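(* Let $k\ge 1$, let $\Lambda=\mathrm{diag}(\alpha_1,\dots,\alpha_k)$ with $\alpha_s\in(0,1]$ for all $s$ and $\sum_{s=1}^k\alpha_s=1$, and let $\Delta^2=(\Delta^2_{s,t})_{s,t=1}^k$ be a nonzero symmetric $k\times k$ matrix with non-negative entries. Consider a multi-species Sherrington--Kirkpatrick (MSK) model with species density matrix $\Lambda$ and variance profile matrix $\Delta^2$, and assume $\Lambda=\Lambda_N+O(N^{-1})$, where $\Lambda_N=\frac1N\mathrm{diag}(|I_1|,\dots,|I_k|)$ is the matrix of species proportions at size $N$ (that is, there is a constant $K$ such that $\bigl|\,|I_s|/N-\alpha_s\bigr|\le K/N$ for all $s$ and all $N\ge k$). Let $F_N(\beta)$ be the free energy at inverse temperature $\beta>0$, and let $$\beta_c=\rho(2\Lambda\Delta^2)^{-1/2},$$ where $\rho(\cdot)$ denotes the spectral radius. If $\Delta^2$ is positive semi-definite, then the following statements hold. 1. There exists a constant $C>0$ (independent of $N$) such that for all $N\ge k$ $$\mathrm{Var}\left(F_N(\beta_c)\right)\le C\left((\log N)^2+1\right).$$ 2. For every fixed $\alpha>0$ and $d>0$, there is a constant $C>0$, depending (for the given model) only on $\alpha$ and $d$ and not on $N$, such that for all $N\ge k$ $$\mathrm{Var}\left(F_N\left(\sqrt{\beta_c^2+dN^{-\alpha}}\right)\right)\le C\left((\log N)^2+N^{1-\alpha}\right).$$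
   Context: MSK model. Fix $k\ge1$, the species density matrix $\Lambda=\mathrm{diag}(\alpha_1,\dots,\alpha_k)$ and the variance profile matrix $\Delta^2$ (here $\Delta^2$ is just the name of a symmetric $k\times k$ matrix with non-negative entries, denoted $\Delta^2_{s,t}$; it is not assumed to be the square of another given matrix). For each $N\ge k$ there is a partition of the spins $\{1,2,\dots,N\}=\bigcup_{s=1}^k I_s$ into $k$ species ($I_s=I_s^{(N)}$ depends on $N$), and with $\Lambda_N:=\frac1N\mathrm{diag}(|I_1|,\dots,|I_k|)$ one has $\lim_{N\to\infty}\Lambda_N=\Lambda$. For a spin configuration $\sigma\in\{-1,1\}^N$ the Hamiltonian is $$H_N(\sigma)=\frac1{\sqrt N}\sum_{i,j=1}^N g_{ij}\sigma_i\sigma_j,$$ where $(g_{ij})_{i,j=1}^N$ are independent centered Gaussian random variables with $\mathbb{E}[g_{ij}^2]=\Delta^2_{s,t}$ for $i\in I_s$ and $j\in I_t$. Free energy. At inverse temperature $\beta>0$, $$F_N(\beta)=\log\sum_{\sigma\in\{-1,1\}^N}\exp\left(\beta H_N(\sigma)\right).$$ $\mathrm{Var}$ denotes the variance with respect to the Gaussian variables $(g_{ij})$. *)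

(* Defs.v *)
From HB Require Import structures.
From mathcomp Require Import all_boot all_order all_algebra.
From mathcomp Require Import all_classical all_reals all_analysis.
From mathcomp.real_closed Require Import complex.

Set Implicit Arguments.
Unset Strict Implicit.
Unset Printing Implicit Defensive.

Import Order.TTheory GRing.Theory Num.Theory.
Import numFieldNormedType.Exports.

Local Open Scope classical_set_scope.
Local Open Scope ring_scope.

(* The complex spectrum of an n x n matrix is finite, and nonempty for n > 0,
   so the supremum is a maximum. *)
Definition spectral_radius (R : realType) (n : nat) (A : 'M[R]_n) : R :=
  sup [set ComplexField.Normc.normc z | z in
         [set z : R[i] | eigenvalue (map_mx (real_complex R) A) z]].

Definition positive_semidefinite (R : realType) (n : nat) (A : 'M[R]_n) : Prop :=
  forall x : 'cV[R]_n, 0 <= (x^T *m A *m x) ord0 ord0.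

Definition mutually_independent (d : measure_display) (T : measurableType d)
    (R : realType) (P : probability T R) (I : finType) (X : I -> T -> R) : Prop :=
  forall (J : {set I}) (B : I -> set R), (forall i, measurable (B i)) ->
    P [set w | forall i, i \in J -> B i (X i w)] =
    (\prod_(i in J) P (X i @^-1` B i))%E.

(* Centered Gaussian law of variance v. The case v = 0 is separate because
   [normal_prob m 0] is the uniform law on [0, 1], not the Dirac mass at m. *)
Definition centered_gaussian_law (R : realType) (v : R) (A : set R) : \bar R :=
  if v == 0 then dirac (0 : R) A else normal_prob 0 (Num.sqrt v) A.

(* The partition of the spins is given by the map sending a spin to its species.
   Only the sizes N >= k matter; each size has its own probability space, and
   nothing is assumed on the joint law of the disorders at different sizes. *)
Record MSK_model (R : realType) (k : nat) (alpha : 'rV[R]_k) (Delta2 : 'M[R]_k) :=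
  MSKModel {
    species : forall N : nat, 'I_N -> 'I_k ;
    species_block (N : nat) (s : 'I_k) : {set 'I_N} :=
      finset (fun i => species i == s) ;
    density_mx (N : nat) : 'M[R]_k :=
      N%:R^-1 *: diag_mx (\row_s #|species_block N s|%:R) ;
    density_mx_cvg : density_mx N @[N --> \oo] --> diag_mx alpha ;
    disp : nat -> measure_display ;
    Omega : forall N : nat, measurableType (disp N) ;
    Prob : forall N : nat, probability (Omega N) R ;
    disorder : forall N : nat, 'I_N -> 'I_N -> {RV (Prob N) >-> R} ;
    disorder_law : forall (N : nat) (i j : 'I_N) (s t : 'I_k), (k <= N)%N ->
      i \in species_block N s -> j \in species_block N t ->
      forall A : set R, measurable A ->
        distribution (Prob N) (disorder i j) A =
        centered_gaussian_law (Delta2 s t) A ;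
    disorder_independent : forall N : nat, (k <= N)%N ->
      mutually_independent (Prob N)
        (fun (ij : 'I_N * 'I_N) w => disorder ij.1 ij.2 w)
  }.

(* Configurations in {-1, 1}^N are encoded as boolean functions: b is (-1)^b. *)
Definition spin (R : realType) (N : nat) (sigma : {ffun 'I_N -> bool}) (i : 'I_N) : R :=
  (-1) ^+ sigma i.

Section MSK.
Context (R : realType) (k : nat) (alpha : 'rV[R]_k) (Delta2 : 'M[R]_k)
  (M : MSK_model alpha Delta2).

Definition hamiltonian (N : nat) (sigma : {ffun 'I_N -> bool}) (w : Omega M N) : R :=
  (Num.sqrt N%:R)^-1 *
  \sum_(i < N) \sum_(j < N) disorder M i j w * spin R sigma i * spin R sigma j.

Definition free_energy (N : nat) (beta : R) (w : Omega M N) : R :=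
  ln (\sum_(sigma : {ffun 'I_N -> bool}) expR (beta * hamiltonian sigma w)).

End MSK.
Arguments free_energy {R k alpha Delta2} M N beta w.

Definition critical_beta (R : realType) (k : nat) (alpha : 'rV[R]_k)
    (Delta2 : 'M[R]_k) : R :=
  spectral_radius (2 *: (diag_mx alpha *m Delta2)) `^ (- 2^-1).

(* Main.v *)
From HB Require Import structures.
Require Import Defs.
From mathcomp Require Import all_boot all_order all_algebra.
From mathcomp Require Import all_classical all_reals all_analysis.
From mathcomp Require Import measurable_realfun ring lra.
From mathcomp.real_closed Require Import complex.

(** The covariance of the energies of two configurations is their overlap
    Q = (beta^2 / N) S^T Delta2 S, where S_s is the sum over the species s of the
    products of the two spins. Let two replicas of the disorder share a proportion
    t of their randomness. Gaussian interpolation writes the variance of the free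
    energy as the integral over t in [0, 1] of the mean overlap of the two replicas,
    each weighted by its Gibbs measure.

    The mean overlap is estimated by replica coupling. Add to the energy of the pair
    the interaction x Q. Positive semidefiniteness makes Q nonnegative, and then
    sharing an amount dt more of the disorder costs no more than raising x by dt
    (lemma [shared_coupled_le]). With u = 1 - t, convexity in x bounds u / 2 times
    the mean overlap at t by the increment of the coupled free energy at t between
    x = 0 and x = u / 2, hence by the increment between 0 and 1 - u / 2 for
    independent disorders (lemma [rademacher_variance_le]). There gauge symmetry
    makes the overlap that of uniformly random configurations, and the increment is
    at most the logarithm of the mean of exp ((1 - u / 2) Q) ([indep_coupled_le]).

    At the critical temperature, Q is at most half of the sum over s of S_s^2 / n_s,
    where n_s is the size of the species s: this is the Rayleigh quotient bound for
    the spectral radius ([spectral_radius_rayleigh]), up to a relative excess of order 1/N due to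
    the finite size, and of the relative excess theta of beta^2. Each S_s is a sum of
    n_s signs, so the exponential moment is that of Gaussian variables,
    at most (4 / u)^k as long as the excess is at most u / 4
    ([avg_expR_overlap_le]). Thus the mean overlap is at most (2 k / u) ln (4 / u);
    integrating over u > 1/p gives a multiple of (ln p)^2 + ln p, while u < 1/p contributes at
    most max Q / p, of order N / p. Taking p of the order of the inverse of the
    excess, the variance is O((ln N)^2 + 1 + N theta) ([msk_variance_uniform]), from
    which both statements follow.

    The interpolation is carried out for a disorder made of random signs: each
    Gaussian variable is replaced by a normalised sum of m signs. All expectations are then
    finite averages over the steps of a random walk, the differential inequalities
    become one-step inequalities with third-order errors, and m steps of size
    m^(-1/2) accumulate an error of order m^(-1/2). Lindeberg's replacement argument
    then returns to Gaussian variables. It applies to bounded smooth test functions,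
    and the variance is reached through 1 - cos (lam (F - c)), letting m tend
    to infinity first and lam to 0 afterwards ([gaussian_variance_le]). *)

Set Implicit Arguments.
Unset Strict Implicit.
Unset Printing Implicit Defensive.

Import Order.TTheory GRing.Theory Num.Theory.
Import numFieldNormedType.Exports.

Local Open Scope ring_scope.


(** * Third-order Taylor bounds *)

Section taylor.
Context {R : realType}.
Implicit Types (x y r : R).

(** The Taylor remainders of the exponential, the sine and the cosine are bounded
    with this one order at a time, since the derivative of each is the previous one. *)
Lemma mvt_bound (g dg : R -> R) (y M : R) :
  (forall t : R, `|t| <= `|y| -> is_derive t 1 g (dg t)) -> g 0 = 0 ->
  (forall t : R, `|t| <= `|y| -> `|dg t| <= M) -> `|g y| <= M * `|y|.
Proof.
move=> dgE g0 dgM.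
have ct t : `|t| <= `|y| -> {for t, continuous g}.
  by move=> /dgE [dg1 _]; exact/differentiable_continuous/derivable1_diffP.
have [y0|y0] := leP 0 y.
  have [||c] := @MVT_segment R g dg 0 y y0.
  - move=> x; rewrite in_itv/= => /andP[x0 xy]; apply: dgE.
    by rewrite (ger0_norm y0) (gtr0_norm x0) ltW.
  - apply: continuous_in_subspaceT => x; rewrite inE/= in_itv/= => /andP[x0 xy].
    by apply: ct; rewrite !ger0_norm.
  rewrite in_itv/= => /andP[c0 cy]; rewrite g0 !subr0 => ->.
  by rewrite normrM ler_wpM2r// dgM// !ger0_norm.
have [||c] := @MVT_segment R g dg y 0 (ltW y0).
- move=> x; rewrite in_itv/= => /andP[x0 xy]; apply: dgE.
  by rewrite (ltr0_norm y0) (ltr0_norm xy) lerN2 ltW.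
- apply: continuous_in_subspaceT => x; rewrite inE/= in_itv/= => /andP[yx x0x].
  by apply: ct; rewrite (ltr0_norm y0) (ler0_norm x0x) lerN2.
rewrite in_itv/= => /andP[c0 cy]; rewrite g0 !sub0r => /eqP.
rewrite mulrN eqr_opp => /eqP ->.
by rewrite normrM ler_wpM2r// dgM// (ltr0_norm y0) (ler0_norm cy) lerN2.
Qed.

Lemma norm_expR_le4 x : `|x| <= 1 -> expR x <= 4.
Proof.
move=> x1; apply: (@le_trans _ _ (expR 1)).
  by rewrite ler_expR (le_trans (ler_norm _)).
have -> : expR 1 = expR (- - 2^-1 + - - 2^-1) :> R by congr expR; lra.
rewrite expRD expRN -invfM -[leRHS]invrK lef_pV2 ?posrE ?mulr_gt0 ?expR_gt0//.
have h : 2^-1 <= expR (- 2^-1 : R).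
  by apply: le_trans (expR_ge1Dx _); lra.
have -> : 4^-1 = 2^-1 * 2^-1 :> R by field.
by rewrite ler_pM ?invr_ge0.
Qed.

Lemma expR_taylor1 x : `|x| <= 1 -> `|expR x - 1| <= 4 * `|x|.
Proof.
move=> x1; apply: (@mvt_bound (fun x => expR x - 1) expR).
- by move=> t _; apply: is_derive_eq; rewrite subr0// /GRing.scale/= mulr1.
- by rewrite expR0 subrr.
- move=> t tx; rewrite ger0_norm ?expR_ge0//; apply: norm_expR_le4.
  exact: le_trans tx x1.
Qed.

Lemma expR_taylor2 x : `|x| <= 1 -> `|expR x - 1 - x| <= 4 * `|x| ^+ 2.
Proof.
move=> x1; rewrite expr2 mulrA.
apply: (@mvt_bound (fun x => expR x - 1 - x) (fun x => expR x - 1)).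
- by move=> t _; apply: is_derive_eq; rewrite subr0// /GRing.scale/= mulr1.
- by rewrite expR0 subrr subr0.
- move=> t tx; apply: (le_trans (expR_taylor1 (le_trans tx x1))).
  by rewrite ler_pM2l.
Qed.

Lemma expR_taylor3 x : `|x| <= 1 ->
  `|expR x - 1 - x - x ^+ 2 / 2| <= 4 * `|x| ^+ 3.
Proof.
move=> x1; rewrite (exprSr `|_|) mulrA.
apply: (@mvt_bound (fun x => expR x - 1 - x - x ^+ 2 / 2)
  (fun x => expR x - 1 - x)).
- move=> t _; apply: is_derive_eq; rewrite /GRing.scale/=.
  by field.
- by rewrite expR0 expr0n mul0r subrr !subr0.
- move=> t tx; apply: (le_trans (expR_taylor2 (le_trans tx x1))).
  by rewrite ler_pM2l// lerXn2r// nnegrE.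
Qed.

Lemma ln_taylor3 y : `|y| <= 2^-1 ->
  `|ln (1 + y) - y + y ^+ 2 / 2| <= 2 * `|y| ^+ 3.
Proof.
move=> y1; rewrite (exprSr `|_|) mulrA.
have pos t : `|t| <= `|y| -> 2^-1 <= 1 + t.
  by move=> ty; have := le_trans ty y1; rewrite ler_norml => /andP[]; lra.
apply: (@mvt_bound (fun x => ln (1 + x) - x + x ^+ 2 / 2)
  (fun x => x ^+ 2 / (1 + x))).
- move=> t /pos t1; have t0 : 0 < 1 + t by lra.
  have dl : is_derive t 1 (fun x : R => ln (1 + x)) ((1 + t)^-1).
    have -> : (fun x : R => ln (1 + x)) = @ln R \o shift 1.
      by apply/funext => x /=; rewrite addrC.
    rewrite -[X in is_derive _ _ _ X]mulr1; apply: is_derive1_comp.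
      by rewrite /= addrC; exact: is_derive1_ln.
    exact: is_derive_shift.
  apply: is_derive_eq; rewrite /GRing.scale/=.
  have t0' : 1 + t != 0 by rewrite gt_eqF.
  by field.
- by rewrite addr0 ln1; lra.
- move=> t ty; have t1 := pos t ty.
  rewrite normrM normrX normfV (ger0_norm (_ : 0 <= 1 + t)); last lra.
  rewrite ler_pdivrMr; last lra.
  have ty2 : `|t| ^+ 2 <= `|y| ^+ 2 by rewrite lerXn2r// nnegrE.
  have : 0 <= `|y| ^+ 2 by [].
  nra.
Qed.

Lemma sin_bound x : `|sin x| <= `|x|.
Proof.
rewrite -[leRHS]mul1r; apply: (@mvt_bound (fun x => sin x) (fun x => cos x)).
- exact: (sin0 R).
- by move=> t _; rewrite ler_norml cos_geN1 cos_le1.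
Qed.

Lemma cos_bound2 x : `|cos x - 1| <= `|x| ^+ 2.
Proof.
rewrite expr2; apply: (@mvt_bound (fun x => cos x - 1) (fun x => - sin x)).
- by move=> t _; apply: is_derive_eq; rewrite subr0// /GRing.scale/= mulr1.
- by rewrite cos0 subrr.
- by move=> t tx; rewrite normrN (le_trans (sin_bound t)).
Qed.

Lemma sin_bound3 x : `|sin x - x| <= `|x| ^+ 3.
Proof.
rewrite exprSr; apply: (@mvt_bound (fun x => sin x - x) (fun x => cos x - 1)).
- by rewrite sin0 subrr.
- by move=> t tx; rewrite (le_trans (cos_bound2 t))// lerXn2r// nnegrE.
Qed.

Lemma cos_bound4 x : `|cos x - 1 + x ^+ 2 / 2| <= `|x| ^+ 4.
Proof.
rewrite (exprSr _ 3); apply: (@mvt_bound (fun x => cos x - 1 + x ^+ 2 / 2)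
  (fun x => - (sin x - x))).
- move=> t _; apply: is_derive_eq; rewrite /GRing.scale/=.
  by field.
- by rewrite cos0 subrr expr0n mul0r addr0.
- by move=> t tx; rewrite normrN (le_trans (sin_bound3 t))// lerXn2r// nnegrE.
Qed.

End taylor.

(** * Finite averages and averages over translations *)

Section average.
Context {R : realType} {I : finType}.
Implicit Types (f g : I -> R) (c : R).

Definition avg f : R := #|I|%:R^-1 * \sum_i f i.

Lemma eq_avg f g : f =1 g -> avg f = avg g.
Proof. by move=> fg; rewrite /avg (eq_bigr g). Qed.

Lemma avgD f g : avg (fun i => f i + g i) = avg f + avg g.
Proof. by rewrite /avg big_split mulrDr. Qed.

Lemma avgZ c f : avg (fun i => c * f i) = c * avg f.
Proof. by rewrite /avg -mulr_sumr mulrCA. Qed.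

Lemma avgZr c f : avg (fun i => f i * c) = avg f * c.
Proof. by rewrite /avg -mulr_suml mulrA. Qed.

Lemma avgN f : avg (fun i => - f i) = - avg f.
Proof. by rewrite /avg sumrN mulrN. Qed.

Lemma avgB f g : avg (fun i => f i - g i) = avg f - avg g.
Proof. by rewrite avgD avgN. Qed.

Lemma avg0 : avg (fun => 0) = 0.
Proof. by rewrite /avg big1// mulr0. Qed.

Lemma le_avg f g : (forall i, f i <= g i) -> avg f <= avg g.
Proof. by move=> fg; rewrite /avg ler_wpM2l ?invr_ge0// ler_sum. Qed.

Lemma norm_avg f : `|avg f| <= avg (fun i => `|f i|).
Proof.
rewrite /avg normrM ger0_norm ?invr_ge0// ler_wpM2l ?invr_ge0//.
exact: ler_norm_sum.
Qed.

Lemma avg_cst (i0 : I) c : avg (fun => c) = c.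
Proof.
rewrite /avg sumr_const -[c *+ _]mulr_natl mulrA mulVf ?mul1r// pnatr_eq0.
by rewrite -lt0n; apply/card_gt0P; exists i0.
Qed.

Lemma avg_sum (J : finType) (F : J -> I -> R) :
  avg (fun i => \sum_j F j i) = \sum_j avg (F j).
Proof. by rewrite /avg exchange_big/= mulr_sumr. Qed.

Lemma avg_reindex (h : I -> I) f : bijective h -> avg f = avg (f \o h).
Proof. by move=> bh; rewrite /avg (reindex h)//; exact: onW_bij. Qed.

End average.

Lemma avg_swap {R : realType} {I J : finType} (F : I -> J -> R) :
  avg (fun i => avg (F i)) = avg (fun j => avg (F^~ j)).
Proof. by rewrite /avg -!mulr_sumr mulrCA exchange_big. Qed.

Lemma avg_pair {R : realType} {I J : finType} (F : I -> J -> R) :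
  avg (fun p : I * J => F p.1 p.2) = avg (fun i => avg (F i)).
Proof.
rewrite /avg -mulr_sumr card_prod natrM invfM -mulrA.
by congr (_ * (_ * _)); rewrite pair_big.
Qed.

Lemma avg_gt0 {R : realType} {I : finType} (i0 : I) (f : I -> R) :
  (forall i, 0 < f i) -> 0 < avg f.
Proof.
move=> f0; rewrite /avg mulr_gt0// ?invr_gt0 ?ltr0n.
  by apply/card_gt0P; exists i0.
by rewrite (bigD1 i0)//= ltr_wpDr// sumr_ge0// => i _; exact/ltW.
Qed.

Lemma ln_le_subr1 {R : realType} (x : R) : 0 < x -> ln x <= x - 1.
Proof.
by move=> x0; rewrite -{1}(subrKC 1 x) le_ln1Dx// ltrBrDl subrr.
Qed.

(** Jensen's inequality for the logarithm, by its tangent at the mean. *)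
Lemma avg_ln {R : realType} {I : finType} (i0 : I) (f : I -> R) :
  (forall i, 0 < f i) -> avg (fun i => ln (f i)) <= ln (avg f).
Proof.
move=> f0; have a0 := avg_gt0 i0 f0.
have : avg (fun i => ln (f i)) <= avg (fun i => ln (avg f) + (f i / avg f - 1)).
  apply: le_avg => i; rewrite -{1}(divfK (lt0r_neq0 a0) (f i)).
  by rewrite lnM ?posrE ?divr_gt0// addrC lerD2l ln_le_subr1// divr_gt0.
by rewrite avgD (avg_cst i0) avgB avgZr (avg_cst i0) divff ?gt_eqF// subrr addr0.
Qed.

Section translation_average.
Context {R : realType} {V : zmodType}.
Implicit Types (f g : V -> R) (a : V).

(** The transition operator of the random walk with uniform steps u. *)
Definition tav {I : finType} (u : I -> V) f : V -> R :=
  fun a => avg (fun i => f (a + u i)).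

Section one.
Context {I : finType} (i0 : I) (u : I -> V).

Lemma le_tav f g : (forall a, f a <= g a) -> forall a, tav u f a <= tav u g a.
Proof. by move=> fg a; apply: le_avg. Qed.

Lemma tavD f g : tav u (fun a => f a + g a) = fun a => tav u f a + tav u g a.
Proof. by apply/funext => a; rewrite /tav avgD. Qed.

Lemma tavZ c f : tav u (fun a => c * f a) = fun a => c * tav u f a.
Proof. by apply/funext => a; rewrite /tav avgZ. Qed.

Lemma tav_cst c : tav u (fun => c) = fun => c.
Proof. by apply/funext => a; rewrite /tav (avg_cst i0). Qed.

Lemma le_iter_tav n f g : (forall a, f a <= g a) ->
  forall a, iter n (tav u) f a <= iter n (tav u) g a.
Proof. by move=> fg; elim: n => //= n IH; exact: le_tav. Qed.

Lemma iter_tavD n f g : iter n (tav u) (fun a => f a + g a) =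
  fun a => iter n (tav u) f a + iter n (tav u) g a.
Proof. by elim: n => //= n ->; rewrite tavD. Qed.

Lemma iter_tavZ n c f : iter n (tav u) (fun a => c * f a) =
  fun a => c * iter n (tav u) f a.
Proof. by elim: n => //= n ->; rewrite tavZ. Qed.

Lemma iter_tav_cst n c : iter n (tav u) (fun => c) = fun => c.
Proof. by elim: n => //= n ->; rewrite tav_cst. Qed.

Lemma iter_tavDc n f c : iter n (tav u) (fun a => f a + c) =
  fun a => iter n (tav u) f a + c.
Proof. by rewrite iter_tavD iter_tav_cst. Qed.

End one.

(** Translations commute, so that the steps of several walks can be reordered. *)
Lemma tavC {I J : finType} (u : I -> V) (v : J -> V) f :
  tav u (tav v f) = tav v (tav u f).
Proof.
apply/funext => a; rewrite /tav avg_swap; apply: eq_avg => j.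
by apply: eq_avg => i; rewrite addrAC.
Qed.

Lemma iter_tavC {I J : finType} (u : I -> V) (v : J -> V) n f :
  tav u (iter n (tav v) f) = iter n (tav v) (tav u f).
Proof. by elim: n => //= n IH; rewrite tavC IH. Qed.

End translation_average.

(** * Rademacher signs *)

Section signs.
Context {R : realType} {E : finType}.
Implicit Types (eta : {ffun E -> bool}) (e : E).

Definition sg (b : bool) : R := (-1) ^+ b.

Lemma sgM b : sg b * sg b = 1.
Proof. by rewrite /sg -expr2 sqrr_sign. Qed.

Lemma sgN b : sg (~~ b) = - sg b.
Proof. by rewrite /sg signrN. Qed.

Lemma norm_sg b : `|sg b| = 1.
Proof. by rewrite /sg normr_sign. Qed.

Definition flip e eta : {ffun E -> bool} :=
  [ffun e' => if e' == e then ~~ eta e' else eta e'].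

Lemma flipK e : involutive (flip e).
Proof. by move=> eta; apply/ffunP => e'; rewrite !ffunE; case: eqP; rewrite ?negbK. Qed.

Lemma avg_flip e (f : {ffun E -> bool} -> R) : avg (fun eta => f (flip e eta)) = avg f.
Proof. by rewrite [RHS](@avg_reindex _ _ _ f (inv_bij (flipK e))). Qed.

Lemma avg_sg e : avg (fun eta => sg (eta e)) = 0 :> R.
Proof.
have : avg (fun eta => sg (eta e)) = - avg (fun eta => sg (eta e)) :> R.
  rewrite -{1}(avg_flip e) -avgN; apply: eq_avg => eta.
  by rewrite ffunE eqxx sgN.
by move=> h; lra.
Qed.

Lemma avg_sgM e e' : avg (fun eta => sg (eta e) * sg (eta e')) = (e == e')%:R :> R.
Proof.
have [->|ee'] := eqVneq e e'.
  rewrite -[RHS](@avg_cst _ {ffun E -> bool} [ffun => true] 1).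
  by apply: eq_avg => eta; rewrite sgM.
set A := avg _; have : A = - A :> R.
  rewrite /A -{1}(avg_flip e) -avgN; apply: eq_avg => eta.
  by rewrite !ffunE eqxx eq_sym (negbTE ee') sgN mulNr.
by rewrite mulr0n => h; lra.
Qed.

Lemma avg_lin (c : E -> R) : avg (fun eta => \sum_e c e * sg (eta e)) = 0.
Proof. by rewrite avg_sum big1// => e _; rewrite avgZ avg_sg mulr0. Qed.

Lemma avg_lin2 (c d : E -> R) :
  avg (fun eta => (\sum_e c e * sg (eta e)) * (\sum_e d e * sg (eta e))) =
  \sum_e c e * d e.
Proof.
under eq_avg do rewrite big_distrl/=.
rewrite avg_sum; apply: eq_bigr => e _.
under eq_avg do rewrite big_distrr/=.
rewrite avg_sum (bigD1 e)//= big1 ?addr0 => [|e' e'e].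
  under eq_avg do rewrite mulrACA.
  by rewrite avgZ avg_sgM eqxx mulr1.
under eq_avg do rewrite mulrACA.
by rewrite avgZ avg_sgM eq_sym (negbTE e'e) mulr0.
Qed.

End signs.

(** * Gibbs averages and the log-partition function *)

Section gibbs.
Context {R : realType} {P : finType} (p0 : P).
Implicit Types (U d f g : P -> R).

Definition gz U : R := \sum_p expR (U p).
Definition gav U f : R := (\sum_p f p * expR (U p)) / gz U.
Definition lse U : R := ln (gz U).

Lemma gz_gt0 U : 0 < gz U.
Proof.
by rewrite /gz (bigD1 p0)//= ltr_wpDr ?expR_gt0// sumr_ge0// => i _; exact: expR_ge0.
Qed.

Lemma eq_gav U f g : f =1 g -> gav U f = gav U g.
Proof. by move=> fg; rewrite /gav; under eq_bigr do rewrite fg. Qed.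

Lemma eq_lse U d : U =1 d -> lse U = lse d.
Proof. by move=> Ud; rewrite /lse /gz; under eq_bigr do rewrite Ud. Qed.

Lemma gavD U f g : gav U (fun p => f p + g p) = gav U f + gav U g.
Proof.
rewrite /gav -mulrDl -big_split/=; congr (_ / _).
by apply: eq_bigr => p _; rewrite mulrDl.
Qed.

Lemma gavZ U c f : gav U (fun p => c * f p) = c * gav U f.
Proof.
rewrite /gav mulrA; congr (_ / _); rewrite mulr_sumr.
by apply: eq_bigr => p _; rewrite mulrA.
Qed.

Lemma gavN U f : gav U (fun p => - f p) = - gav U f.
Proof. by rewrite -mulN1r -gavZ; apply: eq_gav => p; rewrite mulN1r. Qed.

Lemma gavB U f g : gav U (fun p => f p - g p) = gav U f - gav U g.
Proof. by rewrite gavD gavN. Qed.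

Lemma gav_cst U c : gav U (fun => c) = c.
Proof.
by rewrite /gav -mulr_sumr -mulrA divff ?mulr1// gt_eqF// gz_gt0.
Qed.

Lemma le_gav U f g : (forall p, f p <= g p) -> gav U f <= gav U g.
Proof.
move=> fg; rewrite /gav ler_pM2r ?invr_gt0 ?gz_gt0//; apply: ler_sum => p _.
by rewrite ler_wpM2r ?expR_ge0.
Qed.

Lemma gav_ge0 U f : (forall p, 0 <= f p) -> 0 <= gav U f.
Proof. by move=> f0; rewrite -(gav_cst U 0) le_gav. Qed.

Lemma gav_le U f c : (forall p, f p <= c) -> gav U f <= c.
Proof. by move=> fc; rewrite -[leRHS](gav_cst U) le_gav. Qed.

Lemma norm_gav_le U f c : (forall p, `|f p| <= c) -> `|gav U f| <= c.
Proof.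
move=> fc; rewrite ler_norml; apply/andP; split.
  by rewrite -(gav_cst U (- c)) le_gav// => p; have := fc p; rewrite ler_norml => /andP[].
by apply: gav_le => p; have := fc p; rewrite ler_norml => /andP[].
Qed.

Lemma gav_avg {I : finType} U (f : I -> P -> R) :
  gav U (fun p => avg (f^~ p)) = avg (fun i => gav U (f i)).
Proof.
rewrite /gav avgZr avg_sum; congr (_ / _).
by apply: eq_bigr => p _; rewrite avgZr.
Qed.

Lemma gavM U f g : gav U f * gav U g = gav U (fun p => gav U (fun q => f p * g q)).
Proof.
rewrite mulrC -gavZ; apply: eq_gav => p.
by rewrite mulrC -gavZ.
Qed.

Lemma lse_shift U d :
  lse (fun p => U p + d p) = lse U + ln (gav U (fun p => expR (d p))).
Proof.
rewrite /lse /gav -lnM ?posrE ?gz_gt0 ?divr_gt0 ?gz_gt0//; last first.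
  by rewrite (bigD1 p0)//= ltr_wpDr ?mulr_gt0 ?expR_gt0// sumr_ge0.
rewrite mulrCA divff ?mulr1 ?gt_eqF ?gz_gt0//; congr ln.
by apply: eq_bigr => p _; rewrite expRD mulrC.
Qed.

Lemma lse_shift_cst U c : lse (fun p => U p + c) = lse U + c.
Proof. by rewrite lse_shift gav_cst expRK. Qed.

(** Convexity of the log-partition function: it lies above its tangents. *)
Lemma lse_tangent U d : gav U d <= lse (fun p => U p + d p) - lse U.
Proof.
rewrite lse_shift addrAC subrr add0r; set m := gav U d.
have h : expR m <= gav U (fun p => expR (d p)).
  apply: (@le_trans _ _ (gav U (fun p => expR m * (1 + (d p - m))))).
    by rewrite gavZ gavD gavB !gav_cst subrr addr0 mulr1.
  apply: le_gav => p; rewrite -[in leRHS](subrKC m (d p)) expRD.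
  by rewrite ler_pM2l ?expR_gt0// expR_ge1Dx.
by rewrite -[leLHS]expRK ler_ln ?posrE ?expR_gt0// (lt_le_trans _ h)// expR_gt0.
Qed.

(** The first two derivatives of the log-partition function are the Gibbs mean and
    the Gibbs variance of the perturbation. *)
Lemma lse_taylor U d r : r <= 4^-1 -> (forall p, `|d p| <= r) ->
  `|lse (fun p => U p + d p) - lse U - gav U d
    - 2^-1 * (gav U (fun p => d p ^+ 2) - gav U d ^+ 2)| <= 23 * r ^+ 3.
Proof.
move=> r4 dr; have r0 : 0 <= r by exact: le_trans (dr p0).
rewrite lse_shift (addrC (lse U)) addrK.
set m1 := gav U d; set m2 := gav U (fun p => d p ^+ 2).
pose y := gav U (fun p => expR (d p)) - 1.
have -> : gav U (fun p => expR (d p)) = 1 + y by rewrite /y; lra.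
have m1r : `|m1| <= r by exact: norm_gav_le.
have m2r : `|m2| <= r ^+ 2.
  apply: norm_gav_le => p; rewrite ger0_norm ?sqr_ge0//.
  by rewrite -(real_normK (num_real _)) lerXn2r// nnegrE.
have er : `|y - m1 - m2 / 2| <= 4 * r ^+ 3.
  rewrite /y /m1 /m2 -{1}(gav_cst U 1) -gavB -gavB [_ / 2]mulrC -gavZ -gavB.
  apply: norm_gav_le => p; rewrite (mulrC 2^-1).
  apply: (le_trans (expR_taylor3 _)); first by apply: le_trans (dr p) _; lra.
  by rewrite ler_pM2l// lerXn2r// nnegrE.
move: er m1r m2r; rewrite !ler_norml => /andP[e1 e2] /andP[m11 m12] /andP[m21 m22].
have r2 : r ^+ 2 <= r / 4 by rewrite expr2; nra.
have r3 : r ^+ 3 <= r ^+ 2 / 4 by rewrite exprS mulrC ler_wpM2l ?sqr_ge0.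
have r20 : 0 <= r ^+ 2 by exact: sqr_ge0.
have yr : `|y| <= 2 * r by rewrite ler_norml; apply/andP; split; lra.
have := @ln_taylor3 R y; have -> : `|y| <= 2^-1 by lra.
move=> /(_ isT) hl.
have {}hl : `|ln (1 + y) - y + y ^+ 2 / 2| <= 16 * r ^+ 3.
  apply: (le_trans hl); rewrite (_ : 16 * r ^+ 3 = 2 * (2 * r) ^+ 3); last by ring.
  by rewrite ler_pM2l// lerXn2r// nnegrE// mulr_ge0.
have hm : `|y ^+ 2 - m1 ^+ 2| <= 6 * r ^+ 3.
  rewrite subr_sqr normrM (_ : 6 * r ^+ 3 = (2 * r ^+ 2) * (3 * r)); last by ring.
  apply: ler_pM => //; rewrite ler_norml; first by apply/andP; split; lra.
  by move: yr; rewrite ler_norml => /andP[y1 y2]; apply/andP; split; lra.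
move: hl hm; rewrite !ler_norml => /andP[l1 l2] /andP[h1 h2].
by apply/andP; split; lra.
Qed.

Lemma lse_taylor1 U d r : r <= 4^-1 -> (forall p, `|d p| <= r) ->
  `|lse (fun p => U p + d p) - lse U - gav U d| <= 7 * r ^+ 2.
Proof.
move=> r4 dr; have r0 : 0 <= r by exact: le_trans (dr p0).
have := lse_taylor U r4 dr.
have m1r : `|gav U d| <= r by exact: norm_gav_le.
have m1r2 : gav U d ^+ 2 <= r ^+ 2.
  by rewrite -(real_normK (num_real (gav _ _))) lerXn2r// nnegrE.
have m2r : gav U (fun p => d p ^+ 2) <= r ^+ 2.
  apply: gav_le => p.
  by rewrite -(real_normK (num_real _)) lerXn2r// nnegrE.
have m20 : 0 <= gav U (fun p => d p ^+ 2) by apply: gav_ge0 => p; exact: sqr_ge0.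
have m10 : 0 <= gav U d ^+ 2 by exact: sqr_ge0.
have r3 : r ^+ 3 <= r ^+ 2 / 4 by rewrite exprS mulrC ler_wpM2l ?sqr_ge0.
by rewrite !ler_norml => /andP[l1 l2]; apply/andP; split; lra.
Qed.

End gibbs.

(** * Correlated replicas of a Gibbs measure *)

(** For centred increments d of covariance K and a deterministic increment w, the
    first-order term of the expansion averages to the mean of w, and the Gibbs
    variance of d to the diagonal of K minus its mean over independent pairs. *)
Lemma avg_lse_taylor {R : realType} {P I : finType} (p0 : P) (i0 : I)
    (U w : P -> R) (d : I -> P -> R) (K : P -> P -> R) (r : R) :
  (forall p, avg (d^~ p) = 0) ->
  (forall p q, avg (fun i => d i p * d i q) = K p q) ->
  r <= 4^-1 -> (forall i p, `|d i p + w p| <= r) ->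
  `|avg (fun i => lse (fun p => U p + (d i p + w p))) - lse U - gav U w
    - 2^-1 * (gav U (fun p => K p p) - gav U (fun p => gav U (K p))
      + (gav U (fun p => w p ^+ 2) - gav U w ^+ 2))| <= 23 * r ^+ 3.
Proof.
move=> d0 dK r4 dwr.
pose T i := gav U (fun p => d i p + w p)
   + 2^-1 * (gav U (fun p => (d i p + w p) ^+ 2)
       - gav U (fun p => d i p + w p) ^+ 2).
have TE : avg T = gav U w + 2^-1 * (gav U (fun p => K p p)
    - gav U (fun p => gav U (K p))
    + (gav U (fun p => w p ^+ 2) - gav U w ^+ 2)).
  have e1 : avg (fun i => gav U (d i)) = 0.
    by rewrite -gav_avg (eq_gav _ d0) gav_cst.
  have e2 : avg (fun i => gav U (fun p => d i p ^+ 2)) = gav U (fun p => K p p).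
    by rewrite -gav_avg; apply: eq_gav => p; rewrite -dK.
  have e3 : avg (fun i => gav U (d i) ^+ 2) = gav U (fun p => gav U (K p)).
    under eq_avg do rewrite expr2 gavM.
    rewrite -gav_avg; apply: eq_gav => p; rewrite -gav_avg.
    by apply: eq_gav => q; rewrite dK.
  have e4 : avg (fun i => gav U (fun p => w p * d i p)) = 0.
    rewrite -gav_avg -[RHS](gav_cst p0 U); apply: eq_gav => p.
    by rewrite avgZ d0 mulr0.
  transitivity (avg (fun i => gav U (d i) + gav U w + 2^-1 *
    (gav U (fun p => d i p ^+ 2) + 2 * gav U (fun p => w p * d i p)
     + gav U (fun p => w p ^+ 2) - (gav U (d i) ^+ 2
       + (2 * gav U w) * gav U (d i) + gav U w ^+ 2)))).
    apply: eq_avg => i; rewrite /T gavD; congr (_ + _ * (_ - _)); last by ring.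
    by rewrite -gavZ -!gavD; apply: eq_gav => p; ring.
  set w1 := gav U w; set w2 := gav U (fun p => w p ^+ 2).
  clearbody w1 w2.
  rewrite !avgD (avg_cst i0) e1 avgZ avgB !avgD !avgZ e2 e3 e4 e1 !(avg_cst i0).
  by ring.
rewrite -addrA -opprD -(addrA (avg _)) -opprD addrA -addrA -TE.
rewrite -{1}(avg_cst i0 (lse U)) -avgD -avgB.
apply: (le_trans (norm_avg _)); rewrite -[leRHS](avg_cst i0); apply: le_avg => i.
have := lse_taylor p0 U r4 (dwr i); rewrite /T opprD addrA.
by congr (_ <= _); congr (`| _ |); ring.
Qed.

Section replicas.
Context {R : realType} {E S : finType} (s0 : S).
Variables (b : E -> S -> R) (kappa : E -> R).
Local Notation V := {ffun E -> R}.
Implicit Types (x y : V) (ab : V * V) (eta : {ffun E -> bool}) (r t : R).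

Definition energy x (s : S) : R := \sum_e b e s * x e.
Definition fe x : R := lse (energy x).
Definition overlap (s t : S) : R := \sum_e (kappa e * b e s) * (kappa e * b e t).
Definition step r eta : V := [ffun e => r * (kappa e * sg (eta e))].
Definition field eta (s : S) : R := \sum_e (kappa e * b e s) * sg (eta e).

Lemma energyD x y s : energy (x + y) s = energy x s + energy y s.
Proof.
by rewrite /energy -big_split/=; apply: eq_bigr => e _; rewrite ffunE mulrDr.
Qed.

Lemma energy_step r eta s : energy (step r eta) s = r * field eta s.
Proof.
rewrite /energy /field mulr_sumr; apply: eq_bigr => e _.
by rewrite ffunE; ring.
Qed.

Lemma avg_field s : avg (field^~ s) = 0.
Proof. exact: avg_lin. Qed.

Lemma avg_fieldM s s' : avg (fun eta => field eta s * field eta s') = overlap s s'.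
Proof. exact: avg_lin2. Qed.

Lemma overlapC s s' : overlap s s' = overlap s' s.
Proof. by apply: eq_bigr => e _; rewrite mulrC. Qed.

(** [shared] and [indep] add to the disorders of two replicas one step of the walk,
    common to both or drawn independently. *)
Definition shared r : (V * V -> R) -> V * V -> R :=
  tav (fun eta => (step r eta, step r eta)).
Definition indep r : (V * V -> R) -> V * V -> R :=
  tav (fun eta : {ffun E -> bool} * {ffun E -> bool} =>
         (step r eta.1, step r eta.2)).

Definition energy2 ab (p : S * S) : R := energy ab.1 p.1 + energy ab.2 p.2.
(** The tilt by the overlap is chosen so that the derivative in t at 0 is the mean
    overlap of the two replicas. *)
Definition coupled t ab : R :=
  lse (fun p : S * S => energy2 ab p + t * overlap p.1 p.2).
Definition mean_overlap ab : R := gav (energy2 ab) (fun p => overlap p.1 p.2).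
Definition fe2 ab : R := fe ab.1 * fe ab.2.

Local Notation eta0 := ([ffun => true] : {ffun E -> bool}).

Definition fbound : R := 1 + \sum_e \sum_s `|kappa e * b e s|.

Lemma fbound_ge1 : 1 <= fbound.
Proof. by rewrite /fbound lerDl sumr_ge0// => e _; rewrite sumr_ge0. Qed.

Lemma le_fbound s : \sum_e `|kappa e * b e s| <= fbound.
Proof.
rewrite /fbound ler_wpDl//; apply: ler_sum => e _.
by rewrite (bigD1 s)//= ler_wpDr// sumr_ge0.
Qed.

Lemma norm_field eta s : `|field eta s| <= fbound.
Proof.
apply: le_trans (le_fbound s); apply: (le_trans (ler_norm_sum _ _ _)).
by apply: ler_sum => e _; rewrite normrM norm_sg mulr1.
Qed.

Lemma norm_overlap s s' : `|overlap s s'| <= fbound ^+ 2.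
Proof.
apply: (le_trans (ler_norm_sum _ _ _)).
apply: (@le_trans _ _ ((\sum_e `|kappa e * b e s|) * (\sum_e `|kappa e * b e s'|))).
  rewrite mulr_suml; apply: ler_sum => e _; rewrite normrM ler_wpM2l//.
  by rewrite (bigD1 e)//= ler_wpDr// sumr_ge0.
rewrite expr2; apply: ler_pM; rewrite ?le_fbound//; by apply: sumr_ge0.
Qed.

Lemma gav_prod (U W : S -> R) (f : S -> S -> R) :
  gav (fun p : S * S => U p.1 + W p.2) (fun p => f p.1 p.2) =
  gav U (fun s => gav W (f s)).
Proof.
rewrite /gav /gz.
have -> : \sum_(p : S * S) expR (U p.1 + W p.2) =
    (\sum_s expR (U s)) * (\sum_s expR (W s)).
  rewrite big_distrl/= (eq_bigr (fun s => \sum_s' expR (U s + W s'))).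
    by rewrite pair_big.
  by move=> s _; rewrite big_distrr/=; apply: eq_bigr => s' _; rewrite expRD.
rewrite -(pair_big xpredT xpredT (fun s s' => f s s' * expR (U s + W s')))/=.
rewrite invfM mulrA mulrAC; congr (_ / _); rewrite mulr_suml.
apply: eq_bigr => s _; rewrite mulrAC; congr (_ / _); rewrite mulr_suml.
by apply: eq_bigr => s' _; rewrite expRD; ring.
Qed.

Lemma lse_prod (U W : S -> R) :
  lse (fun p : S * S => U p.1 + W p.2) = lse U + lse W.
Proof.
rewrite /lse -lnM ?posrE ?(gz_gt0 s0)//; congr ln; rewrite /gz.
rewrite big_distrl/= (eq_bigr (fun s => \sum_s' expR (U s + W s'))).
  by rewrite pair_big.
by move=> s _; rewrite big_distrr/=; apply: eq_bigr => s' _; rewrite expRD.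
Qed.

Lemma coupled0 ab : coupled 0 ab = fe ab.1 + fe ab.2.
Proof. by rewrite -lse_prod; apply: eq_lse => p; rewrite mul0r addr0. Qed.

(** Convexity in t. *)
Lemma mean_overlap_le t ab : t * mean_overlap ab <= coupled t ab - coupled 0 ab.
Proof.
rewrite /mean_overlap -gavZ /coupled.
rewrite [X in _ - X](_ : _ = lse (energy2 ab)); last first.
  by apply: eq_lse => p; rewrite mul0r addr0.
exact: (lse_tangent (s0, s0)).
Qed.

(** Where positive semidefiniteness enters: correlating one more step of the
    disorders of two coupled replicas increases their log-partition function by
    the mean overlap of the coupled pair, up to the overlap between two
    independent pairs, which has a sign. *)
Lemma shared_coupled_le t r ab :
  (forall s s', 0 <= overlap s s') -> 0 <= r -> r * (3 * fbound ^+ 2) <= 4^-1 ->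
  shared r (coupled (t - r ^+ 2)) ab <=
  indep r (coupled t) ab + 47 * (r * (3 * fbound ^+ 2)) ^+ 3.
Proof.
move=> Q0 r0 rK; set K := fbound in rK *; set rho := r * _ in rK *.
have K1 : 1 <= K := fbound_ge1.
have K12 : K <= K ^+ 2 by rewrite expr2 ler_peMl// (le_trans _ K1).
have r1 : r <= 1 by rewrite /rho in rK; nra.
pose U p := energy2 ab p + t * overlap p.1 p.2.
pose ds eta (p : S * S) := r * (field eta p.1 + field eta p.2).
pose di (e2 : {ffun E -> bool} * {ffun E -> bool}) (p : S * S) :=
  r * (field e2.1 p.1 + field e2.2 p.2).
pose w (p : S * S) := - (r ^+ 2 * overlap p.1 p.2).
pose Ks (p q : S * S) := r ^+ 2 * (overlap p.1 q.1 + overlap p.1 q.2 +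
  (overlap p.2 q.1 + overlap p.2 q.2)).
pose Ki (p q : S * S) := r ^+ 2 * (overlap p.1 q.1 + overlap p.2 q.2).
(* Both sides are averages of log-partition functions around the same energy U,
   the loss of r ^+ 2 in the coupling being the drift w. *)
have hs : shared r (coupled (t - r ^+ 2)) ab =
    avg (fun eta => lse (fun p => U p + (ds eta p + w p))).
  apply: eq_avg => eta; apply: eq_lse => p; rewrite /energy2/= !energyD.
  by rewrite !energy_step /U /ds /w /energy2; ring.
have hi : indep r (coupled t) ab =
    avg (fun e2 => lse (fun p => U p + (di e2 p + 0))).
  apply: eq_avg => eta; apply: eq_lse => p; rewrite /energy2/= !energyD.
  by rewrite !energy_step /U /di /energy2; ring.
have ds0 p : avg (ds^~ p) = 0 by rewrite avgZ avgD !avg_field addr0 mulr0.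
have di0 p : avg (di^~ p) = 0.
  rewrite avgZ avgD (avg_pair (fun i _ => field i p.1)).
  rewrite (avg_pair (fun _ j => field j p.2)) !avg_field (avg_cst eta0).
  under eq_avg do rewrite (avg_cst eta0).
  by rewrite avg_field addr0 mulr0.
have dsK p q : avg (fun i => ds i p * ds i q) = Ks p q.
  rewrite /Ks -!avg_fieldM -!avgD -avgZ; apply: eq_avg => i.
  by rewrite /ds; ring.
have diK p q : avg (fun i => di i p * di i q) = Ki p q.
  transitivity (r ^+ 2 *
    (avg (fun i : {ffun E -> bool} * {ffun E -> bool} => field i.1 p.1 * field i.1 q.1)
     + avg (fun i : {ffun E -> bool} * {ffun E -> bool} => field i.1 p.1 * field i.2 q.2)
     + (avg (fun i : {ffun E -> bool} * {ffun E -> bool} => field i.2 p.2 * field i.1 q.1)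
     + avg (fun i : {ffun E -> bool} * {ffun E -> bool} => field i.2 p.2 * field i.2 q.2)))).
    by rewrite -!avgD -avgZ; apply: eq_avg => i; rewrite /di; ring.
  rewrite /Ki; congr (_ * _).
  rewrite (avg_pair (fun i _ => field i p.1 * field i q.1)).
  rewrite (avg_pair (fun i j => field i p.1 * field j q.2)).
  rewrite (avg_pair (fun i j => field j p.2 * field i q.1)).
  rewrite (avg_pair (fun i j => field j p.2 * field j q.2)).
  have -> : avg (fun i => avg (fun j => field i p.1 * field j q.2)) = 0.
    by rewrite -[RHS](@avg0 R {ffun E -> bool}); apply: eq_avg => i; rewrite avgZ avg_field mulr0.
  have -> : avg (fun i => avg (fun j => field j p.2 * field i q.1)) = 0.
    by rewrite -[RHS](@avg0 R {ffun E -> bool}); apply: eq_avg => i; rewrite avgZr avg_field mul0r.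
  rewrite addr0 add0r (avg_cst eta0) avg_fieldM; congr (_ + _).
  by rewrite -avg_fieldM; apply: eq_avg => i; rewrite (avg_cst eta0).
have rho2 : r * K * 2 + r ^+ 2 * K ^+ 2 <= rho.
  have h1 : r * K <= r * K ^+ 2 by rewrite ler_wpM2l.
  have h2 : r ^+ 2 * K ^+ 2 <= r * K ^+ 2.
    by rewrite ler_wpM2r ?sqr_ge0// expr2 ler_piMr.
  by rewrite /rho; lra.
have fb e s : - K <= field e s <= K by rewrite -ler_norml norm_field.
have ob s s' : overlap s s' <= K ^+ 2.
  by have := norm_overlap s s'; rewrite ler_norml => /andP[].
have K0 : 0 <= K by apply: le_trans K1.
have r20 : 0 <= r ^+ 2 by apply: sqr_ge0.
have dsb i p : `|ds i p + w p| <= rho.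
  apply: le_trans rho2; apply: (le_trans (ler_normD _ _)); apply: lerD.
    rewrite /ds normrM ger0_norm// -mulrA ler_wpM2l// mulr_natr mulr2n.
    by apply: (le_trans (ler_normD _ _)); rewrite lerD// norm_field.
  by rewrite /w normrN normrM (ger0_norm r20) ler_wpM2l// norm_overlap.
have dib i p : `|di i p + 0| <= rho.
  rewrite addr0; apply: le_trans rho2; apply: ler_wpDr; first by rewrite mulr_ge0// sqr_ge0.
  rewrite /di normrM ger0_norm// -mulrA ler_wpM2l// mulr_natr mulr2n.
  by apply: (le_trans (ler_normD _ _)); rewrite lerD// norm_field.
have := avg_lse_taylor (s0, s0) eta0 U ds0 dsK rK dsb; rewrite -hs.
have := avg_lse_taylor (w := fun=> 0) (s0, s0) (eta0, eta0) U di0 diK rK dib; rewrite -hi.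
have -> : gav U (fun=> 0) = 0 by rewrite (gav_cst (s0, s0)).
have -> : gav U (fun=> 0 ^+ 2) = 0.
  by rewrite (@eq_gav _ _ _ _ (fun=> 0)) ?(gav_cst (s0, s0))// => p; rewrite expr0n.
set mo := gav U (fun p => overlap p.1 p.2).
have mo0 : 0 <= mo by apply: (gav_ge0 (s0, s0)).
have moK : mo <= K ^+ 2 by apply: (gav_le (s0, s0)).
have wE : gav U w = - (r ^+ 2 * mo) by rewrite gavN gavZ.
have w2 : gav U (fun p => w p ^+ 2) - gav U w ^+ 2 <= 2 * rho ^+ 3.
  apply: (@le_trans _ _ ((r ^+ 2 * K ^+ 2) ^+ 2)).
    rewrite lerBlDr; apply: ler_wpDr; first exact: sqr_ge0.
    apply: (gav_le (s0, s0)) => p; rewrite /w sqrrN lerXn2r ?nnegrE//.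
    - by rewrite mulr_ge0.
    - by rewrite mulr_ge0// sqr_ge0.
    - by rewrite ler_wpM2l.
  have -> : (r ^+ 2 * K ^+ 2) ^+ 2 = (r * K ^+ 2) ^+ 3 * r / K ^+ 2.
    by field; rewrite gt_eqF// (lt_le_trans _ K1).
  have q0 : 0 <= (r * K ^+ 2) ^+ 3 by rewrite exprn_ge0// mulr_ge0// sqr_ge0.
  have -> : rho ^+ 3 = 27 * (r * K ^+ 2) ^+ 3 by rewrite /rho; ring.
  rewrite -mulrA; apply: (@le_trans _ _ ((r * K ^+ 2) ^+ 3 * 1)); last lra.
  rewrite ler_wpM2l// ler_pdivrMr ?exprn_gt0 ?(lt_le_trans _ K1)// mul1r.
  by apply: (le_trans r1); rewrite (le_trans K1).
(* The covariances differ by the cross terms between the replicas: the diagonal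
   ones compensate the drift, the others are nonnegative. *)
have hK : gav U (fun p => Ks p p) - gav U (fun p => gav U (Ks p)) <=
    gav U (fun p => Ki p p) - gav U (fun p => gav U (Ki p)) + 2 * (r ^+ 2 * mo).
  pose Kc (p q : S * S) := r ^+ 2 * (overlap p.1 q.2 + overlap p.2 q.1).
  have KsE p q : Ks p q = Ki p q + Kc p q by rewrite /Ks /Ki /Kc; ring.
  rewrite (eq_gav _ (fun p => KsE p p)) gavD.
  have -> : gav U (fun p => gav U (Ks p)) =
      gav U (fun p => gav U (Ki p)) + gav U (fun p => gav U (Kc p)).
    rewrite -gavD; apply: eq_gav => p.
    transitivity (gav U (fun q => Ki p q + Kc p q)); last by rewrite gavD.
    by apply: eq_gav => q; exact: KsE.
  have : 0 <= gav U (fun p => gav U (Kc p)).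
    apply: (gav_ge0 (s0, s0)) => p; apply: (gav_ge0 (s0, s0)) => q.
    by rewrite mulr_ge0// addr_ge0.
  have -> : gav U (fun p => Kc p p) = 2 * (r ^+ 2 * mo).
    by rewrite /mo -!gavZ; apply: eq_gav => p; rewrite /Kc (overlapC p.2); ring.
  lra.
rewrite wE in w2 *; rewrite !ler_norml => /andP[a1 a2] /andP[b1 b2].
move: w2 hK a1 b2; rewrite sqrrN.
set A := gav U (fun p => Ks p p); set B := gav U (fun p => gav U (Ks p)).
set A' := gav U (fun p => Ki p p); set B' := gav U (fun p => gav U (Ki p)).
set C := gav U (fun p => w p ^+ 2); set D := (r ^+ 2 * mo) ^+ 2.
set X := shared _ _ _; set Y := indep _ _ _; set Z := rho ^+ 3.
by rewrite expr0n/=; lra.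
Qed.

(** Gaussian interpolation of the covariance, one step at a time: sharing the
    step creates a covariance equal to the mean overlap. *)
Lemma shared_fe2_le r ab : 0 <= r -> r * fbound <= 4^-1 ->
  shared r fe2 ab <= indep r fe2 ab + r ^+ 2 * mean_overlap ab
    + 39 * (r * fbound) ^+ 3.
Proof.
move=> r0; set K := fbound => rK; case: ab => x y.
have K1 : 1 <= K := fbound_ge1.
have K0 : 0 <= K by apply: le_trans K1.
have rK0 : 0 <= r * K by rewrite mulr_ge0.
(* f is the increment of the free energy and r * A its linear part. *)
pose A z eta := gav (energy z) (field eta).
pose f z eta := fe (z + step r eta) - fe z.
pose rem z eta := f z eta - r * A z eta.
have remb z eta : `|rem z eta| <= 7 * (r * K) ^+ 2.
  rewrite /rem /f /A -gavZ.
  rewrite {1}/fe (@eq_lse _ _ _ (fun s => energy z s + r * field eta s)).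
    apply: (lse_taylor1 s0) => // s.
    by rewrite normrM ger0_norm// ler_wpM2l// norm_field.
  by move=> s; rewrite energyD energy_step.
have Ab z eta : `|A z eta| <= K by apply: (norm_gav_le s0) => s; exact: norm_field.
have avgA z : avg (A z) = 0.
  by rewrite -gav_avg (eq_gav _ avg_field) (gav_cst s0).
have avgAA : avg (fun eta => A x eta * A y eta) = mean_overlap (x, y).
  rewrite /mean_overlap /energy2/= (gav_prod _ _ overlap).
  transitivity (avg (fun eta => gav (energy x) (fun s =>
     gav (energy y) (fun s' => field eta s * field eta s')))).
    apply: eq_avg => eta; rewrite /A mulrC -gavZ; apply: eq_gav => s.
    by rewrite mulrC -gavZ.
  rewrite -gav_avg; apply: eq_gav => s; rewrite -gav_avg; apply: eq_gav => s'.
  exact: avg_fieldM.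
have favg z : `|avg (f z)| <= 7 * (r * K) ^+ 2.
  have -> : avg (f z) = avg (rem z).
    rewrite -[LHS]subr0 -(mulr0 r) -(avgA z) -avgZ -avgB.
    exact: eq_avg.
  by rewrite (le_trans (norm_avg _))// -[leRHS](avg_cst eta0) le_avg.
have feE z eta : fe (z + step r eta) = f z eta + fe z by rewrite subrK.
have -> : shared r fe2 (x, y) = avg (fun eta => f x eta * f y eta)
   + fe y * avg (f x) + fe x * avg (f y) + fe x * fe y.
  rewrite -!avgZ -(avg_cst eta0 (fe x * fe y)) -!avgD.
  by apply: eq_avg => eta; rewrite /fe2/= !feE; ring.
have -> : indep r fe2 (x, y) = (avg (f x) + fe x) * (avg (f y) + fe y).
  rewrite /indep /tav /fe2/= (avg_pair (fun i j => fe (x + step r i) * fe (y + step r j))).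
  under eq_avg do rewrite avgZ.
  rewrite avgZr; congr (_ * _); rewrite -[X in _ + X](avg_cst eta0) -avgD.
    by apply: eq_avg => eta; rewrite feE.
  by apply: eq_avg => eta; rewrite feE.
have ff : avg (fun eta => f x eta * f y eta) <=
    r ^+ 2 * mean_overlap (x, y) + (14 * (r * K) ^+ 3 + 49 * (r * K) ^+ 4).
  rewrite -avgAA -avgZ -[X in _ + X](avg_cst eta0) -avgD; apply: le_avg => eta.
  have fE z : f z eta = r * A z eta + rem z eta by rewrite /rem; ring.
  have rA z : `|r * A z eta| <= r * K by rewrite normrM ger0_norm// ler_wpM2l.
  have -> : f x eta * f y eta = r ^+ 2 * (A x eta * A y eta) +
     (r * A x eta * rem y eta + r * A y eta * rem x eta + rem x eta * rem y eta).
    by rewrite !fE; ring.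
  rewrite lerD2l; apply: (le_trans (ler_norm _)).
  have h1 u v : `|r * A u eta * rem v eta| <= 7 * (r * K) ^+ 3.
    rewrite normrM (_ : 7 * (r * K) ^+ 3 = (r * K) * (7 * (r * K) ^+ 2)); last by ring.
    by apply: ler_pM.
  have h2 : `|rem x eta * rem y eta| <= 49 * (r * K) ^+ 4.
    rewrite normrM (_ : 49 * (r * K) ^+ 4 = (7 * (r * K) ^+ 2) * (7 * (r * K) ^+ 2)); last by ring.
    by apply: ler_pM.
  apply: (le_trans (ler_normD _ _)); apply: lerD => //.
  apply: (le_trans (ler_normD _ _)).
  by have := h1 x y; have := h1 y x; lra.
have gg : - (avg (f x) * avg (f y)) <= 49 * (r * K) ^+ 4.
  apply: (le_trans (ler_norm _)); rewrite normrN normrM.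
  rewrite (_ : 49 * (r * K) ^+ 4 = (7 * (r * K) ^+ 2) * (7 * (r * K) ^+ 2)); last by ring.
  by apply: ler_pM.
have q4 : (r * K) ^+ 4 <= (r * K) ^+ 3 / 4.
  by rewrite exprSr ler_wpM2l// exprn_ge0.
have q3 : 0 <= (r * K) ^+ 3 by rewrite exprn_ge0.
move: ff gg q4 q3; set Z3 := (r * K) ^+ 3; set Z4 := (r * K) ^+ 4.
set X := avg (fun eta => _); set X1 := avg (f x); set Y1 := avg (f y).
set mo := mean_overlap _.
move=> ff gg q4 q3; have -> : (X1 + fe x) * (Y1 + fe y) =
  X1 * Y1 + fe y * X1 + fe x * Y1 + fe x * fe y by ring.
by lra.
Qed.

End replicas.

(** * The variance under Rademacher disorder *)

(** Each term is at most an increment of the logarithm, and these telescope. *)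
Lemma harmonic_block {R : realType} (n p : nat) : (0 < n)%N -> (0 < p)%N ->
  \sum_(n <= i < p * n) (i.+1%:R)^-1 <= ln p%:R :> R.
Proof.
move=> n0 p0.
have npn : (n <= p * n)%N by rewrite leq_pmull.
apply: (@le_trans _ _ (\sum_(n <= i < p * n) (ln i.+1%:R - ln i%:R : R))).
  rewrite big_nat [leRHS]big_nat; apply: ler_sum => i /andP[ni _].
  have i0 : (0 < i)%N by exact: leq_trans ni.
  have iR : 0 < i%:R :> R by rewrite ltr0n.
  have i1R : 0 < i.+1%:R :> R by rewrite ltr0n.
  have := @ln_le_subr1 R (i%:R / i.+1%:R); rewrite divr_gt0// => /(_ isT).
  rewrite ln_div ?posrE// => h; rewrite -lerN2 opprB (le_trans h)//.
  rewrite (_ : i%:R / i.+1%:R - 1 = - i.+1%:R^-1)//.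
  by rewrite -natr1 in i1R *; field; rewrite gt_eqF.
rewrite telescope_sumr// natrM lnM ?posrE ?ltr0n//.
by rewrite addrK.
Qed.

Section rademacher_variance.
Context {R : realType} {E S : finType} (s0 : S).
Variables (b : E -> S -> R) (kappa : E -> R).
Local Notation V := {ffun E -> R}.
Local Notation overlap := (overlap b kappa).
Local Notation shared := (shared kappa).
Local Notation indep := (indep kappa).
Local Notation coupled := (coupled b kappa).
Local Notation mean_overlap := (mean_overlap b kappa).
Local Notation fe2 := (fe2 b).
Local Notation fe := (fe b).
Local Notation K := (fbound b kappa).
Local Notation eta0 := ([ffun => true] : {ffun E -> bool}).
Implicit Types (r t : R) (ab : V * V).

Definition walk r : (V -> R) -> V -> R := tav (step kappa r).

Lemma shared_diag r n (f : V * V -> R) x :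
  iter n (shared r) f (x, x) = iter n (walk r) (fun y => f (y, y)) x.
Proof.
elim: n x => //= n IH x; rewrite /shared /walk /tav; apply: eq_avg => eta.
exact: IH.
Qed.

Lemma indep_prod r n (f g : V -> R) ab :
  iter n (indep r) (fun ab => f ab.1 * g ab.2) ab =
  iter n (walk r) f ab.1 * iter n (walk r) g ab.2.
Proof.
elim: n ab => //= n IH ab; rewrite {1}/indep /tav.
under eq_avg do rewrite IH/=.
rewrite (avg_pair (fun i j => iter n (walk r) f (ab.1 + step kappa r i) *
   iter n (walk r) g (ab.2 + step kappa r j))).
by under eq_avg do rewrite avgZ; rewrite avgZr.
Qed.

(** Without coupling the two replicas separate, and only the law of each disorder
    matters. *)
Lemma shared_coupled0 r n j ab :
  iter j (shared r) (iter n (indep r) (coupled 0)) ab =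
  iter (n + j) (indep r) (coupled 0) ab.
Proof.
have h : shared r (coupled 0) = indep r (coupled 0).
  apply/funext => -[x y]; rewrite /shared /indep /tav.
  under eq_avg do rewrite (coupled0 s0)/=.
  under [RHS]eq_avg do rewrite (coupled0 s0)/=.
  rewrite (avg_pair (fun i j => fe (x + step kappa r i) + fe (y + step kappa r j))).
  rewrite avgD [in RHS](_ : (fun i => _) = fun i => fe (x + step kappa r i) +
    avg (fun j => fe (y + step kappa r j))) ?avgD ?(avg_cst eta0)//.
  by apply/funext => i; rewrite avgD (avg_cst eta0).
elim: j n => [|j IH] n; first by rewrite addn0.
by rewrite iterSr /shared iter_tavC -/(shared r) h -iterSr IH addnS addSn.
Qed.

Hypothesis overlap_ge0 : forall s s', 0 <= overlap s s'.

(** The replica coupling inequality: sharing j more steps costs no more than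
    increasing the coupling by j steps, along the characteristics of a transport
    equation. *)
Lemma shared_coupled_path r t n j ab : 0 <= r -> r * (3 * K ^+ 2) <= 4^-1 ->
  iter j (shared r) (iter n (indep r) (coupled t)) ab <=
  iter (n + j) (indep r) (coupled (t + j%:R * r ^+ 2)) ab
    + j%:R * (47 * (r * (3 * K ^+ 2)) ^+ 3).
Proof.
move=> r0 rK; set C := 47 * _.
elim: j n t => [|j IH] n t; first by rewrite addn0 !mul0r !addr0.
rewrite iterSr /shared iter_tavC -/(shared r).
apply: (@le_trans _ _ (iter j (shared r) (iter n (indep r)
    (fun ab => indep r (coupled (t + r ^+ 2)) ab + C)) ab)).
  apply: le_iter_tav => ab1; apply: le_iter_tav => ab2.
  have := shared_coupled_le s0 (t + r ^+ 2) ab2 overlap_ge0 r0 rK.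
  by rewrite addrK.
rewrite (iter_tavDc (eta0, eta0)) (iter_tavDc eta0) -/(indep r) -iterSr.
apply: (le_trans (lerD (IH _ _) (lexx _))).
rewrite addSnnS (_ : t + r ^+ 2 + j%:R * r ^+ 2 = t + j.+1%:R * r ^+ 2).
  by rewrite -[in X in _ <= _ + X]natr1 mulrDl mul1r addrA lexx.
by rewrite -natr1; ring.
Qed.

(** The independent steps are made common one at a time. *)
Lemma shared_fe2_path r n j ab : 0 <= r -> r * K <= 4^-1 ->
  iter j (shared r) (iter n (indep r) fe2) ab <=
  iter (n + j) (indep r) fe2 ab
   + \sum_(i < j) (r ^+ 2 *
       iter i (shared r) (iter (n + j - i.+1) (indep r) mean_overlap) ab)
   + j%:R * (39 * (r * K) ^+ 3).
Proof.
move=> r0 rK; set C := 39 * _.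
elim: j n => [|j IH] n; first by rewrite big_ord0 mul0r !addr0 addn0.
rewrite iterSr /shared iter_tavC -/(shared r).
apply: (@le_trans _ _ (iter j (shared r) (iter n (indep r)
    (fun ab => (indep r fe2 ab + r ^+ 2 * mean_overlap ab) + C)) ab)).
  apply: le_iter_tav => ab1; apply: le_iter_tav => ab2.
  exact: shared_fe2_le.
rewrite (iter_tavDc (eta0, eta0)) (iter_tavDc eta0).
rewrite (iter_tavD _ n (indep r fe2)) (iter_tavZ _ n (r ^+ 2) mean_overlap).
rewrite (iter_tavD _ j (iter n (indep r) (indep r fe2))).
rewrite (iter_tavZ _ j (r ^+ 2) (iter n (indep r) mean_overlap)) -iterSr.
apply: (le_trans (lerD (lerD (IH _) (lexx _)) (lexx _))).
rewrite big_ord_recr/= addnK !addSn !addnS -natr1 mulrDl mul1r.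
under eq_bigr do rewrite subSS.
rewrite -[indep r _ ab]/(iter (n + j).+1 (indep r) fe2 ab).
set X := iter _ _ fe2 _; set Y := iter _ _ _ ab; set Z := \sum_(i < j) _.
rewrite le_eqVlt; apply/orP; left; apply/eqP; ring.
Qed.

Lemma mean_overlap_le_max q ab : (forall s s', overlap s s' <= q) ->
  mean_overlap ab <= q.
Proof. by move=> h; apply: (gav_le (s0, s0)). Qed.

(** The variance of the free energy is at most the sum of the mean overlaps along
    the path. The overlap of replicas sharing a proportion t of their disorder
    is estimated through the replica coupling as long as 1 - t > 1/p, and by its
    maximum afterwards. *)
Lemma rademacher_variance_le (p : nat) (q L : R) : (0 < p)%N -> 0 <= L ->
  (forall s s', overlap s s' <= q) ->
  (forall (r u : R) n, p%:R^-1 < u -> u <= 1 -> 0 <= r ->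
    iter n (indep r) (coupled (1 - u / 2)) (0, 0) -
    iter n (indep r) (coupled 0) (0, 0) <= L) ->
  exists C, forall n r, (0 < n)%N -> 0 <= r -> r ^+ 2 = (p * n)%:R^-1 ->
    r * (3 * K ^+ 2) <= 4^-1 ->
    iter (p * n) (walk r) (fun x => fe x ^+ 2) 0 -
    iter (p * n) (walk r) fe 0 ^+ 2 <= 2 * L * ln p%:R + q / p%:R + C * r.
Proof.
move=> p0 L0 Qq HL.
have K1 : 1 <= K := fbound_ge1 b kappa.
have K0 : 0 < K by apply: lt_le_trans K1.
pose c1 := 47 * (3 * K ^+ 2) ^+ 3; pose c2 := 39 * K ^+ 3.
have c10 : 0 <= c1 by rewrite mulr_ge0// exprn_ge0// mulr_ge0// sqr_ge0.
exists (2 * c1 * ln p%:R + c2) => n r n0 r0 rE rK.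
have rK' : r * K <= 4^-1.
  apply: le_trans rK; rewrite ler_wpM2l//; move: (K) K1 => k k1; nra.
set m := (p * n)%N in rE *.
have m0 : (0 < m)%N by rewrite muln_gt0 p0 n0.
have mR : 0 < m%:R :> R by rewrite ltr0n.
have pR : 0 < p%:R :> R by rewrite ltr0n.
have nR : 0 < n%:R :> R by rewrite ltr0n.
have mr2 : m%:R * r ^+ 2 = 1 by rewrite rE divff// gt_eqF.
have := shared_fe2_path 0 m (0, 0) r0 rK'.
rewrite shared_diag add0n /fe2 (indep_prod r m fe fe)/=.
set A := iter m _ _ _; set B := iter m _ fe 0.
have -> : m%:R * (39 * (r * K) ^+ 3) = c2 * r.
  transitivity ((m%:R * r ^+ 2) * (c2 * r)); last by rewrite mr2 mul1r.
  by rewrite /c2; ring.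
set T := fun i => iter i (shared r) (iter (m - i.+1) (indep r) mean_overlap) (0, 0).
(* a k bounds the contribution of the stage at which k independent steps
   remain: u below is the proportion (k + 1) / m of steps that are not shared. *)
pose a k := if (k < n)%N then r ^+ 2 * q else 2 * (L + c1 * r) * (k.+1%:R^-1).
have Ta i : (i < m)%N -> r ^+ 2 * T i <= a (m - i.+1)%N.
  move=> im; rewrite /a; case: ltnP => h.
    rewrite ler_wpM2l ?sqr_ge0//.
    apply: (@le_trans _ _ (iter i (shared r) (iter (m - i.+1) (indep r) (fun=> q)) (0, 0))).
      by apply: le_iter_tav => ab1; apply: le_iter_tav => ab2; exact: mean_overlap_le_max.
    by rewrite (iter_tav_cst (eta0, eta0)) (iter_tav_cst eta0).
  set u : R := (m - i)%:R / m%:R.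
  have miE : (m - i)%:R = m%:R - i%:R :> R by rewrite natrB// ltnW.
  have mi0 : 0 < (m - i)%:R :> R by rewrite ltr0n subn_gt0.
  have uE : u = 1 - i%:R * r ^+ 2 by rewrite /u miE mulrBl divff ?gt_eqF// rE.
  have up : p%:R^-1 < u.
    rewrite /u ltr_pdivlMr// /m natrM mulKf ?gt_eqF// ltr_nat.
    by rewrite (leq_ltn_trans h)// subnS prednK// subn_gt0.
  have u1 : u <= 1 by rewrite uE gerBl mulr_ge0// sqr_ge0.
  have u0 : 0 < u by rewrite divr_gt0.
  have huT : u / 2 * T i <= L + c1 * r.
    apply: (@le_trans _ _ (iter i (shared r) (iter (m - i.+1) (indep r)
      (fun ab => coupled (u / 2) ab + (-1) * coupled 0 ab)) (0, 0))).
      have -> : u / 2 * T i = iter i (shared r) (iter (m - i.+1) (indep r)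
          (fun ab => u / 2 * mean_overlap ab)) (0, 0).
        by rewrite !iter_tavZ.
      apply: le_iter_tav => ab1; apply: le_iter_tav => ab2.
      by rewrite mulN1r; exact: mean_overlap_le.
    rewrite !iter_tavD !iter_tavZ mulN1r shared_coupled0.
    have := shared_coupled_path (u / 2) (m - i.+1) i (0, 0) r0 rK.
    (* The i shared steps raise the coupling from u / 2 to 1 - u / 2, which stays
       below 1. *)
    have -> : u / 2 + i%:R * r ^+ 2 = 1 - u / 2 by rewrite uE; field.
    have := HL r u (m - i.+1 + i)%N up u1 r0.
    have : i%:R * (47 * (r * (3 * K ^+ 2)) ^+ 3) <= c1 * r.
      rewrite (_ : 47 * _ = c1 * r * r ^+ 2); last by rewrite /c1; ring.
      apply: (@le_trans _ _ (c1 * r * (m%:R * r ^+ 2))); last by rewrite mr2 mulr1.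
      rewrite mulrCA; apply: ler_wpM2l; first by rewrite mulr_ge0.
      by apply: ler_wpM2r; rewrite ?sqr_ge0// ler_nat ltnW.
    set X := iter _ _ _ _; set Y := iter _ _ (coupled 0) _; set Z := iter _ _ _ _.
    by lra.
  have -> : (m - i.+1).+1 = (m - i)%N by rewrite subnS prednK// subn_gt0.
  have -> : r ^+ 2 * T i = 2 * (u / 2 * T i) * ((m - i)%:R^-1).
    by rewrite rE /u; field; rewrite !gt_eqF.
  by rewrite ler_wpM2r ?invr_ge0// ler_pM2l.
have sumT : \sum_(i < m) (r ^+ 2 * T i) <= q / p%:R + 2 * (L + c1 * r) * ln p%:R.
  apply: (@le_trans _ _ (\sum_(i < m) a (m - i.+1)%N)).
    by apply: ler_sum => i _; exact: Ta.
  have -> : \sum_(i < m) a (m - i.+1)%N = \sum_(0 <= k < m) a k.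
    by rewrite big_rev_mkord subn0.
  have nm : (n <= m)%N by rewrite leq_pmull.
  rewrite (@big_cat_nat _ _ _ n)//=; apply: lerD.
    rewrite big_nat (eq_bigr (fun=> r ^+ 2 * q)); last first.
      by move=> i /andP[_ kn]; rewrite /a kn.
    rewrite -big_nat sumr_const_nat subn0 -mulr_natl rE /m natrM.
    rewrite le_eqVlt; apply/orP; left; apply/eqP; field.
    by rewrite !gt_eqF.
  rewrite big_nat (eq_bigr (fun i => 2 * (L + c1 * r) * (i.+1%:R^-1))); last first.
    by move=> i /andP[nk _]; rewrite /a ltnNge nk.
  rewrite -big_nat -mulr_sumr ler_wpM2l ?harmonic_block//.
  by rewrite mulr_ge0// addr_ge0// mulr_ge0.
rewrite expr2; set SS := \sum_(i < m) _ in sumT *.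
by move=> h; lra.
Qed.

End rademacher_variance.

(** * Gauge symmetry *)

Section gauge.
Context {R : realType} {E S : finType} (s0 : S).
Variables (b : E -> S -> R) (kappa : E -> R).
Local Notation V := {ffun E -> R}.
Local Notation overlap := (overlap b kappa).
Local Notation indep := (indep kappa).
Local Notation coupled := (coupled b kappa).
Local Notation eta0 := ([ffun => true] : {ffun E -> bool}).
Implicit Types (r t : R) (ab : V * V) (s rho : S).

Variables (act : S -> S -> S) (chi : S -> E -> bool).
Hypothesis act_bij : forall rho, bijective (act rho).
Hypothesis actr_bij : forall s, bijective (act^~ s).
Hypothesis b_act : forall rho e s, b e (act rho s) = sg (chi rho e) * b e s.

(** Changing the signs of the disorder by chi rho amounts to moving the
    configurations by rho, while the walk keeps its law. *)
Definition gauge rho (x : V) : V := [ffun e => sg (chi rho e) * x e].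

Lemma energy_gauge rho x s : energy b (gauge rho x) s = energy b x (act rho s).
Proof. by apply: eq_bigr => e _; rewrite ffunE b_act; ring. Qed.

Lemma gauge0 rho : gauge rho 0 = 0.
Proof. by apply/ffunP => e; rewrite !ffunE mulr0. Qed.

Lemma gauge_step rho r x eta : gauge rho (x + step kappa r eta) =
  gauge rho x + step kappa r [ffun e => chi rho e (+) eta e].
Proof.
by apply/ffunP => e; rewrite !ffunE mulrDr /sg signr_addb; congr (_ + _); ring.
Qed.

Lemma indep_gauge rho r n (H : V * V -> R) ab :
  iter n (indep r) (fun ab => H (gauge rho ab.1, ab.2)) ab =
  iter n (indep r) H (gauge rho ab.1, ab.2).
Proof.
elim: n ab => //= n IH ab; rewrite /indep /tav.
pose h (e2 : {ffun E -> bool} * {ffun E -> bool}) :=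
  ([ffun e => chi rho e (+) e2.1 e], e2.2).
have hK : involutive h.
  move=> [e1 e2]; rewrite /h/=; congr (_, _).
  by apply/ffunP => e; rewrite !ffunE addKb.
rewrite [RHS](@avg_reindex _ _ h _ (inv_bij hK)); apply: eq_avg => e2.
by rewrite IH/= gauge_step.
Qed.

Lemma gav_gauge rho (f : S * S -> R) x y :
  gav (energy2 b (gauge rho x, y)) (fun p => f (act rho p.1, p.2)) =
  gav (energy2 b (x, y)) f.
Proof.
have [g gK Kg] := act_bij rho.
have hb : bijective (fun p : S * S => (act rho p.1, p.2)).
  by exists (fun p => (g p.1, p.2)) => -[s s']/=; rewrite ?gK ?Kg.
rewrite /gav /gz [in RHS](reindex _ (onW_bij _ hb))/=.
rewrite [X in _ = _ / X](reindex _ (onW_bij _ hb))/=.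
by congr (_ / _); apply: eq_bigr => p _; rewrite /energy2/= energy_gauge.
Qed.

Lemma iter_tav_avg {U : zmodType} {I J : finType} (u : I -> U) n
    (F : J -> U -> R) x :
  avg (fun j => iter n (tav u) (F j) x) =
  iter n (tav u) (fun y => avg (F^~ y)) x.
Proof.
elim: n x => //= n IH x; rewrite {1}/tav avg_swap; apply: eq_avg => i.
exact: IH.
Qed.

Lemma iter_tav_ln {U : zmodType} {I : finType} (i0 : I) (u : I -> U) n
    (f : U -> R) x : (forall y, 0 < f y) ->
  iter n (tav u) (fun y => ln (f y)) x <= ln (iter n (tav u) f x).
Proof.
move=> f0; have pos k y : 0 < iter k (tav u) f y.
  elim: k y => //= k IH y; exact: (avg_gt0 i0).
elim: n x => //= n IH x; apply: le_trans (avg_ln i0 _) => //.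
by apply: le_avg.
Qed.

(** For independent disorders the law of the overlap under the averaged product
    Gibbs measure is, by gauge invariance, that of a uniform configuration, at
    every temperature; with Jensen's inequality this bounds the coupled
    log-partition function. *)
Lemma indep_coupled_le r t n (c : R) :
  (forall s', avg (fun rho => expR (t * overlap rho s')) <= c) ->
  iter n (indep r) (coupled t) (0, 0) - iter n (indep r) (coupled 0) (0, 0) <= ln c.
Proof.
move=> Hc; pose f (p : S * S) := expR (t * overlap p.1 p.2).
pose g (f : S * S -> R) ab := gav (energy2 b ab) f.
have g0 ab : 0 < g f ab.
  rewrite /g /gav divr_gt0 ?(gz_gt0 (s0, s0))// (bigD1 (s0, s0))//=.
  by rewrite /f ltr_wpDr ?mulr_gt0 ?expR_gt0// sumr_ge0.
have gc : iter n (indep r) (g f) (0, 0) <= c.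
  pose fr rho (p : S * S) := f (act rho p.1, p.2).
  have e rho : iter n (indep r) (g f) (0, 0) = iter n (indep r) (g (fr rho)) (0, 0).
    transitivity (iter n (indep r)
       (fun ab => g (fr rho) (gauge rho ab.1, ab.2)) (0, 0)).
      by congr (iter _ _ _ _); apply/funext => -[x y]; rewrite /g /fr gav_gauge.
    by rewrite indep_gauge/= gauge0.
  rewrite -[leLHS](avg_cst s0) (eq_avg e) iter_tav_avg.
  rewrite -[leRHS](_ : iter n (indep r) (fun=> c) (0, 0) = _); last first.
    by rewrite (iter_tav_cst (eta0, eta0)).
  apply: le_iter_tav => ab; rewrite -gav_avg; apply: (gav_le (s0, s0)) => p.
  apply: le_trans (Hc p.2); rewrite le_eqVlt; apply/orP; left; apply/eqP.
  by rewrite [RHS](@avg_reindex _ _ (act^~ p.1) _ (actr_bij p.1)).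
apply: (@le_trans _ _ (iter n (indep r) (fun ab => ln (g f ab)) (0, 0))).
  have <- : iter n (indep r) (fun ab => coupled t ab + (-1) * coupled 0 ab) (0, 0) =
      iter n (indep r) (coupled t) (0, 0) - iter n (indep r) (coupled 0) (0, 0).
    by rewrite (iter_tavD _ n (coupled t)) (iter_tavZ _ n (-1) (coupled 0)) mulN1r.
  rewrite le_eqVlt; apply/orP; left; apply/eqP.
  congr (iter _ _ _ _); apply/funext => ab; rewrite mulN1r.
  rewrite {1}/coupled (lse_shift (s0, s0)) addrAC -[RHS]add0r; congr (_ + _).
  apply/eqP; rewrite subr_eq0; apply/eqP; apply: eq_lse => p.
  by rewrite mul0r addr0.
apply: (le_trans (iter_tav_ln (eta0, eta0) _ _ _ g0)).
have p0 : 0 < iter n (indep r) (g f) (0, 0).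
  elim: (n) (0, 0) => //= k IH y; exact: (avg_gt0 (eta0, eta0)).
by rewrite ler_ln ?posrE// (lt_le_trans p0).
Qed.

End gauge.

(** * Exponential moments of squared sums of signs *)

Section cosh.
Context {R : realType}.

Lemma ger0_is_derive_le (g dg : R -> R) (y : R) :
  (forall t : R, 0 <= t -> is_derive t 1 g (dg t)) ->
  (forall t : R, 0 <= t -> 0 <= dg t) -> 0 <= y -> g 0 <= g y.
Proof.
move=> dgE dg0 y0; rewrite -subr_ge0.
have [||c] := @MVT_segment R g dg 0 y y0.
- by move=> x; rewrite in_itv/= => /andP[x0 _]; apply: dgE; exact: ltW.
- apply: continuous_in_subspaceT => x; rewrite inE/= in_itv/= => /andP[x0 _].
  by have [dg1 _] := dgE _ x0; exact/differentiable_continuous/derivable1_diffP.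
rewrite in_itv/= => /andP[c0 _] ->.
by rewrite mulr_ge0 ?dg0// subr0.
Qed.

(** On the positive axis exp (- t^2 / 2) cosh t decreases from 1: its derivative has
    the sign of sinh t - t cosh t. *)
Lemma cosh_le (u : R) : expR u + expR (- u) <= 2 * expR (u ^+ 2 / 2).
Proof.
wlog u0 : u / 0 <= u.
  move=> h; have [/h//|u0] := leP 0 u.
  have := h (- u); rewrite oppr_ge0 ltW// => /(_ isT).
  by rewrite opprK sqrrN addrC.
pose phi (t : R) := t * (expR t + expR (- t)) - (expR t - expR (- t)).
have dN (t : R) : is_derive t 1 (fun t : R => expR (- t)) (- expR (- t)).
  rewrite -[X in is_derive _ _ _ X]mulrN1.
  exact: (@is_derive1_comp R (@expR R) -%R t).
have phi0 t : 0 <= t -> 0 <= phi t.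
  move=> t0; rewrite [leLHS](_ : _ = phi 0); last first.
    by rewrite /phi mul0r oppr0 subrr subr0.
  apply: (@ger0_is_derive_le phi (fun t => t * (expR t - expR (- t)))) => //.
  - move=> x x0; apply: is_derive_eq; rewrite /GRing.scale/=; ring.
  - move=> x x0; rewrite mulr_ge0// subr_ge0 ler_expR; lra.
have dG (t : R) : is_derive t 1 (fun t : R => expR (- (t ^+ 2 / 2)))
    (- t * expR (- (t ^+ 2 / 2))).
  have d1 : is_derive t 1 (fun t : R => - (t ^+ 2 / 2)) (- t).
    by apply: is_derive_eq; rewrite /GRing.scale/=; field.
  rewrite mulrC.
  exact: (@is_derive1_comp R (@expR R) (fun t : R => - (t ^+ 2 / 2)) t).
have := @ger0_is_derive_le
  (fun t => 2 - expR (- (t ^+ 2 / 2)) * (expR t + expR (- t)))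
  (fun t => expR (- (t ^+ 2 / 2)) * phi t) u.
rewrite oppr0 expR0 expr0n mul0r oppr0 expR0 mul1r (_ : 2 - (1 + 1) = 0 :> R)//; last by ring.
move=> h; have : 0 <= 2 - expR (- (u ^+ 2 / 2)) * (expR u + expR (- u)).
  apply: h => // [t t0|t t0].
  - by apply: is_derive_eq; rewrite /GRing.scale/= /phi; ring.
  - by rewrite mulr_ge0 ?expR_ge0 ?phi0.
rewrite subr_ge0 expRN mulrC ler_pdivrMr ?expR_gt0//.
Qed.

(** Averaging over one sign turns the coefficient l into l / (1 - 2 l), exactly as
    integrating out one standard Gaussian variable does. *)
Lemma expR_square_step (l y : R) : 0 <= l -> 2 * l < 1 ->
  2^-1 * (expR (l * (1 + y) ^+ 2) + expR (l * (-1 + y) ^+ 2)) <=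
  (1 - 2 * l)^-1 * expR (l / (1 - 2 * l) * y ^+ 2).
Proof.
move=> l0 l1; have l2 : 0 < 1 - 2 * l by lra.
have -> : l * (1 + y) ^+ 2 = (l * y ^+ 2 + l) + 2 * l * y by ring.
have -> : l * (-1 + y) ^+ 2 = (l * y ^+ 2 + l) + - (2 * l * y) by ring.
rewrite !expRD -mulrDr mulrCA.
have h := cosh_le (2 * l * y).
apply: (@le_trans _ _ (expR (l * y ^+ 2) * expR l * expR ((2 * l * y) ^+ 2 / 2))).
  by rewrite ler_wpM2l ?mulr_ge0 ?expR_ge0// ler_pdivrMl.
rewrite mulrAC -expRD mulrC; apply: ler_pM; rewrite ?expR_ge0//.
  rewrite -[l in expR l]opprK expRN lef_pV2 ?posrE ?expR_gt0//.
  apply: le_trans (expR_ge1Dx _); lra.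
rewrite ler_expR (_ : l * y ^+ 2 + _ = (l + 2 * l ^+ 2) * y ^+ 2); last by field.
rewrite ler_wpM2r ?sqr_ge0// ler_pdivlMr//.
have -> : (l + 2 * l ^+ 2) * (1 - 2 * l) = l - 4 * l ^+ 3 by ring.
by rewrite gerBl mulr_ge0// exprn_ge0.
Qed.

End cosh.

Section spin_sums.
Context {R : realType} {I T : finType} (sp : I -> T).
Implicit Types (rho : {ffun I -> bool}) (l : T -> R).

Definition spin_sum (J : seq I) rho (s : T) : R :=
  \sum_(i <- J | sp i == s) sg (rho i).

(** By induction on the spins: integrating out one sign changes the coefficient of its
    species only, and the factor 1 - 2 l n of that species splits accordingly. *)
Lemma avg_expR_square_le (J : seq I) l : uniq J -> (forall s, 0 <= l s) ->
  (forall s, 2 * l s * (count (fun i => sp i == s) J)%:R < 1) ->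
  avg (fun rho => expR (\sum_s l s * spin_sum J rho s ^+ 2)) <=
  \prod_s (1 - 2 * l s * (count (fun i => sp i == s) J)%:R)^-1.
Proof.
elim: J l => [|j J IH] l.
  move=> _ _ _; rewrite [leRHS]big1; last by move=> s _; rewrite mulr0 subr0 invr1.
  rewrite -[leRHS](@avg_cst _ {ffun I -> bool} [ffun => true]); apply: le_avg => rho.
  rewrite big1 ?expR0// => s _; by rewrite /spin_sum big_nil expr0n mulr0.
rewrite cons_uniq => /andP[jJ uJ] l0 l1.
set s0 := sp j.
have cJ s : count (fun i => sp i == s) (j :: J) = ((s0 == s) + count (fun i => sp i == s) J)%N by [].
have l01 : 2 * l s0 < 1.
  apply: le_lt_trans (l1 s0); rewrite cJ eqxx ler_peMr ?mulr_ge0//.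
  by rewrite ler1n.
have d0 : 0 < 1 - 2 * l s0 by lra.
pose l' s := if s == s0 then l s0 / (1 - 2 * l s0) else l s.
have l'0 s : 0 <= l' s by rewrite /l'; case: eqP => // _; rewrite divr_ge0// ltW.
have step s : 1 - 2 * l s * (count (fun i => sp i == s) (j :: J))%:R =
    (if s == s0 then 1 - 2 * l s0 else 1) * (1 - 2 * l' s * (count (fun i => sp i == s) J)%:R).
  rewrite cJ /l' (eq_sym s0); case: eqP => [->|_]; last by rewrite add0n mul1r.
  by rewrite add1n -natr1; field; rewrite gt_eqF.
have l'1 s : 2 * l' s * (count (fun i => sp i == s) J)%:R < 1.
  have := l1 s; rewrite -subr_gt0 step pmulr_rgt0 ?subr_gt0//.
  by case: eqP.
have sE rho s : spin_sum (j :: J) rho s =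
    (if s == s0 then sg (rho j) else 0) + spin_sum J rho s.
  by rewrite /spin_sum big_cons (eq_sym s) ; case: ifP => // _; rewrite add0r.
have flipE rho s : spin_sum J (flip j rho) s = spin_sum J rho s.
  rewrite /spin_sum big_seq_cond [RHS]big_seq_cond; apply: eq_bigr => i /andP[iJ _].
  rewrite ffunE; case: eqP => // ij; by rewrite ij in iJ; rewrite iJ in jJ.
pose f rho := expR (\sum_s l s * spin_sum (j :: J) rho s ^+ 2).
have -> : avg f = avg (fun rho => 2^-1 * (f rho + f (flip j rho))).
  by rewrite avgZ avgD avg_flip; field.
apply: (@le_trans _ _ (avg (fun rho => (1 - 2 * l s0)^-1 *
    expR (\sum_s l' s * spin_sum J rho s ^+ 2)))).
  apply: le_avg => rho.
  pose A := \sum_(s | s != s0) l s * spin_sum J rho s ^+ 2.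
  have fE r : (forall s, spin_sum J r s = spin_sum J rho s) ->
      f r = expR (l s0 * (sg (r j) + spin_sum J rho s0) ^+ 2) * expR A.
    move=> h; rewrite /f (bigD1 s0)//= expRD sE eqxx h; congr (_ * expR _).
    by apply: eq_bigr => s /negbTE ss0; rewrite sE ss0 add0r h.
  rewrite (fE rho)// (fE _ (flipE rho)) ffunE eqxx sgN -mulrDl mulrA.
  rewrite [in leRHS](bigD1 s0)//= {1}/l' eqxx expRD [leRHS]mulrA.
  have -> : \sum_(s | s != s0) l' s * spin_sum J rho s ^+ 2 = A.
    by apply: eq_bigr => s /negbTE ss0; rewrite /l' ss0.
  rewrite ler_wpM2r ?expR_ge0//.
  have := expR_square_step (spin_sum J rho s0) (l0 s0) l01.
  by rewrite /sg; case: (rho j); rewrite /= ?opprK// addrC.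
rewrite avgZ.
apply: (@le_trans _ _ ((1 - 2 * l s0)^-1 *
  \prod_s (1 - 2 * l' s * (count (fun i => sp i == s) J)%:R)^-1)).
  by apply: ler_wpM2l; [rewrite invr_ge0 ltW|exact: IH].
under [leRHS]eq_bigr do rewrite step invfM.
rewrite big_split/= ler_wpM2r//.
  by apply: prodr_ge0 => s _; rewrite invr_ge0 subr_ge0 ltW.
rewrite (bigD1 s0)//= eqxx big1 ?mulr1// => s /negbTE ->; by rewrite invr1.
Qed.

End spin_sums.

(** * Gaussian averages *)

Section gaussian.
Context {R : realType}.
Local Notation TR := (measurableTypeR R).
Local Notation mu := (@lebesgue_measure R).
Local Notation sd v := (Num.sqrt (v : R)).
Implicit Types (v s t x y : R).

(** The Radon-Nikodym derivative agrees almost everywhere with the density. *)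
Lemma normal_prob_integral (m sg : R) (f : TR -> \bar R) :
  measurable_fun [set: TR] f -> (forall x, (0 <= f x)%E) ->
  (\int[normal_prob m sg]_x f x = \int[mu]_x (f x * (normal_pdf m sg x)%:E))%E.
Proof.
move=> mf f0; set N := normal_prob _ _.
have dom : N `<< mu := normal_prob_dominates m sg.
rewrite -(Radon_Nikodym_SigmaFinite.change_of_variables dom)//.
have mpdf : measurable_fun [set: TR] (fun x : TR => (normal_pdf m sg x)%:E).
  by apply/measurable_EFinP; exact: measurable_normal_pdf.
have irn := Radon_Nikodym_SigmaFinite.f_integrable dom.
have h : ae_eq mu setT (Radon_Nikodym_SigmaFinite.f N mu)
    (fun x : TR => (normal_pdf m sg x)%:E).
  apply: integral_ae_eq => // A _ mA.
  by rewrite -(Radon_Nikodym_SigmaFinite.f_integral dom mA).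
apply: ge0_ae_eq_integral => //.
- apply: emeasurable_funM => //; exact: measurable_int irn.
- exact: emeasurable_funM.
- by move=> x _; rewrite mule_ge0// Radon_Nikodym_SigmaFinite.f_ge0.
- by move=> x _; rewrite mule_ge0// lee_fin normal_pdf_ge0.
- by apply: filterS h => x hx Dx; rewrite hx.
Qed.

(** The translate of the Lebesgue measure gives intervals their length. *)
Lemma lebesgue_measureD (a : R) (A : set TR) : measurable A ->
  pushforward mu (fun x : TR => a + x : TR) A = mu A.
Proof.
have ma : measurable_fun [set: TR] (fun x : TR => a + x : TR).
  by apply: measurable_funD.
pose F : {mfun TR >-> TR} := HB.pack (fun x : TR => a + x : TR)
  (isMeasurableFun.Build _ _ _ _ _ ma).
move=> mA; apply/esym.
apply: (@lebesgue_measure_unique R (pushforward mu F)) => //= _ [[c d]] _ <-.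
rewrite /pushforward/=.
have -> : ((fun x : TR => a + x : TR) @^-1` `]c, d] = `]c - a, d - a])%classic.
  apply/seteqP; split => x /=; rewrite !in_itv/= => /andP[h1 h2]; apply/andP; split; lra.
rewrite /= !lebesgue_measure_itv/= !lte_fin ltrD2r; case: ifP => // _.
by rewrite -!EFinB; congr (_%:E); ring.
Qed.

Lemma ge0_integral_shift (f : TR -> \bar R) a :
  measurable_fun [set: TR] f -> (forall x, (0 <= f x)%E) ->
  (\int[mu]_x f (a + x)%R = \int[mu]_x f x)%E.
Proof.
move=> mf f0.
have ma : measurable_fun [set: TR] (fun x : TR => a + x : TR) by apply: measurable_funD.
pose F : {mfun TR >-> TR} := HB.pack (fun x : TR => a + x : TR)
  (isMeasurableFun.Build _ _ _ _ _ ma).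
have -> : (\int[mu]_x f x = \int[pushforward mu F]_x f x)%E.
  by apply: eq_measure_integral => A mA _; exact/esym/(lebesgue_measureD a mA).
by rewrite ge0_integral_pushforward.
Qed.

Lemma ge0_integral_opp (f : TR -> \bar R) :
  measurable_fun [set: TR] f -> (forall x, (0 <= f x)%E) ->
  (\int[mu]_x f (- x)%R = \int[mu]_x f x)%E.
Proof.
move=> mf f0.
have ma : measurable_fun [set: TR] (fun x : TR => - x : TR) by apply: measurable_funN.
pose F : {mfun TR >-> TR} := HB.pack (fun x : TR => - x : TR)
  (isMeasurableFun.Build _ _ _ _ _ ma).
have -> : (\int[mu]_x f x = \int[pushforward mu F]_x f x)%E.
  by apply: eq_measure_integral => A mA _; exact/esym/(lebesgue_measureN mA).
by rewrite ge0_integral_pushforward.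
Qed.

Lemma normal_pdf0E v x : 0 < v ->
  normal_pdf 0 (sd v) x = (Num.sqrt (2 * pi * v))^-1 * expR (- (x ^+ 2 / (2 * v))).
Proof.
move=> v0; rewrite normal_pdfE ?gt_eqF ?sqrtr_gt0//.
rewrite /normal_peak /normal_fun sqr_sqrtr ?ltW// subr0.
by congr ((Num.sqrt _)^-1 * expR _); rewrite -mulr_natr; [ring|rewrite mulNr (mulrC v)].
Qed.

Lemma measurable_npdf m sg : measurable_fun [set: TR] (fun x : TR => normal_pdf m sg x).
Proof. exact: measurable_normal_pdf. Qed.

Lemma ge0_integral_normal_opp v (f : TR -> \bar R) : 0 < v ->
  measurable_fun [set: TR] f -> (forall x, (0 <= f x)%E) ->
  (\int[normal_prob 0 (sd v)]_x f (- x)%R = \int[normal_prob 0 (sd v)]_x f x)%E.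
Proof.
move=> v0 mf f0; rewrite !normal_prob_integral//; last first.
  by apply: measurableT_comp => //; exact: measurable_funN.
have h x : normal_pdf 0 (sd v) (- x) = normal_pdf 0 (sd v) x.
  by rewrite !normal_pdf0E// sqrrN.
rewrite -[RHS]ge0_integral_opp.
- by apply: eq_integral => x _; rewrite h.
- by apply: emeasurable_funM => //; apply/measurable_EFinP; exact: measurable_npdf.
- by move=> x; rewrite mule_ge0// lee_fin normal_pdf_ge0.
Qed.

(** Completing the square factors the joint density of (x, z - x) into the density of
    the sum z and the conditional density of x. *)
Lemma normal_pdf_conv s t x z : 0 < s -> 0 < t ->
  normal_pdf 0 (sd t) (z - x) * normal_pdf 0 (sd s) x =
  normal_pdf 0 (sd (s + t)) z *
  normal_pdf (s * z / (s + t)) (sd (s * t / (s + t))) x.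
Proof.
move=> s0 t0; have st0 : 0 < s + t by rewrite addr_gt0.
have v0 : 0 < s * t / (s + t) by rewrite divr_gt0// mulr_gt0.
rewrite !normal_pdf0E// normal_pdfE ?gt_eqF ?sqrtr_gt0//.
rewrite /normal_peak /normal_fun sqr_sqrtr ?ltW// mulrACA -expRD [RHS]mulrACA -expRD.
have pi0 := @pi_gt0 R.
congr (_ * expR _); last first.
  by rewrite -mulr_natr; field; rewrite !gt_eqF.
rewrite -!invfM -!sqrtrM ?mulr_ge0 ?ltW//.
by congr (Num.sqrt _)^-1; rewrite -mulr_natr; field; rewrite gt_eqF.
Qed.

(** The conditional density of [normal_pdf_conv] integrates to 1. *)
Lemma ge0_integral_normal_conv s t (f : TR -> \bar R) : 0 < s -> 0 < t ->
  measurable_fun [set: TR] f -> (forall x, (0 <= f x)%E) ->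
  (\int[normal_prob 0 (sd s)]_x \int[normal_prob 0 (sd t)]_y f (x + y)%R =
   \int[normal_prob 0 (sd (s + t))]_x f x)%E.
Proof.
move=> s0 t0 mf f0.
have pdf0 m sg x : (0 <= (normal_pdf m sg x)%:E)%E by rewrite lee_fin normal_pdf_ge0.
pose g (p : TR * TR) := (f p.2 * (normal_pdf 0 (sd t) (p.2 - p.1))%:E)%E.
have mpdf2 : measurable_fun [set: TR * TR]
    (fun p : TR * TR => (normal_pdf 0 (sd t) (p.2 - p.1))%:E).
  apply/measurable_EFinP; apply: (measurableT_comp (measurable_npdf 0 (sd t))).
  by apply: measurable_funB.
have mg : measurable_fun [set: TR * TR] g.
  by apply: emeasurable_funM => //; apply: measurableT_comp.
have g0 p : (0 <= g p)%E by rewrite mule_ge0.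
have inner x : (\int[normal_prob 0 (sd t)]_y f (x + y)%R = \int[mu]_z g (x, z))%E.
  have mfx : measurable_fun [set: TR] (fun y : TR => f (x + y)%R).
    by apply: measurableT_comp => //; exact: measurable_funD.
  rewrite (normal_prob_integral 0 (sd t) mfx (fun y => f0 _)).
  have mgx : measurable_fun [set: TR] (fun z => g (x, z)).
    by apply: (measurableT_comp mg); exact: measurable_pair1.
  rewrite -(ge0_integral_shift x mgx (fun z => g0 (x, z))).
  by apply: eq_integral => y _; rewrite /g/= addrAC subrr add0r.
transitivity (\int[normal_prob 0 (sd s)]_x \int[mu]_z g (x, z))%E.
  by apply: eq_integral => x _.
have mG : measurable_fun [set: TR] (fun x => \int[mu]_z g (x, z))%E.
  exact: (measurable_fun_fubini_tonelli_F g).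
have G0 x : (0 <= \int[mu]_z g (x, z))%E by apply: integral_ge0.
etransitivity; first exact: (normal_prob_integral 0 (sd s) mG G0).
pose G (p : TR * TR) := (g p * (normal_pdf 0 (sd s) p.1)%:E)%E.
have mG2 : measurable_fun [set: TR * TR] G.
  apply: emeasurable_funM => //; apply/measurable_EFinP.
  by apply: (measurableT_comp (measurable_npdf 0 (sd s))).
transitivity (\int[mu]_x \int[mu]_z G (x, z))%E.
  apply: eq_integral => x _; rewrite -ge0_integralZr//.
  by apply: (measurableT_comp mg); exact: measurable_pair1.
have GG0 p : (0 <= G p)%E by rewrite mule_ge0.
etransitivity; first exact: (fubini_tonelli G mG2 GG0).
etransitivity; last exact/esym/(normal_prob_integral 0 (sd (s + t)) mf f0).
apply: eq_integral => z _.
transitivity (\int[mu]_x ((f z * (normal_pdf 0 (sd (s + t)) z)%:E) *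
    (normal_pdf (s * z / (s + t)) (sd (s * t / (s + t))) x)%:E))%E.
  apply: eq_integral => x _; rewrite /G /g/= -muleA -EFinM normal_pdf_conv//.
  by rewrite EFinM muleA.
rewrite ge0_integralZl ?integral_normal_pdf ?mule1//.
- by apply/measurable_EFinP; exact: measurable_npdf.
- by rewrite mule_ge0.
Qed.

(** Up to a constant the integrand is the density of variance v / (1 + 2 th v). *)
Lemma integral_normal_expR_sqr v th : 0 < v -> 0 < 1 + 2 * th * v ->
  (\int[normal_prob 0 (sd v)]_x (expR (- (th * x ^+ 2)))%:E =
   ((Num.sqrt (1 + 2 * th * v))^-1)%:E)%E.
Proof.
move=> v0 th0; set w := 1 + _ in th0 *.
have v'0 : 0 < v / w by rewrite divr_gt0.
have pi0 := @pi_gt0 R.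
have me : measurable_fun [set: TR] (fun x : TR => (expR (- (th * x ^+ 2)))%:E).
  apply/measurable_EFinP; apply: measurableT_comp => //; apply: measurable_funN.
  by apply: measurable_funM => //; exact: measurable_funX.
rewrite (normal_prob_integral 0 (sd v) me); last by move=> x; rewrite lee_fin expR_ge0.
transitivity (\int[mu]_x (((Num.sqrt w)^-1)%:E * (normal_pdf 0 (sd (v / w)) x)%:E))%E.
  apply: eq_integral => x _; rewrite -!EFinM; congr (_%:E).
  rewrite !normal_pdf0E// mulrCA -expRD [RHS]mulrA -invfM -sqrtrM ?ltW//.
  congr ((Num.sqrt _)^-1 * expR _); first by field; rewrite gt_eqF.
  by rewrite /w; field; rewrite -/w !gt_eqF.
rewrite ge0_integralZl ?integral_normal_pdf ?mule1//.
- by apply/measurable_EFinP; exact: measurable_npdf.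
- by move=> x _; rewrite lee_fin normal_pdf_ge0.
Qed.

(** A fourth power is dominated by the exponential of a small square, whose mean is
    explicit. *)
Lemma integrable_normal_X4 v : 0 < v ->
  (normal_prob 0 (sd v)).-integrable [set: TR] (fun x => (x ^+ 4)%:E) /\
  (\int[normal_prob 0 (sd v)]_x (x ^+ 4)%:E <= (64 * v ^+ 2)%:E)%E.
Proof.
move=> v0; pose th := (4 * v)^-1; have th0 : 0 < th by rewrite invr_gt0 mulr_gt0.
have thv : th * v = 4^-1 by rewrite /th; field; rewrite gt_eqF.
have x40 x : 0 <= x ^+ 4 by rewrite exprn_even_ge0.
have mX n : measurable_fun [set: TR] (fun x : TR => (x ^+ n)%:E).
  by apply/measurable_EFinP; exact: measurable_funX.
have me : measurable_fun [set: TR] (fun x : TR => (expR (- ((- th) * x ^+ 2)))%:E).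
  apply/measurable_EFinP; apply: measurableT_comp => //; apply: measurable_funN.
  by apply: measurable_funM => //; exact: measurable_funX.
have hle : (\int[normal_prob 0 (sd v)]_x (x ^+ 4)%:E <= (64 * v ^+ 2)%:E)%E.
  have w0 : 0 < 1 + 2 * (- th) * v by rewrite -mulrA mulNr thv; lra.
  have := integral_normal_expR_sqr v0 w0.
  have -> : 1 + 2 * (- th) * v = 2^-1 by rewrite -mulrA mulNr thv; lra.
  move=> h; apply: (@le_trans _ _ (\int[normal_prob 0 (sd v)]_x
     ((32 * v ^+ 2)%:E * (expR (- ((- th) * x ^+ 2)))%:E))%E).
    apply: ge0_le_integral => //.
    - by move=> x _; rewrite lee_fin.
    - by apply: emeasurable_funM.
    - move=> x _; rewrite -EFinM lee_fin mulNr opprK.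
      have := @expR_ge1Dxn R (th * x ^+ 2) 1 (mulr_ge0 (ltW th0) (sqr_ge0 x)).
      rewrite (_ : (2`!)%:R = 2)// => h2.
      have : (th * x ^+ 2) ^+ 2 / 2 <= expR (th * x ^+ 2) by lra.
      have -> : x ^+ 4 = (32 * v ^+ 2) * ((th * x ^+ 2) ^+ 2 / 2).
        by rewrite /th; field; rewrite gt_eqF.
      by move=> h3; rewrite ler_wpM2l// mulr_ge0// sqr_ge0.
  have c0 : (0 <= (32 * v ^+ 2)%:E)%E by rewrite lee_fin mulr_ge0// sqr_ge0.
  have e0 x : (0 <= (expR (- ((- th) * x ^+ 2)))%:E)%E by rewrite lee_fin expR_ge0.
  rewrite ge0_integralZl// h -EFinM lee_fin.
  have -> : 64 * v ^+ 2 = 32 * v ^+ 2 * 2 by ring.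
  apply: ler_wpM2l; first by rewrite mulr_ge0// sqr_ge0.
  have h0 : 0 < 2^-1 :> R by rewrite invr_gt0.
  rewrite -[leRHS]invrK lef_pV2 ?posrE ?sqrtr_gt0//.
  rewrite -[leLHS](ger0_norm (ltW h0)) -sqrtr_sqr ler_sqrt//.
  by rewrite expr2; lra.
split => //; apply/integrableP; split; first exact: mX.
under eq_integral do rewrite gee0_abs ?lee_fin//.
exact: le_lt_trans hle (ltry _).
Qed.

Lemma inv_sqrt_le x y : 0 < x -> 0 <= y -> 1 <= x * y ^+ 2 -> (Num.sqrt x)^-1 <= y.
Proof.
move=> x0 y0 h; rewrite -div1r ler_pdivrMr ?sqrtr_gt0// -[y]ger0_norm//.
rewrite -sqrtr_sqr mulrC -(sqrtrM _ (ltW x0)).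
by rewrite -[X in X <= _]sqrtr1 ler_wsqrtr.
Qed.

(** The second moment is read off the mean of exp (- th x^2) as th tends to 0 from
    both sides. *)
Lemma normal_second_moment v : 0 < v ->
  (normal_prob 0 (sd v)).-integrable [set: TR] (fun x => (x ^+ 2)%:E) /\
  (\int[normal_prob 0 (sd v)]_x (x ^+ 2)%:E = v%:E)%E.
Proof.
move=> v0; set N := normal_prob 0 (sd v).
have mX n : measurable_fun [set: TR] (fun x : TR => (x ^+ n)%:E).
  by apply/measurable_EFinP; exact: measurable_funX.
have me th : measurable_fun [set: TR] (fun x : TR => (expR (- (th * x ^+ 2)))%:E).
  apply/measurable_EFinP; apply: measurableT_comp => //; apply: measurable_funN.
  by apply: measurable_funM => //; exact: measurable_funX.
have x20 x : (0 <= (x ^+ 2)%:E)%E by rewrite lee_fin sqr_ge0.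
have i2 : N.-integrable [set: TR] (fun x => (x ^+ 2)%:E).
  have [i4 _] := integrable_normal_X4 v0.
  apply: (@le_integrable _ _ _ N _ measurableT _ (fun x => (1 + x ^+ 4)%:E)) => //.
    move=> x _; have x40 : 0 <= x ^+ 4 by rewrite exprn_even_ge0.
    rewrite /= lee_fin !ger0_norm ?sqr_ge0 ?addr_ge0//.
    have : 0 <= (x ^+ 2 - 1) ^+ 2 by apply: sqr_ge0.
    move: x40; have -> : x ^+ 4 = (x ^+ 2) ^+ 2 by ring.
    by nra.
  have i1 : N.-integrable [set: TR] (EFin \o cst 1) by exact: finite_measure_integrable_cst.
  exact: (integrableD measurableT i1 i4).
split=> //; have fV : (\int[N]_x (x ^+ 2)%:E)%E \is a fin_num.
  exact: integrable_fin_num.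
rewrite -(fineK fV); set V := fine _; congr (_%:E).
have VE : (\int[N]_x (x ^+ 2)%:E = V%:E)%E by rewrite fineK.
have int1 : (\int[N]_x 1 = 1)%E.
  rewrite integral_cst// mul1e.
  exact: (@probability_setT _ _ _ (normal_prob 0 (sd v))).
have intT th : (\int[N]_x ((th)%:E * (x ^+ 2)%:E) = (th * V)%:E)%E.
  by rewrite integralZl// VE.
have up w : 0 < w -> w <= 2^-1 -> V <= v + 2 * v * w.
  move=> w0 w1; pose th := w / (2 * v).
  have wE : 2 * (- th) * v = - w by rewrite /th; field; rewrite gt_eqF.
  have th0 : 0 < th by rewrite divr_gt0// mulr_gt0.
  have w2 : 0 < 1 + 2 * (- th) * v by rewrite wE; lra.
  have : (\int[N]_x (1 + th%:E * (x ^+ 2)%:E) <=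
      \int[N]_x (expR (- (- th * x ^+ 2)))%:E)%E.
    apply: ge0_le_integral => //.
    - by move=> x _; rewrite adde_ge0// mule_ge0// lee_fin ltW.
    - by apply: emeasurable_funD => //; apply: emeasurable_funM.
    - by move=> x _; rewrite -EFinM -EFinD lee_fin mulNr opprK expR_ge1Dx.
  have t0 x : (0 <= th%:E * (x ^+ 2)%:E)%E by rewrite mule_ge0// lee_fin ltW.
  have mt : measurable_fun [set: TR] (fun x : TR => th%:E * (x ^+ 2)%:E)%E.
    by apply: emeasurable_funM.
  rewrite ge0_integralD// int1 intT (integral_normal_expR_sqr v0 w2) wE -EFinD lee_fin => h.
  have : (Num.sqrt (1 - w))^-1 <= 1 + w / 2 + w ^+ 2.
    apply: inv_sqrt_le; [lra|by rewrite !addr_ge0// ?sqr_ge0// divr_ge0// ltW|].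
    rewrite -subr_ge0.
    rewrite [X in 0 <= X](_ : _ = 5 / 4 * w ^+ 2 * (1 - w) - w ^+ 2 * w ^+ 3); last by field.
    have -> : w ^+ 3 = w * w ^+ 2 by ring.
    have w22 : 0 <= w ^+ 2 by apply: sqr_ge0.
    have w21 : w ^+ 2 <= 4^-1 by rewrite expr2; nra.
    have : w * w ^+ 2 <= 8^-1 by nra.
    by nra.
  move=> h2; have : th * V <= w / 2 + w ^+ 2 by lra.
  rewrite -ler_pdivlMl// => /le_trans; apply; rewrite le_eqVlt; apply/orP; left.
  by apply/eqP; rewrite /th; field; rewrite !gt_eqF.
have lo w : 0 < w -> w <= 2^-1 -> v - 2 * v * w <= V.
  move=> w0 w1; pose th := w / (2 * v).
  have wE : 2 * th * v = w by rewrite /th; field; rewrite gt_eqF.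
  have th0 : 0 < th by rewrite divr_gt0// mulr_gt0.
  have w2 : 0 < 1 + 2 * th * v by rewrite wE; lra.
  have : (\int[N]_x 1 <= \int[N]_x (th%:E * (x ^+ 2)%:E + (expR (- (th * x ^+ 2)))%:E))%E.
    apply: ge0_le_integral => //.
    - by apply: emeasurable_funD => //; apply: emeasurable_funM.
    - move=> x _; rewrite -EFinM -EFinD lee_fin.
      by have := expR_ge1Dx (- (th * x ^+ 2)); lra.
  have t0 x : (0 <= th%:E * (x ^+ 2)%:E)%E by rewrite mule_ge0// lee_fin ltW.
  have mt : measurable_fun [set: TR] (fun x : TR => th%:E * (x ^+ 2)%:E)%E.
    by apply: emeasurable_funM.
  have e0 x : (0 <= (expR (- (th * x ^+ 2)))%:E)%E by rewrite lee_fin expR_ge0.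
  rewrite ge0_integralD// int1 intT (integral_normal_expR_sqr v0 w2) wE -EFinD lee_fin => h.
  have : (Num.sqrt (1 + w))^-1 <= 1 - w / 2 + w ^+ 2.
    have p0 : 0 <= 1 - w / 2 + w ^+ 2 by rewrite addr_ge0 ?sqr_ge0//; lra.
    apply: inv_sqrt_le => //; first by lra.
    rewrite -subr_ge0.
    rewrite [X in 0 <= X](_ : _ = 5 / 4 * (w ^+ 2 + w ^+ 3) + w ^+ 5); last by field.
    by rewrite addr_ge0// ?mulr_ge0 ?addr_ge0 ?exprn_ge0// ltW.
  move=> h2; have : w / 2 - w ^+ 2 <= th * V by lra.
  rewrite -ler_pdivrMl//; apply: le_trans; rewrite le_eqVlt; apply/orP; left.
  by apply/eqP; rewrite /th; field; rewrite !gt_eqF.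
apply/eqP; rewrite eq_le; apply/andP; split; apply/ler_addgt0Pr => e e0.
  pose w := Num.min 2^-1 (e / (2 * v)).
  have w0 : 0 < w by rewrite lt_min invr_gt0 ltr0n divr_gt0// mulr_gt0.
  have w1 : w <= 2^-1 by rewrite ge_min lexx.
  apply: (le_trans (up w w0 w1)); rewrite lerD2l -ler_pdivlMl ?mulr_gt0// mulrC.
  by rewrite ge_min lexx orbT.
pose w := Num.min 2^-1 (e / (2 * v)).
have w0 : 0 < w by rewrite lt_min invr_gt0 ltr0n divr_gt0// mulr_gt0.
have w1 : w <= 2^-1 by rewrite ge_min lexx.
rewrite -lerBlDr; apply: le_trans (lo w w0 w1); rewrite lerD2l lerN2.
by rewrite -ler_pdivlMl ?mulr_gt0// mulrC ge_min lexx orbT.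
Qed.

End gaussian.

(** * The central limit theorem for sums of signs *)

Section clt.
Context {R : realType}.
Local Notation TR := (measurableTypeR R).
Local Notation N v := (normal_prob 0 (Num.sqrt (v : R))).
Implicit Types (v s t x y K c : R) (h : R -> R).

(** A second-order expansion stated on symmetric differences, so that it passes
    to averages over translations without differentiating anything. *)
Definition third_order K (h h2 : R -> R) : Prop :=
  forall x y, `|h (x + y) + h (x - y) - 2 * h x - y ^+ 2 * h2 x| <= K * `|y| ^+ 3.

Definition sign_avg s h : R -> R := fun x => 2^-1 * (h (x + s) + h (x - s)).
Definition normal_avg v h : R -> R := fun x => \int[N v]_y h (x + y).

(** The test functions are bounded, so that every average of them is defined. *)
Definition nonneg_le c h := measurable_fun [set: TR] (h : TR -> R) /\
  forall x, 0 <= h x <= c.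

Lemma third_order_sign_avg K s h h2 : third_order K h h2 ->
  third_order K (sign_avg s h) (sign_avg s h2).
Proof.
move=> H x y; have := H (x + s) y; have := H (x - s) y; rewrite /sign_avg.
have -> : x + y + s = x + s + y by ring.
have -> : x + y - s = x - s + y by ring.
have -> : x - y + s = x + s - y by ring.
have -> : x - y - s = x - s - y by ring.
rewrite !ler_norml => /andP[a1 a2] /andP[b1 b2]; apply/andP; split; lra.
Qed.

Lemma measurable_shift h a : measurable_fun [set: TR] (h : TR -> R) ->
  measurable_fun [set: TR] (fun x : TR => h (x + a)).
Proof. by move=> mh; apply: measurableT_comp => //; exact: measurable_funD. Qed.

Lemma measurable_shiftl h a : measurable_fun [set: TR] (h : TR -> R) ->
  measurable_fun [set: TR] (fun x : TR => h (a + x)).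
Proof. by move=> mh; apply: measurableT_comp => //; exact: measurable_funD. Qed.

Lemma nonneg_le_sign_avg c s h : nonneg_le c h -> nonneg_le c (sign_avg s h).
Proof.
move=> [mh hc]; split.
  apply: measurable_funM => //; apply: measurable_funD; exact: measurable_shift.
move=> x; rewrite /sign_avg; have /andP[a1 a2] := hc (x + s); have /andP[b1 b2] := hc (x - s).
by apply/andP; split; lra.
Qed.

Lemma integrable_nonneg_le v c h x : nonneg_le c h ->
  (N v).-integrable [set: TR] (fun y => (h (x + y))%:E).
Proof.
move=> [mh hc].
apply: (@le_integrable _ _ _ (N v) _ measurableT _ (EFin \o cst c)).
- by apply/measurable_EFinP; exact: measurable_shiftl.
- move=> y _ /=; rewrite lee_fin; have /andP[h0 h1] := hc (x + y).
  by rewrite !ger0_norm// (le_trans h0).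
- exact: finite_measure_integrable_cst.
Qed.

Lemma normal_avgE v c h x : nonneg_le c h ->
  (\int[N v]_y (h (x + y))%:E = (normal_avg v h x)%:E)%E.
Proof.
by move=> hc; rewrite fineK//; apply: integrable_fin_num => //; exact: integrable_nonneg_le hc.
Qed.

Lemma nonneg_le_normal_avg v c h : nonneg_le c h -> nonneg_le c (normal_avg v h).
Proof.
move=> [mh hc]; split.
  apply/measurable_EFinP.
  pose g (p : TR * TR) := (h (p.1 + p.2))%:E.
  rewrite (_ : EFin \o _ = fun x : TR => (\int[N v]_y g (x, y))%E).
    apply: (measurable_fun_fubini_tonelli_F g).
    - apply/measurable_EFinP; apply: measurableT_comp => //.
      by apply: measurable_funD.
    - by move=> p; rewrite lee_fin; have /andP[] := hc (p.1 + p.2).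
  by apply/funext => x; rewrite /g /= -(@normal_avgE v c h x).
move=> x; apply/andP; split; rewrite -lee_fin -(@normal_avgE v c h x)//.
  by apply: integral_ge0 => y _; rewrite lee_fin; have /andP[] := hc (x + y).
apply: (@le_trans _ _ (\int[N v]_y (cst c%:E) y)%E).
  apply: ge0_le_integral => //.
  - by move=> y _; rewrite lee_fin; have /andP[] := hc (x + y).
  - by apply/measurable_EFinP; exact: measurable_shiftl.
  - by move=> y _; rewrite lee_fin; have /andP[] := hc (x + y).
rewrite integral_cst//.
rewrite [X in (_ * X)%E](_ : _ = 1%E) ?mule1//.
exact: (@probability_setT _ _ _ (N v)).
Qed.

Lemma normal_avgD s t c h x : 0 < s -> 0 < t -> nonneg_le c h ->
  normal_avg (s + t) h x = normal_avg s (normal_avg t h) x.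
Proof.
move=> s0 t0 hc; apply: EFin_inj; have [mh h0] := hc.
transitivity (\int[N (s + t)]_z (h (x + z))%:E)%E.
  exact/esym/(normal_avgE _ _ hc).
transitivity (\int[N s]_y (normal_avg t h (x + y))%:E)%E; last first.
  exact: (normal_avgE _ _ (nonneg_le_normal_avg t hc)).
have mf : measurable_fun [set: TR] (fun z : TR => (h (x + z))%:E).
  by apply/measurable_EFinP; exact: measurable_shiftl.
have f0 z : (0 <= (h (x + z))%:E)%E by rewrite lee_fin; have /andP[] := h0 (x + z).
etransitivity; first exact/esym/(ge0_integral_normal_conv s0 t0 mf f0).
apply: eq_integral => y _; rewrite -(normal_avgE t (x + y) hc).
by apply: eq_integral => z _; rewrite addrA.
Qed.

Lemma Rintegral_normal_cst v a : \int[N v]_y (cst a y) = a.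
Proof.
rewrite /Rintegral; have -> : (\int[N v]_y (cst a y)%:E = a%:E * N v [set: TR])%E.
  transitivity (\int[N v]_y (cst a%:E) y)%E => //.
  by rewrite integral_cst.
have -> : (N v [set: TR] = 1)%E by exact: (@probability_setT _ _ _ (N v)).
by rewrite mule1.
Qed.

Lemma normal_avg_dist v c f g e x : nonneg_le c f -> nonneg_le c g ->
  (forall y, `|f y - g y| <= e) -> `|normal_avg v f x - normal_avg v g x| <= e.
Proof.
move=> fc gc fg.
have fi := integrable_nonneg_le v x fc; have gi := integrable_nonneg_le v x gc.
have ie : (N v).-integrable [set: TR] (EFin \o cst e) by exact: finite_measure_integrable_cst.
have ce : \int[N v]_y (cst e y) = e by exact: Rintegral_normal_cst.
have fgi := integrableB measurableT fi gi.
have -> : normal_avg v f x - normal_avg v g x = \int[N v]_y (f (x + y) - g (x + y)).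
  by rewrite RintegralB.
apply: (le_trans (le_normr_Rintegral measurableT fgi)).
rewrite -[leRHS]ce; apply: le_Rintegral => //.
exact: (integrable_norm fgi).
Qed.

Lemma normal_avg_opp v c h x : 0 < v -> nonneg_le c h ->
  \int[N v]_y h (x - y) = normal_avg v h x.
Proof.
move=> v0 [mh h0].
have mf : measurable_fun [set: TR] (fun z : TR => (h (x + z))%:E).
  by apply/measurable_EFinP; exact: measurable_shiftl.
have f0 z : (0 <= (h (x + z))%:E)%E by rewrite lee_fin; have /andP[] := h0 (x + z).
by rewrite /normal_avg /Rintegral -(ge0_integral_normal_opp v0 mf f0).
Qed.

(** Symmetrised in y, both averages are h x + s h2 x / 2 up to third-order terms.
    With r the standard deviation, |y|^3 <= (r y^2 + y^4 / r) / 2 turns the third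
    moment into the second and the fourth. *)
Lemma normal_avg_step K c s h h2 x : 0 < s -> nonneg_le c h -> third_order K h h2 ->
  `|normal_avg s h x - sign_avg (Num.sqrt s) h x| <= 17 * K * (s * Num.sqrt s).
Proof.
move=> s0 hc H; set r := Num.sqrt s.
have r0 : 0 < r by rewrite sqrtr_gt0.
have sE : s = r ^+ 2 by rewrite sqr_sqrtr// ltW.
have K0 : 0 <= K.
  by have := H 0 1; rewrite normr1 !expr1n mulr1; apply: le_trans.
have [i4 e4] := integrable_normal_X4 s0.
have [i2 e2] := normal_second_moment s0.
have i1 := integrable_nonneg_le s x hc.
have i1' : (N s).-integrable [set: TR] (fun y => (h (x - y))%:E).
  have hc' : nonneg_le c (fun y => h (2 * x - y)).
    split; last by move=> y; have [_] := hc; apply.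
    apply: measurableT_comp; first by have [] := hc.
    by apply: measurable_funB.
  have := integrable_nonneg_le s x hc'; apply: eq_integrable => // y _.
  by congr (h _)%:E; ring.
have ic a : (N s).-integrable [set: TR] (EFin \o cst a) by exact: finite_measure_integrable_cst.
have ce a : \int[N s]_y (cst a y) = a by exact: Rintegral_normal_cst.
have E2 : \int[N s]_y (y ^+ 2) = s by rewrite /Rintegral e2.
have E4 : \int[N s]_y (y ^+ 4) <= 64 * s ^+ 2.
  by rewrite /Rintegral -lee_fin fineK//; exact: integrable_fin_num.
pose g y := h (x + y) + h (x - y) - 2 * h x - y ^+ 2 * h2 x.
have iA := integrableD measurableT i1 i1'.
have iB := integrableB measurableT iA (ic (2 * h x)).
have iC : (N s).-integrable [set: TR] (fun y => (y ^+ 2 * h2 x)%:E).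
  by have := integrableZr measurableT (h2 x) i2; apply: eq_integrable.
have ig := integrableB measurableT iB iC.
have Eg : \int[N s]_y g y = 2 * normal_avg s h x - 2 * h x - s * h2 x.
  have e1 : \int[N s]_y g y = \int[N s]_y (h (x + y) + h (x - y) - 2 * h x)
      - \int[N s]_y (y ^+ 2 * h2 x) := RintegralB measurableT iB iC.
  have e3 : \int[N s]_y (h (x + y) + h (x - y) - 2 * h x) =
      \int[N s]_y (h (x + y) + h (x - y)) - \int[N s]_y (cst (2 * h x) y) :=
    RintegralB measurableT iA (ic (2 * h x)).
  have e5 : \int[N s]_y (h (x + y) + h (x - y)) =
      \int[N s]_y h (x + y) + \int[N s]_y h (x - y) := RintegralD measurableT i1 i1'.
  have e6 : \int[N s]_y (y ^+ 2 * h2 x) = \int[N s]_y (y ^+ 2) * h2 x :=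
    RintegralZr (h2 x) measurableT i2.
  rewrite e1 e3 e5 e6 ce E2 (normal_avg_opp x s0 hc) -/(normal_avg s h x).
  by ring.
pose q y := K / 2 * (r * y ^+ 2 + r^-1 * y ^+ 4).
have i2' : (N s).-integrable [set: TR] (fun y => (r * y ^+ 2)%:E).
  by have := integrableZl measurableT r i2; apply: eq_integrable.
have i4' : (N s).-integrable [set: TR] (fun y => (r^-1 * y ^+ 4)%:E).
  by have := integrableZl measurableT r^-1 i4; apply: eq_integrable.
have i24 := integrableD measurableT i2' i4'.
have iq : (N s).-integrable [set: TR] (fun y => (q y)%:E).
  by have := integrableZl measurableT (K / 2) i24; apply: eq_integrable.
have Eq : \int[N s]_y q y <= 65 / 2 * K * (s * r).
  have q1 : \int[N s]_y q y = K / 2 * \int[N s]_y (r * y ^+ 2 + r^-1 * y ^+ 4) :=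
    RintegralZl (K / 2) measurableT i24.
  have q2 : \int[N s]_y (r * y ^+ 2 + r^-1 * y ^+ 4) =
      \int[N s]_y (r * y ^+ 2) + \int[N s]_y (r^-1 * y ^+ 4) :=
    RintegralD measurableT i2' i4'.
  have q3 : \int[N s]_y (r * y ^+ 2) = r * \int[N s]_y (y ^+ 2) :=
    RintegralZl r measurableT i2.
  have q4 : \int[N s]_y (r^-1 * y ^+ 4) = r^-1 * \int[N s]_y (y ^+ 4) :=
    RintegralZl r^-1 measurableT i4.
  rewrite q1 q2 q3 q4 E2.
  apply: (@le_trans _ _ (K / 2 * (r * s + r^-1 * (64 * s ^+ 2)))).
    rewrite ler_wpM2l ?divr_ge0// lerD2l ler_wpM2l// invr_ge0 ltW//.
  rewrite sE le_eqVlt; apply/orP; left; apply/eqP; field.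
  by rewrite gt_eqF.
have gq : `|\int[N s]_y g y| <= 65 / 2 * K * (s * r).
  apply: (le_trans (le_normr_Rintegral measurableT ig)).
  apply: le_trans Eq; apply: le_Rintegral => //; first exact: (integrable_norm ig).
  move=> y _; apply: (le_trans (H x y)); rewrite /q -mulrA ler_wpM2l//.
  have -> : `|y| ^+ 3 = `|y| * y ^+ 2 by rewrite -(real_normK (num_real y)); ring.
  have -> : y ^+ 4 = y ^+ 2 * y ^+ 2 by ring.
  have -> : 2^-1 * (r * y ^+ 2 + r^-1 * (y ^+ 2 * y ^+ 2)) =
      2^-1 * (r + r^-1 * y ^+ 2) * y ^+ 2 by ring.
  apply: ler_wpM2r; first exact: sqr_ge0.
  rewrite -(real_normK (num_real y)) -subr_ge0.
  have -> : 2^-1 * (r + r^-1 * `|y| ^+ 2) - `|y| = (`|y| - r) ^+ 2 / (2 * r).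
    by field; rewrite gt_eqF.
  by rewrite divr_ge0 ?sqr_ge0// mulr_ge0// ltW.
have := H x r; rewrite (gtr0_norm r0) -sE.
rewrite (_ : r ^+ 3 = s * r); last by rewrite sE; ring.
rewrite Eg in gq; move: gq; rewrite /sign_avg !ler_norml => /andP[a1 a2] /andP[b1 b2].
have sr0 : 0 <= K * (s * r) by rewrite !mulr_ge0// ltW.
by apply/andP; split; lra.
Qed.

(** By the semigroup property the Gaussian step splits into m.+1 steps of variance s,
    which are exchanged for signs one after the other. *)
Lemma normal_avg_clt K c s h h2 m x : 0 < s -> nonneg_le c h -> third_order K h h2 ->
  `|normal_avg (m.+1%:R * s) h x - iter m.+1 (sign_avg (Num.sqrt s)) h x| <=
  m.+1%:R * (17 * K * (s * Num.sqrt s)).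
Proof.
move=> s0; elim: m h h2 => [|m IH] h h2 hc H.
  by rewrite !mul1r; exact: normal_avg_step hc H.
set e := 17 * K * _; rewrite iterSr -[m.+2%:R]natr1 !mulrDl !mul1r.
have ms0 : 0 < m.+1%:R * s by rewrite mulr_gt0.
rewrite (normal_avgD x ms0 s0 hc).
have hB := nonneg_le_sign_avg (Num.sqrt s) hc.
have HB := third_order_sign_avg (Num.sqrt s) H.
apply: (le_trans (ler_distD (normal_avg (m.+1%:R * s) (sign_avg (Num.sqrt s) h) x) _ _)).
rewrite addrC; apply: lerD; first exact: IH hB HB.
apply: (normal_avg_dist _ _ (nonneg_le_normal_avg s hc) hB) => y.
exact: normal_avg_step hc H.
Qed.

End clt.

(** * Integrating out one independent coordinate *)

Lemma integral_prob_cst {R : realType} d (T : measurableType d) (P : probability T R)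
  (c : R) : (\int[P]_x (cst c%:E) x = c%:E)%E.
Proof.
rewrite integral_cst//; have h := @probability_setT _ _ _ P.
by transitivity (c%:E * 1)%E; [congr (_ * _)%E|rewrite mule1].
Qed.

Section independence.
Context {R : realType}.
Local Notation TR := (measurableTypeR R).

(** The joint law of Z and X is the product measure, to which Tonelli applies. *)
Lemma ge0_integral_indep d d' (T : measurableType d) (T' : measurableType d')
    (P : probability T R) (Z : T -> T') (X : T -> TR) (mu : probability TR R)
    (F : T' * TR -> \bar R) :
  measurable_fun [set: T] Z -> measurable_fun [set: T] X ->
  (forall A B, measurable A -> measurable B ->
     (P (Z @^-1` A `&` X @^-1` B)%classic = P (Z @^-1` A)%classic * mu B)%E) ->
  measurable_fun [set: T' * TR] F -> (forall p, (0 <= F p)%E) ->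
  (\int[P]_w F (Z w, X w) = \int[P]_w \int[mu]_y F (Z w, y))%E.
Proof.
move=> mZ mX indep mF F0.
have mZX : measurable_fun [set: T] (fun w => (Z w, X w) : T' * TR).
  exact: measurable_fun_pair.
pose Zf : {mfun T >-> T'} := HB.pack Z (isMeasurableFun.Build _ _ _ _ _ mZ).
pose ZXf : {mfun T >-> (T' * TR)%type} := HB.pack (fun w => (Z w, X w) : T' * TR)
  (isMeasurableFun.Build _ _ _ _ _ mZX).
pose nu := pushforward P Zf.
have nuE A B : measurable A -> measurable B ->
    (pushforward P ZXf (A `*` B)%classic = nu A * mu B)%E.
  move=> mA mB; rewrite /nu /pushforward -indep//; congr (P _).
have mI : measurable_fun [set: T'] (fun z => \int[mu]_y F (z, y))%E.
  exact: (measurable_fun_fubini_tonelli_F F).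
transitivity (\int[pushforward P ZXf]_p F p)%E.
  by rewrite ge0_integral_pushforward.
transitivity (\int[distribution P Zf \x mu]_p F p)%E.
  apply: eq_measure_integral => A mA _; apply/esym.
  exact: (@product_measure_unique _ _ _ _ _ (distribution P Zf) mu _ nuE).
rewrite fubini_tonelli1//= ge0_integral_pushforward//.
by move=> z _; apply: integral_ge0.
Qed.

End independence.

Section coordinates.
Context {R : realType} {E : finType} d (T : measurableType d) (P : probability T R).
Local Notation TR := (measurableTypeR R).
Variables (X : E -> T -> R) (e : E).
Hypothesis mX : forall i, measurable_fun [set: T] (X i).
Hypothesis indepX : mutually_independent P X.

(** A pi-system generating the sigma-algebra of the coordinates other than e. *)
Definition box : set (set T) :=
  [set A | exists2 B : E -> set R, (forall i, measurable (B i)) &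
    A = [set w | forall i, i != e -> B i (X i w)]]%classic.

Lemma measurable_box : (box `<=` measurable)%classic.
Proof.
move=> _ [B mB ->].
rewrite (_ : [set w | _] = \bigcap_(i in [set i | i != e]) (X i @^-1` B i))%classic; last first.
  by apply/seteqP; split => w /= h i; exact: h.
apply: fin_bigcap_measurable; first exact: finite_finset.
by move=> i _; rewrite -[X in measurable X]setTI; exact: mX.
Qed.

Lemma setI_box : setI_closed box.
Proof.
move=> _ _ [B mB ->] [C mC ->]; exists (fun i => B i `&` C i)%classic.
  by move=> i; exact: measurableI.
apply/seteqP; split => w /=.
  by move=> [h1 h2] i ie; split; [exact: h1|exact: h2].
by move=> h; split => i ie; have [] := h i ie.
Qed.

(** Independence on the pi-system extends by uniqueness of finite measures. *)
Lemma box_indep A (B : set R) : (<<s box >>)%classic A -> measurable B ->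
  (P (A `&` X e @^-1` B)%classic = P A * P (X e @^-1` B)%classic)%E.
Proof.
move=> sA mB.
have mXB : measurable (X e @^-1` B)%classic.
  by rewrite -[X in measurable X]setTI; exact: mX.
have c0 : 0 <= fine (P (X e @^-1` B)%classic) by rewrite fine_ge0.
have cE : (P (X e @^-1` B)%classic = (NngNum c0)%:num%:E)%E by rewrite fineK// fin_num_measure.
pose m1 := mrestr P mXB.
pose m2 := mscale (NngNum c0) P.
have m1E C : (m1 C = P (C `&` X e @^-1` B)%classic)%E by [].
have m2E C : (m2 C = P C * P (X e @^-1` B)%classic)%E by rewrite muleC cE.
rewrite -m1E -m2E.
apply: (@g_sigma_algebra_measure_unique _ _ _ box measurable_box (fun=> setT)) => //.
- by move=> _; exists (fun=> setT) => //; apply/seteqP; split.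
- by rewrite bigcup_const//; exists 0%N.
- exact: setI_box.
- move=> _ [C mC ->]; apply: (eq_trans (m1E _)); apply: (eq_trans _ (esym (m2E _))).
  pose D i := if i == e then B else C i.
  have mD i : measurable (D i) by rewrite /D; case: eqP.
  have De : D e = B by rewrite /D eqxx.
  pose J0 : {set E} := finset predT; pose J1 : {set E} := finset (predC1 e).
  have inJ0 i : i \in J0 by rewrite inE.
  have inJ1 i : (i \in J1) = (i != e) by rewrite !inE.
  have hT := indepX J0 mD; have hC := indepX J1 mD.
  rewrite (bigD1 e) ?inJ0//= De in hT; move: hC hT.
  have -> : [set w | forall i, i \in J1 -> D i (X i w)]%classic =
      [set w | forall i, i != e -> C i (X i w)]%classic.
    apply/seteqP; split => w /= h i ie.
      by have := h i; rewrite inJ1 /D (negbTE ie); apply.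
    by rewrite inJ1 in ie; rewrite /D (negbTE ie); exact: h.
  have -> : [set w | forall i, i \in J0 -> D i (X i w)]%classic =
      ([set w | forall i, i != e -> C i (X i w)] `&` X e @^-1` B)%classic.
    apply/seteqP; split => w /= h.
      split => [i ie|]; first by have := h i (inJ0 i); rewrite /D (negbTE ie); apply.
      by have := h e (inJ0 e); rewrite De.
    by move=> i _; rewrite /D; case: eqP => [->|/eqP ie]; [exact: h.2|exact: h.1].
  move=> -> ->; rewrite muleC; congr (_ * _)%E.
  by apply: eq_bigl => i; rewrite inJ0 inJ1.
- by move=> k; rewrite /m1 /mrestr; apply: (le_lt_trans (probability_le1 _ _)); rewrite ?ltry//; exact: measurableI.
Qed.

Lemma ge0_integral_box (mu : probability TR R) (F : g_sigma_algebraType box * TR -> \bar R) :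
  (forall B : set R, measurable B -> (P (X e @^-1` B)%classic = mu B)%E) ->
  measurable_fun [set: g_sigma_algebraType box * TR] F -> (forall p, (0 <= F p)%E) ->
  (\int[P]_w F (w, X e w) = \int[P]_w \int[mu]_y F (w, y))%E.
Proof.
move=> law mF F0.
have mid : measurable_fun [set: T] (id : T -> g_sigma_algebraType box).
  move=> _ A mA; rewrite setTI preimage_id.
  exact: (smallest_sub (@sigma_algebra_measurable _ T) measurable_box mA).
apply: (ge0_integral_indep mid) => //; first exact: mX.
by move=> A B mA mB; rewrite preimage_id box_indep// law.
Qed.

Lemma measurable_box_coord i : i != e ->
  measurable_fun [set: g_sigma_algebraType box] (X i : g_sigma_algebraType box -> R).
Proof.
move=> ie _ A mA; rewrite setTI; apply: sub_sigma_algebra.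
exists (fun j => if j == i then A else setT) => [j|]; first by case: eqP.
apply/seteqP; split => w /=.
  by move=> h j _; case: eqP => [->|].
by move=> /(_ i ie); rewrite eqxx.
Qed.

End coordinates.

(** Measurability in finitely many coordinates, tested against measurable families
    instead of a sigma-algebra on finite functions. *)
Definition coord_measurable {R : realType} {E : finType} (f : {ffun E -> R} -> R) : Prop :=
  forall d (T : measurableType d) (Y : E -> T -> R),
    (forall i, measurable_fun [set: T] (Y i)) ->
    measurable_fun [set: T] (fun w => f [ffun i => Y i w]).

Section replacement.
Context {R : realType} {E : finType} d (T : measurableType d) (P : probability T R).
Local Notation TR := (measurableTypeR R).
Local Notation V := {ffun E -> R}.
Variables (X : E -> T -> R).
Hypothesis mX : forall i, measurable_fun [set: T] (X i).
Hypothesis indepX : mutually_independent P X.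
Implicit Types (f g : V -> R) (x : V) (e : E) (y K c : R).

Definition delta e y : V := [ffun i => if i == e then y else 0].

Lemma deltaN e y : delta e (- y) = - delta e y.
Proof. by apply/ffunP => i; rewrite !ffunE; case: eqP; rewrite ?oppr0. Qed.

Lemma deltaD e y z : delta e (y + z) = delta e y + delta e z.
Proof. by apply/ffunP => i; rewrite !ffunE; case: eqP; rewrite ?addr0. Qed.

Definition coord_step e y : (V -> R) -> V -> R :=
  tav (fun b : bool => delta e (sg b * y)).

Lemma coord_stepE e y f x :
  coord_step e y f x = 2^-1 * (f (x + delta e y) + f (x - delta e y)).
Proof.
rewrite /coord_step /tav /avg card_bool big_bool /sg/= expr1 expr0 mul1r mulN1r deltaN.
by rewrite addrC.
Qed.

Lemma iter_coord_step e y n f x : iter n (coord_step e y) f x =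
  iter n (sign_avg y) (fun z => f (x + delta e z)) 0.
Proof.
suff h a : iter n (coord_step e y) f (x + delta e a) =
    iter n (sign_avg y) (fun z => f (x + delta e z)) a.
  rewrite -h (_ : delta e 0 = 0) ?addr0//.
  by apply/ffunP => i; rewrite !ffunE; case: eqP.
elim: n a => //= n IH a; rewrite coord_stepE /sign_avg -!IH !deltaD deltaN.
by rewrite !addrA.
Qed.

(** The assumptions of the one-dimensional limit theorem in each coordinate,
    uniformly in the others. *)
Definition smooth_le c K f : Prop :=
  [/\ coord_measurable f, (forall x, 0 <= f x <= c) &
    forall e, exists f2, forall x y,
    `|f (x + delta e y) + f (x - delta e y) - 2 * f x - y ^+ 2 * f2 x| <= K * `|y| ^+ 3].

Lemma coord_measurableD f a : coord_measurable f -> coord_measurable (fun x => f (x + a)).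
Proof.
move=> mf d' T' Y mY.
rewrite (_ : (fun w => _) = fun w => f [ffun i => Y i w + a i]).
  by apply: (mf d' T' (fun i w => Y i w + a i)) => i; exact: measurable_funD.
by apply/funext => w; congr (f _); apply/ffunP => i; rewrite !ffunE.
Qed.

Lemma smooth_le_coord_step c K e y f : smooth_le c K f -> smooth_le c K (coord_step e y f).
Proof.
move=> [mf fc f3]; split.
- move=> d' T' Y mY.
  under eq_fun do rewrite coord_stepE.
  apply: measurable_funM => //; apply: measurable_funD.
    exact: (coord_measurableD (delta e y) mf).
  exact: (coord_measurableD (- delta e y) mf).
- move=> x; rewrite coord_stepE.
  have /andP[a1 a2] := fc (x + delta e y); have /andP[b1 b2] := fc (x - delta e y).
  by apply/andP; split; lra.
- move=> i; have [f2 H] := f3 i; exists (coord_step e y f2) => x z.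
  rewrite !coord_stepE.
  have := H (x + delta e y) z; have := H (x - delta e y) z.
  rewrite (addrAC x _ (delta i z)) (addrAC x _ (- delta i z)).
  rewrite (addrAC x _ (delta i z)) (addrAC x _ (- delta i z)).
  rewrite !ler_norml => /andP[a1 a2] /andP[b1 b2]; apply/andP; split; lra.
Qed.

Lemma smooth_le_iter c K e y n f : smooth_le c K f ->
  smooth_le c K (iter n (coord_step e y) f).
Proof. by move=> h; elim: n => //= n; exact: smooth_le_coord_step. Qed.

(** The coordinates already replaced are set to 0, their randomness being moved into
    the test function. *)
Definition kill (s : seq E) x : V := [ffun i => if i \in s then 0 else x i].

Lemma coord_measurable_kill s f : coord_measurable f ->
  coord_measurable (fun x => f (kill s x)).
Proof.
move=> mf d' T' Y mY.
rewrite (_ : (fun w => _) = fun w => f [ffun i => if i \in s then 0 else Y i w]).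
  by apply: (mf d' T' (fun (i : E) (w : T') => if i \in s then 0 else Y i w)) => i /=; case: (i \in s).
by apply/funext => w; congr (f _); apply/ffunP => i; rewrite !ffunE.
Qed.

Definition Xv (w : T) : V := [ffun i => X i w].

Lemma integrable_smooth c f : coord_measurable f -> (forall x, 0 <= f x <= c) ->
  P.-integrable [set: T] (fun w => (f (Xv w))%:E).
Proof.
move=> mf fc.
apply: (@le_integrable _ _ _ P _ measurableT _ (EFin \o cst c)).
- by apply/measurable_EFinP; exact: mf.
- move=> w _ /=; rewrite lee_fin; have /andP[h0 h1] := fc (Xv w).
  by rewrite !ger0_norm// (le_trans h0).
- exact: finite_measure_integrable_cst.
Qed.

(** The coordinate e is independent of the remaining ones, so it can be integrated
    out alone; T1 stands for the averaging operator that is put in its place. *)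
Lemma replace_coord c f e s (mu : probability TR R) (T1 : (V -> R) -> V -> R) err :
  (forall B : set R, measurable B -> (P (X e @^-1` B)%classic = mu B)%E) ->
  coord_measurable f -> (forall x, 0 <= f x <= c) ->
  coord_measurable (T1 f) -> (forall x, 0 <= T1 f x <= c) -> e \notin s ->
  (forall x, x e = 0 -> `|\int[mu]_y f (x + delta e y) - T1 f x| <= err) ->
  `|\int[P]_w f (kill s (Xv w)) - \int[P]_w T1 f (kill (e :: s) (Xv w))| <= err.
Proof.
move=> law mf fc mT Tc es H.
pose F (p : g_sigma_algebraType (box X e) * TR) : \bar R :=
  (f (kill (e :: s) (Xv p.1) + delta e p.2))%:E.
have mF : measurable_fun [set: g_sigma_algebraType (box X e) * TR] F.
  apply/measurable_EFinP.
  pose Y i (p : g_sigma_algebraType (box X e) * TR) : R :=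
    if i == e then p.2 else if i \in s then 0 else X i p.1.
  rewrite (_ : (fun p => _) = fun p => f [ffun i => Y i p]).
    apply: mf => i; rewrite /Y; case: (eqVneq i e) => [_|ie]; first exact: measurable_snd.
    case: (i \in s); first exact: measurable_cst.
    have mXi : measurable_fun [set: g_sigma_algebraType (box X e)]
        (X i : g_sigma_algebraType (box X e) -> R) by exact: measurable_box_coord.
    by apply: (measurableT_comp mXi); exact: measurable_fst.
  apply/funext => p; congr (f _); apply/ffunP => i; rewrite !ffunE /Y inE.
  by case: eqP => [_|_] /=; rewrite ?add0r ?addr0.
have F0 p : (0 <= F p)%E by rewrite lee_fin; have /andP[] := fc (kill (e :: s) (Xv p.1) + delta e p.2).
have fF w : (f (kill s (Xv w)))%:E = F (w, X e w).
  congr (f _)%:E; apply/ffunP => i; rewrite !ffunE inE.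
  case: eqP => [->|_] /=; first by rewrite (negbTE es) add0r.
  by rewrite addr0.
have main := ge0_integral_box mX indepX law mF F0.
have mFw w : measurable_fun [set: TR] (fun y => F (w, y)).
  apply/measurable_EFinP.
  pose Y i (y : TR) : R := kill (e :: s) (Xv w) i + (if i == e then y else 0).
  rewrite (_ : (fun y => _) = fun y => f [ffun i => Y i y]).
    by apply: mf => i; rewrite /Y; apply: measurable_funD => //; case: (i == e).
  by apply/funext => y; congr (f _); apply/ffunP => i; rewrite !ffunE /Y !ffunE.
have Fc w y : (F (w, y) <= c%:E)%E.
  by rewrite lee_fin; have /andP[] := fc (kill (e :: s) (Xv w) + delta e y).
have c0 : 0 <= c by have /andP[h0 h1] := fc 0; exact: le_trans h1.
pose I w := \int[mu]_y f (kill (e :: s) (Xv w) + delta e y).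
have IE w : (\int[mu]_y F (w, y) = (I w)%:E)%E.
  rewrite fineK//; apply: integrable_fin_num => //.
  apply: (@le_integrable _ _ _ mu _ measurableT _ (EFin \o cst c)).
  - exact: (mFw w).
  - move=> y _ /=; rewrite lee_fin; have /andP[h0 h1] := fc (kill (e :: s) (Xv w) + delta e y).
    by rewrite !ger0_norm.
  - exact: finite_measure_integrable_cst.
have If : \int[P]_w f (kill s (Xv w)) = \int[P]_w I w.
  rewrite /Rintegral; congr fine.
  transitivity (\int[P]_w F (w, X e w))%E; first by apply: eq_integral => w _.
  by rewrite main; apply: eq_integral => w _; rewrite IE.
have mI : measurable_fun [set: T] I.
  apply/measurable_EFinP; rewrite (_ : EFin \o I = fun w => \int[mu]_y F (w, y))%E; last first.
    by apply/funext => w /=; rewrite -IE.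
  have mG : measurable_fun [set: g_sigma_algebraType (box X e)]
      (fun w => \int[mu]_y F (w, y))%E.
    exact: (measurable_fun_fubini_tonelli_F F).
  move=> _ A mA; have := mG measurableT A mA; rewrite !setTI => h.
  exact: (smallest_sub (@sigma_algebra_measurable _ T) (measurable_box mX) h).
have Ic w : 0 <= I w <= c.
  have h1 : (I w)%:E = (\int[mu]_y F (w, y))%E by rewrite IE.
  apply/andP; split; first by rewrite -lee_fin h1; apply: integral_ge0.
  rewrite -lee_fin h1; apply: (@le_trans _ _ (\int[mu]_y (cst c%:E) y)%E).
    by apply: ge0_le_integral => // y _; exact: Fc.
  by rewrite integral_prob_cst.
have iP (h : T -> R) : measurable_fun [set: T] h -> (forall w, 0 <= h w <= c) ->
    P.-integrable [set: T] (EFin \o h).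
  move=> mh hc; apply: (@le_integrable _ _ _ P _ measurableT _ (EFin \o cst c)).
  - exact/measurable_EFinP.
  - move=> w _ /=; rewrite lee_fin; have /andP[h0 h1] := hc w.
    by rewrite !ger0_norm// (le_trans h0).
  - exact: finite_measure_integrable_cst.
have iI := iP _ mI Ic.
have iT := iP (fun w => T1 f (kill (e :: s) (Xv w)))
  (coord_measurable_kill (e :: s) mT mX) (fun w => Tc _).
rewrite If -RintegralB//.
apply: (le_trans (le_normr_Rintegral measurableT (integrableB measurableT iI iT))).
have -> : err = \int[P]_w (cst err w).
  by rewrite -[RHS]/(fine (\int[P]_x (cst err%:E) x)%E) integral_prob_cst.
apply: le_Rintegral => //.
- exact: (integrable_norm (integrableB measurableT iI iT)).
- exact: finite_measure_integrable_cst.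
- by move=> w _; apply: H; rewrite ffunE inE eqxx.
Qed.

End replacement.

(** * Gaussian vectors as limits of sums of signs *)

Section gaussian_vector.
Context {R : realType} {E : finType}.
Local Notation TR := (measurableTypeR R).
Local Notation V := {ffun E -> R}.
Local Notation N v := (normal_prob 0 (Num.sqrt (v : R))).

Lemma coord_measurable_line (f : V -> R) x e : coord_measurable f ->
  measurable_fun [set: TR] (fun y : TR => f (x + delta e y)).
Proof.
move=> mf; pose Y i (y : TR) : R := x i + (if i == e then y else 0).
rewrite (_ : (fun y => _) = fun y => f [ffun i => Y i y]).
  by apply: mf => i; rewrite /Y; apply: measurable_funD => //; case: (i == e).
by apply/funext => y; congr (f _); apply/ffunP => i; rewrite !ffunE /Y.
Qed.

Lemma normal_coord_clt (v c K : R) (f : V -> R) e x m : 0 < v -> smooth_le c K f ->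
  `|\int[N v]_y f (x + delta e y)
    - iter m.+1 (coord_step e (Num.sqrt (v / m.+1%:R))) f x| <=
  17 * K * (v * Num.sqrt (v / m.+1%:R)).
Proof.
move=> v0 [mf fc f3]; have [f2 H] := f3 e.
have m0 : 0 < m.+1%:R :> R by rewrite ltr0n.
have s0 : 0 < v / m.+1%:R by rewrite divr_gt0.
pose h y := f (x + delta e y).
have hc : nonneg_le c h by split; [exact: coord_measurable_line|move=> y; exact: fc].
have h3 : third_order K h (fun y => f2 (x + delta e y)).
  by move=> y z; have := H (x + delta e y) z; rewrite /h !deltaD deltaN !addrA.
have := normal_avg_clt m 0 s0 hc h3.
rewrite iter_coord_step (_ : m.+1%:R * (v / m.+1%:R) = v); last first.
  by rewrite mulrCA divff ?mulr1// gt_eqF.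
rewrite /normal_avg; under eq_Rintegral do rewrite add0r.
rewrite (_ : m.+1%:R * (17 * K * _) = 17 * K * (v * Num.sqrt (v / m.+1%:R)))//.
by set q := Num.sqrt _; field; rewrite gt_eqF.
Qed.

Lemma dirac_coord_clt (f : V -> R) e x n c K : smooth_le c K f ->
  `|\int[dirac (0 : TR)]_y f (x + delta e y) - iter n (coord_step e 0) f x| <= 0.
Proof.
move=> [mf _ _]; rewrite normr_le0 subr_eq0; apply/eqP.
have d0 : delta e 0 = 0 :> V by apply/ffunP => i; rewrite !ffunE; case: eqP.
have -> : iter n (coord_step e 0) f = f.
  elim: n => //= n ->; apply/funext => y; rewrite coord_stepE d0 subr0 addr0.
  by field.
rewrite /Rintegral integral_dirac//; last first.
  by apply/measurable_EFinP; exact: coord_measurable_line.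
by rewrite diracE mem_set// mul1e d0 addr0.
Qed.

(** The m.+1 signs have total variance v; for v = 0 both averages are the value at
    the centre. *)
Lemma centered_gaussian_coord_clt (v : R) : 0 <= v ->
  exists2 mu : probability TR R,
    (forall B : set R, measurable B -> centered_gaussian_law v B = mu B) &
    forall c K (f : V -> R) e x m, smooth_le c K f ->
    `|\int[mu]_y f (x + delta e y)
      - iter m.+1 (coord_step e (Num.sqrt (v / m.+1%:R))) f x| <=
    17 * K * (v * Num.sqrt (v / m.+1%:R)).
Proof.
rewrite le_eqVlt => /orP[/eqP <-|v0].
  exists (dirac (0 : TR) : probability TR R).
    by move=> B mB; rewrite /centered_gaussian_law eqxx.
  move=> c K f e x m Hf; rewrite !mul0r sqrtr0 mulr0.
  exact: dirac_coord_clt Hf.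
exists (N v : probability TR R).
  by move=> B mB; rewrite /centered_gaussian_law gt_eqF.
by move=> c K f e x m; exact: normal_coord_clt.
Qed.

Section replace_all.
Context d (T : measurableType d) (P : probability T R) (X : E -> T -> R) (v : E -> R).
Hypothesis mX : forall i, measurable_fun [set: T] (X i).
Hypothesis indepX : mutually_independent P X.
Hypothesis v_ge0 : forall e, 0 <= v e.
Hypothesis lawX : forall e (B : set R), measurable B ->
  P (X e @^-1` B)%classic = centered_gaussian_law (v e) B.

Definition step_all m (s : seq E) (f : V -> R) : V -> R :=
  foldr (fun e g => iter m (coord_step e (Num.sqrt (v e / m%:R))) g) f s.

Lemma smooth_le_step_all m s c K (f : V -> R) : smooth_le c K f -> smooth_le c K (step_all m s f).
Proof. by move=> h; elim: s => //= e s IH; exact: smooth_le_iter. Qed.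

(** Lindeberg's replacement of the coordinates one after the other. *)
Lemma gaussian_step_all m s c K (f : V -> R) : uniq s -> smooth_le c K f ->
  `|\int[P]_w f (Xv X w) - \int[P]_w step_all m.+1 s f (kill s (Xv X w))| <=
  \sum_(e <- s) 17 * K * (v e * Num.sqrt (v e / m.+1%:R)).
Proof.
move=> us Hf; elim: s us => [_|e s IH].
  rewrite big_nil (_ : (fun w => step_all _ _ _ _) = fun w => f (Xv X w)); last first.
    by apply/funext => w; congr (f _); apply/ffunP => i; rewrite !ffunE.
  by rewrite subrr normr0.
rewrite cons_uniq => /andP[es us]; rewrite big_cons [leRHS]addrC.
apply: (le_trans (ler_distD (\int[P]_w step_all m.+1 s f (kill s (Xv X w))) _ _)).
apply: lerD; first exact: IH.
have [mu muE muH] := centered_gaussian_coord_clt (v_ge0 e).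
have Hg := smooth_le_step_all m.+1 s Hf; have [mg gc _] := Hg.
have Hg' := smooth_le_iter e (Num.sqrt (v e / m.+1%:R)) m.+1 Hg; have [mg' gc' _] := Hg'.
apply: (replace_coord mX indepX (mu := mu) (T1 := iter m.+1 (coord_step e _))
  _ mg gc mg' gc' es).
  by move=> B mB; rewrite lawX// muE.
by move=> x _; exact: muH Hg.
Qed.

End replace_all.

(** Steps in distinct coordinates commute, and one step in each of them makes one
    step of the walk. *)
Lemma step_all_walk (v : E -> R) m (f : V -> R) x : (0 < m)%N ->
  (forall e, 0 <= v e) ->
  step_all v m (enum E) f x =
  iter m (walk (fun e => Num.sqrt (v e)) (Num.sqrt m%:R^-1)) f x.
Proof.
move=> m0 v0; pose y e := Num.sqrt (v e / m%:R).
pose W s (g : V -> R) := foldr (fun e g => coord_step e (y e) g) g s.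
have WC s e n g : W s (iter n (coord_step e (y e)) g) = iter n (coord_step e (y e)) (W s g).
  elim: s => //= e' s ->; rewrite /coord_step.
  exact: iter_tavC.
have hW s g : step_all v m s g = iter m (W s) g.
  have hit e s' n h : iter n (coord_step e (y e)) (iter n (W s') h) = iter n (W (e :: s')) h.
    by elim: n => // n IHn; rewrite iterS [iter n.+1 (W s') h]iterS -WC IHn.
  elim: s => [|e s IH]; first by rewrite /W/=; elim: (m) => //= n <-.
  by rewrite -hit -IH.
rewrite hW; suff -> : W (enum E) = walk (fun e => Num.sqrt (v e)) (Num.sqrt m%:R^-1) by [].
have hs s : uniq s -> forall g a, W s g a =
    avg (fun eta : {ffun E -> bool} => g (a + [ffun e => if e \in s then sg (eta e) * y e else 0])).
  elim: s => [_|e s IH]; move=> /=.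
    move=> g a; rewrite -[LHS](@avg_cst _ {ffun E -> bool} [ffun => true]).
    apply: eq_avg => eta; congr (g _); apply/ffunP => i; by rewrite !ffunE addr0.
  move=> /andP[es us] g a.
  pose u (eta : {ffun E -> bool}) : V := [ffun i => if i \in s then sg (eta i) * y i else 0].
  pose u' (eta : {ffun E -> bool}) : V := [ffun i => if i \in e :: s then sg (eta i) * y i else 0].
  have uE eta : u' eta = delta e (sg (eta e) * y e) + u eta.
    apply/ffunP => i; rewrite !ffunE inE; case: eqP => [->|_]; rewrite ?add0r//=.
    by rewrite (negbTE es) addr0.
  have uF eta : u (flip e eta) = u eta.
    apply/ffunP => i; rewrite !ffunE; case: eqP => // ->.
    by rewrite (negbTE es).
  rewrite coord_stepE !IH// -/u.
  transitivity (avg (fun eta => 2^-1 * (g (a + u' eta) + g (a + u' (flip e eta))))).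
    rewrite -avgD -avgZ; apply: eq_avg => eta; congr (_ * _).
    rewrite !uE uF ffunE eqxx sgN mulNr deltaN !addrA /sg.
    case: (eta e); rewrite /= ?expr1 ?expr0 ?mul1r ?mulN1r ?deltaN ?opprK//.
    exact: addrC.
  rewrite avgZ avgD (avg_flip e (fun eta => g (a + u' eta))).
  by rewrite -/u'; field.
apply/funext => g; apply/funext => a; rewrite hs ?enum_uniq//.
apply: eq_avg => eta; congr (g (a + _)); apply/ffunP => e; rewrite !ffunE mem_enum inE.
by rewrite /y sqrtrM//; ring.
Qed.

End gaussian_vector.

(** * Smoothness of the free energy in each disorder variable *)

(** D1 and D2 stand for the increments of a free energy in two opposite directions,
    with linear parts a and - a and total second-order part g. *)
Lemma cos_second_difference {R : realType} (lam th D1 D2 a g z : R) :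
  0 <= lam -> 0 <= z <= 4^-1 -> `|a| <= z -> `|g| <= 2 * z ^+ 2 ->
  `|D1 - a| <= 7 * z ^+ 2 -> `|D2 + a| <= 7 * z ^+ 2 ->
  `|D1 + D2 - g| <= 46 * z ^+ 3 ->
  `|2 * cos th - cos (th + lam * D1) - cos (th + lam * D2)
    - (lam ^+ 2 * a ^+ 2 * cos th + lam * g * sin th)| <=
  (28 * lam ^+ 2 + 42 * lam ^+ 4 + 46 * lam + 54 * lam ^+ 3) * z ^+ 3.
Proof.
move=> lam0 /andP[z0 z4] az gz D1a D2a Dg.
have half (D s : R) : `|D - s| <= 7 * z ^+ 2 -> `|s| <= z ->
    [/\ `|D| <= 3 * z, `|D ^+ 2 - s ^+ 2| <= 28 * z ^+ 3 & `|D| ^+ 4 <= 21 * z ^+ 3].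
  move=> Ds sz; have D3 : `|D| <= 3 * z.
    rewrite -(subrK s D); apply: (le_trans (ler_normD _ _)).
    apply: (le_trans (lerD Ds sz)); nra.
  split => //.
    have -> : D ^+ 2 - s ^+ 2 = (D - s) * (D + s) by ring.
    rewrite normrM (_ : 28 * z ^+ 3 = (7 * z ^+ 2) * (4 * z)); last by ring.
    apply: ler_pM => //; apply: (le_trans (ler_normD _ _)); lra.
  apply: (@le_trans _ _ ((3 * z) ^+ 4)); first by rewrite lerXn2r ?nnegrE// mulr_ge0.
  rewrite (_ : (3 * z) ^+ 4 = (81 * z) * z ^+ 3); last by ring.
  by rewrite ler_wpM2r ?exprn_ge0//; lra.
have [d1 q1 f1] := half _ _ D1a az.
have [d2 q2 f2] : [/\ `|D2| <= 3 * z, `|D2 ^+ 2 - a ^+ 2| <= 28 * z ^+ 3 &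
    `|D2| ^+ 4 <= 21 * z ^+ 3].
  have := half D2 (- a); rewrite opprK sqrrN normrN; exact.
have c1 := cos_bound4 (lam * D1); have c2 := cos_bound4 (lam * D2).
have s1 := sin_bound3 (lam * D1); have s2 := sin_bound3 (lam * D2).
set A := - ((cos (lam * D1) - 1 + (lam * D1) ^+ 2 / 2)
  + (cos (lam * D2) - 1 + (lam * D2) ^+ 2 / 2))
  + lam ^+ 2 / 2 * ((D1 ^+ 2 - a ^+ 2) + (D2 ^+ 2 - a ^+ 2)).
set B := (sin (lam * D1) - lam * D1) + (sin (lam * D2) - lam * D2) + lam * (D1 + D2 - g).
have -> : 2 * cos th - cos (th + lam * D1) - cos (th + lam * D2)
    - (lam ^+ 2 * a ^+ 2 * cos th + lam * g * sin th) = cos th * A + sin th * B.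
  by rewrite !cosD /A /B; field.
have nA : `|A| <= (28 * lam ^+ 2 + 42 * lam ^+ 4) * z ^+ 3.
  rewrite /A; apply: (le_trans (ler_normD _ _)).
  rewrite normrN (_ : (28 * lam ^+ 2 + 42 * lam ^+ 4) * z ^+ 3 =
    (lam ^+ 4 * (21 * z ^+ 3) + lam ^+ 4 * (21 * z ^+ 3)) +
    lam ^+ 2 / 2 * (28 * z ^+ 3 + 28 * z ^+ 3)); last by field.
  apply: lerD.
    apply: (le_trans (ler_normD _ _)); apply: lerD.
      apply: (le_trans c1); rewrite normrM exprMn (ger0_norm lam0).
      by rewrite ler_wpM2l ?exprn_ge0.
    apply: (le_trans c2); rewrite normrM exprMn (ger0_norm lam0).
    by rewrite ler_wpM2l ?exprn_ge0.
  rewrite normrM ger0_norm ?divr_ge0 ?exprn_ge0//.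
  rewrite ler_wpM2l ?divr_ge0 ?exprn_ge0//.
  by apply: (le_trans (ler_normD _ _)); apply: lerD.
have nB : `|B| <= (46 * lam + 54 * lam ^+ 3) * z ^+ 3.
  rewrite /B; apply: (le_trans (ler_normD _ _)).
  rewrite (_ : (46 * lam + 54 * lam ^+ 3) * z ^+ 3 =
    (lam ^+ 3 * (3 * z) ^+ 3 + lam ^+ 3 * (3 * z) ^+ 3) +
    lam * (46 * z ^+ 3)); last by ring.
  apply: lerD; last by rewrite normrM (ger0_norm lam0) ler_wpM2l.
  apply: (le_trans (ler_normD _ _)); apply: lerD.
    apply: (le_trans s1); rewrite normrM exprMn (ger0_norm lam0).
    by rewrite ler_wpM2l ?exprn_ge0// lerXn2r// nnegrE ?mulr_ge0.
  apply: (le_trans s2); rewrite normrM exprMn (ger0_norm lam0).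
  by rewrite ler_wpM2l ?exprn_ge0// lerXn2r// nnegrE ?mulr_ge0.
apply: (le_trans (ler_normD _ _)); rewrite !normrM.
have ct : `|cos th| <= 1 by rewrite ler_norml cos_geN1 cos_le1.
have st : `|sin th| <= 1 by rewrite ler_norml sin_geN1 sin_le1.
have := ler_wpM2r (normr_ge0 A) ct; have := ler_wpM2r (normr_ge0 B) st.
rewrite !mul1r => h1 h2; apply: (le_trans (lerD h2 h1)).
apply: (le_trans (lerD nA nB)); rewrite le_eqVlt; apply/orP; left; apply/eqP; ring.
Qed.

Section gaussian_free_energy.
Context {R : realType} {E S : finType} (s0 : S).
Variable (b : E -> S -> R).
Local Notation V := {ffun E -> R}.
Local Notation F := (fe b).

Lemma coord_measurable_fe : coord_measurable F.
Proof.
move=> d T Y mY; rewrite /fe /lse /gz.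
apply: (measurableT_comp (@measurable_ln R)).
apply: measurable_sum => s; apply: (measurableT_comp (@measurable_expR R)).
rewrite /energy; apply: measurable_sum => e.
rewrite (_ : (fun w => _) = fun w => b e s * Y e w); last first.
  by apply/funext => w; rewrite ffunE.
exact: measurable_funM.
Qed.

Local Notation B := (1 + \sum_e \sum_s `|b e s|).

Let B_ge1 : 1 <= B.
Proof. by rewrite lerDl sumr_ge0// => e _; rewrite sumr_ge0. Qed.

Let B_ge0 : 0 <= B := le_trans ler01 B_ge1.

Lemma le_coef_bound e s : `|b e s| <= B.
Proof.
rewrite ler_wpDl// (bigD1 e)//= ler_wpDr//; last first.
  by rewrite (bigD1 s)//= ler_wpDr// sumr_ge0.
by apply: sumr_ge0 => e' _; apply: sumr_ge0.
Qed.

Lemma energy_delta (x : V) e y s : energy b (x + delta e y) s = energy b x s + y * b e s.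
Proof.
rewrite energyD; congr (_ + _); rewrite /energy (bigD1 e)//= big1 ?addr0.
  by rewrite ffunE eqxx mulrC.
by move=> i /negbTE ie; rewrite ffunE ie mulr0.
Qed.

(** The derivatives of the free energy in one disorder variable are Gibbs cumulants
    of the coefficients b, bounded uniformly in the other variables. *)
Lemma smooth_cos_fe (lam : R) : 0 <= lam ->
  exists K, forall c, smooth_le 2 K (fun x : V => 1 - cos (lam * (F x - c))).
Proof.
move=> lam0.
pose C1 := 28 * lam ^+ 2 + 42 * lam ^+ 4 + 46 * lam + 54 * lam ^+ 3.
have C10 : 0 <= C1 by rewrite !addr_ge0// mulr_ge0// exprn_ge0.
exists ((C1 + (256 + 4 * lam ^+ 2 + 8 * lam)) * B ^+ 3) => c; split.
- move=> d T Y mY; apply: measurable_funB => //.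
  apply: measurableT_comp; first exact: continuous_measurable_fun (@continuous_cos R).
  apply: measurable_funM => //; apply: measurable_funB => //.
  exact: coord_measurable_fe.
- by move=> x; have := cos_geN1 (lam * (F x - c)); have := cos_le1 (lam * (F x - c)); lra.
move=> e.
pose g1 x := gav (energy b x) (b e).
pose g2 x := gav (energy b x) (fun s => b e s ^+ 2) - g1 x ^+ 2.
have g1B x : `|g1 x| <= B by apply: (norm_gav_le s0) => s; exact: le_coef_bound.
have g2B x : `|g2 x| <= 2 * B ^+ 2.
  rewrite mulr2n mulrDl mul1r; apply: (le_trans (ler_normB _ _)); apply: lerD.
    apply: (norm_gav_le s0) => s; rewrite normrX lerXn2r ?nnegrE//; exact: le_coef_bound.
  by rewrite normrX lerXn2r ?nnegrE.
exists (fun x => lam ^+ 2 * g1 x ^+ 2 * cos (lam * (F x - c))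
  + lam * g2 x * sin (lam * (F x - c))) => x y.
set th := lam * (F x - c).
pose z := B * `|y|; have z0 : 0 <= z by rewrite mulr_ge0.
have -> : (C1 + (256 + 4 * lam ^+ 2 + 8 * lam)) * B ^+ 3 * `|y| ^+ 3 =
    C1 * z ^+ 3 + (256 + 4 * lam ^+ 2 + 8 * lam) * z ^+ 3 by rewrite /z; ring.
have C20 : 0 <= 256 + 4 * lam ^+ 2 + 8 * lam by rewrite !addr_ge0// mulr_ge0// exprn_ge0.
have a0 : `|y * g1 x| <= z by rewrite normrM mulrC ler_wpM2r.
have gg0 : `|y ^+ 2 * g2 x| <= 2 * z ^+ 2.
  rewrite normrM normrX mulrC (_ : 2 * z ^+ 2 = 2 * B ^+ 2 * `|y| ^+ 2).
    by rewrite ler_wpM2r ?exprn_ge0.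
  by rewrite /z; ring.
(* For large steps the bound is trivial, since 1 <= (4 z)^3. *)
have [z4|z4] := leP z 4^-1; last first.
  rewrite ler_wpDl ?mulr_ge0 ?exprn_ge0//.
  have z1 : 1 <= 64 * z ^+ 3.
    have : 1 <= (4 * z) ^+ 3 by apply: exprn_ege1; lra.
    by rewrite exprMn; congr (_ <= _ * _); ring.
  have zz : z ^+ 2 <= 4 * z ^+ 3.
    by rewrite (exprS z 2) mulrA ler_peMl ?exprn_ge0//; lra.
  rewrite (_ : _ * z ^+ 3 = 4 * (64 * z ^+ 3) + (lam ^+ 2 * (4 * z ^+ 3)
     + lam * (2 * (4 * z ^+ 3)))); last by ring.
  apply: (le_trans (ler_normB _ _)); apply: lerD.
    have hc (t : R) : -1 <= cos t <= 1 by rewrite cos_geN1 cos_le1.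
    have /andP[? ?] := hc (lam * (F (x + delta e y) - c)).
    have /andP[? ?] := hc (lam * (F (x - delta e y) - c)).
    have /andP[? ?] := hc th; rewrite -/th ler_norml; apply/andP; split; lra.
  rewrite mulrDr; apply: (le_trans (ler_normD _ _)); apply: lerD.
    rewrite (_ : _ * _ = lam ^+ 2 * ((y * g1 x) ^+ 2 * cos th)); last by ring.
    rewrite normrM ger0_norm ?exprn_ge0// ler_wpM2l ?exprn_ge0//.
    rewrite normrM -[leRHS]mulr1; apply: ler_pM => //.
      apply: le_trans zz; rewrite normrX lerXn2r ?nnegrE//.
    by rewrite ler_norml cos_geN1 cos_le1.
  rewrite (_ : _ * _ = lam * ((y ^+ 2 * g2 x) * sin th)); last by ring.
  rewrite normrM ger0_norm// ler_wpM2l//.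
  rewrite normrM -[leRHS]mulr1; apply: ler_pM => //.
    by apply: (le_trans gg0); rewrite ler_wpM2l.
  by rewrite ler_norml sin_geN1 sin_le1.
rewrite ler_wpDr ?mulr_ge0 ?exprn_ge0//.
have tay y' : `|y'| = `|y| -> `|F (x + delta e y') - F x - y' * g1 x| <= 7 * z ^+ 2 /\
    `|F (x + delta e y') - F x - y' * g1 x - 2^-1 * (y' ^+ 2 * g2 x)| <= 23 * z ^+ 3.
  move=> yy; have dz s : `|y' * b e s| <= z by rewrite normrM yy mulrC ler_wpM2r ?le_coef_bound.
  have := lse_taylor s0 (energy b x) z4 dz; have := lse_taylor1 s0 (energy b x) z4 dz.
  rewrite gavZ (_ : lse (fun p => _) = F (x + delta e y')); last first.
    by apply: eq_lse => s; rewrite energy_delta.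
  move=> h1 h2; split => //; move: h2; congr (_ <= _); congr (`|_ - 2^-1 * _|).
  rewrite /g2 /g1 mulrBr exprMn; congr (_ - _); rewrite -gavZ; apply: eq_gav => s.
  by rewrite exprMn.
have [p1 p2] := tay y erefl; have [] := tay (- y) (normrN y).
rewrite sqrrN mulNr opprK deltaN => m1 m2.
have := @cos_second_difference R lam th _ _ _ (y ^+ 2 * g2 x) z lam0 _ a0 gg0 p1 m1.
rewrite z0 z4 => /(_ isT) H.
apply: le_trans (H _); last first.
  rewrite (_ : 46 * z ^+ 3 = 23 * z ^+ 3 + 23 * z ^+ 3); last by ring.
  apply: le_trans (lerD p2 m2); apply: le_trans (ler_normD _ _).
  by rewrite le_eqVlt; apply/orP; left; apply/eqP; congr (`|_|); field.
rewrite le_eqVlt; apply/orP; left; apply/eqP; congr (`|_|).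
have e1 t : lam * (F t - c) = th + lam * (F t - F x) by rewrite /th; ring.
rewrite !(e1 (_ + _)) -/th; ring.
Qed.

End gaussian_free_energy.

(** * Cosine test functions and the walk *)

Lemma cos_le_sqr {R : realType} (u : R) : 1 - cos u <= u ^+ 2 / 2.
Proof.
have -> : cos u = 1 - 2 * sin (u / 2) ^+ 2.
  rewrite {1}(_ : u = (u / 2) *+ 2) ?cos_mulr2n; last by rewrite mulr2n; field.
  by have := cos2Dsin2 (u / 2); lra.
have := sin_bound (u / 2); rewrite -(ler_pXn2r (n := 2)) ?nnegrE//.
rewrite !real_normK ?num_real// => h; have -> : u ^+ 2 / 2 = 2 * (u / 2) ^+ 2 by field.
by lra.
Qed.

Lemma expr4_ge0 {R : realDomainType} (x : R) : 0 <= x ^+ 4.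
Proof. by rewrite exprn_even_ge0. Qed.

Lemma sqr_le_cos {R : realType} (u : R) : u ^+ 2 / 2 <= 1 - cos u + u ^+ 4.
Proof.
have := cos_bound4 u; rewrite ler_norml -normrX (ger0_norm (expr4_ge0 u)).
by move=> /andP[_]; lra.
Qed.

Lemma expr4D_le {R : realDomainType} (a t : R) : (a + t) ^+ 4 <= 8 * (a ^+ 4 + t ^+ 4).
Proof.
rewrite -subr_ge0.
rewrite (_ : _ - _ = 4 * (a ^+ 2 - t ^+ 2) ^+ 2
  + (a - t) ^+ 2 * (2 * (a ^+ 2 + t ^+ 2) + (a + t) ^+ 2)); last by ring.
by apply: addr_ge0; apply: mulr_ge0; rewrite ?sqr_ge0//; apply: addr_ge0;
   rewrite ?sqr_ge0//; apply: mulr_ge0 => //; apply: addr_ge0; rewrite sqr_ge0.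
Qed.

Lemma expr4_sum {R : realDomainType} {I : Type} (s : seq I) (a : I -> R) :
  (\sum_(i <- s) a i) ^+ 4 <= 8 ^+ size s * \sum_(i <- s) a i ^+ 4.
Proof.
elim: s => [|i s IH]; first by rewrite !big_nil expr0n/= mulr0.
rewrite !big_cons /= (exprS 8); apply: (le_trans (expr4D_le _ _)).
rewrite -mulrA ler_wpM2l// mulrDr lerD//.
by apply: ler_peMl; rewrite ?expr4_ge0// exprn_ege1// ler1n.
Qed.

Lemma le_lse {R : realType} {P : finType} (p0 : P) (U W : P -> R) :
  (forall p, U p <= W p) -> lse U <= lse W.
Proof.
move=> UW; rewrite /lse ler_ln ?posrE ?gz_gt0//; apply: ler_sum => p _.
by rewrite ler_expR.
Qed.

Section moments.
Context {R : realType} {E S : finType} (s0 : S).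
Variable (b : E -> S -> R).
Local Notation V := {ffun E -> R}.
Local Notation F := (fe b).
Local Notation B := (1 + \sum_e \sum_s `|b e s|).

Lemma norm_fe_sub (x : V) : `|F x - F 0| <= B * \sum_e `|x e|.
Proof.
set M := B * _.
have eM s : `|energy b x s| <= M.
  apply: (le_trans (ler_norm_sum _ _ _)); rewrite /M mulr_sumr; apply: ler_sum => e _.
  by rewrite normrM ler_wpM2r ?le_coef_bound.
have e0 s : energy b 0 s = 0 by rewrite /energy big1// => e _; rewrite ffunE mulr0.
rewrite ler_distl; apply/andP; split; rewrite -(lse_shift_cst s0) /fe; apply: (le_lse s0) => s.
  by rewrite e0 add0r; have := eM s; rewrite ler_norml => /andP[].
by rewrite e0 add0r; have := eM s; rewrite ler_norml => /andP[].
Qed.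

Section sign_side.
Variable (kappa : E -> R).
Local Notation K := (fbound b kappa).

(** One step moves the mean free energy by a second-order quantity only, so that the
    mean after m steps of size m^(-1/2) stays bounded. *)
Lemma iter_walk_fe_dist m r : 0 <= r -> r * K <= 4^-1 -> r ^+ 2 = m%:R^-1 -> (0 < m)%N ->
  `|iter m (walk kappa r) F 0 - F 0| <= 7 * K ^+ 2.
Proof.
move=> r0 rK r2 m0.
have K0 : 0 <= K by apply: le_trans (fbound_ge1 b kappa).
have one x : `|walk kappa r F x - F x| <= 7 * (r * K) ^+ 2.
  have e0 : avg (fun eta => gav (energy b x) (fun s => r * field b kappa eta s)) = 0.
    rewrite -gav_avg (eq_gav _ (g := cst 0)) ?(gav_cst s0)// => s /=.
    by rewrite avgZ avg_field mulr0.
  have -> : walk kappa r F x - F x = avg (fun eta => F (x + step kappa r eta) - F x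
      - gav (energy b x) (fun s => r * field b kappa eta s)).
    by rewrite !avgB e0 (@avg_cst R {ffun E -> bool} [ffun => true]) subr0.
  apply: (le_trans (norm_avg _)).
  rewrite -[leRHS](@avg_cst R {ffun E -> bool} [ffun => true]); apply: le_avg => eta.
  have dz s : `|r * field b kappa eta s| <= r * K.
    by rewrite normrM ger0_norm// ler_wpM2l// norm_field.
  have := lse_taylor1 s0 (energy b x) rK dz.
  congr (`|_ - _ - _| <= _).
  by apply: eq_lse => s; rewrite energyD energy_step.
have h n x : `|iter n (walk kappa r) F x - F x| <= n%:R * (7 * (r * K) ^+ 2).
  elim: n x => [|n IH] x; first by rewrite subrr normr0 mul0r.
  rewrite ler_distl; apply/andP; split.
    have := le_iter_tav (step kappa r) 1 (f := fun a => F a - n%:R * (7 * (r * K) ^+ 2)) (g := iter n (walk kappa r) F).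
    have hl a : F a - n%:R * (7 * (r * K) ^+ 2) <= iter n (walk kappa r) F a.
      by have := IH a; rewrite ler_distl => /andP[].
    move=> /(_ hl x); rewrite (iter_tavDc [ffun => true])/= => h1; apply: le_trans h1.
    by have := one x; rewrite ler_distl -natr1 => /andP[+ _]; rewrite /walk; lra.
  have := le_iter_tav (step kappa r) 1 (g := fun a => F a + n%:R * (7 * (r * K) ^+ 2)) (f := iter n (walk kappa r) F).
  have hl a : iter n (walk kappa r) F a <= F a + n%:R * (7 * (r * K) ^+ 2).
    by have := IH a; rewrite ler_distl => /andP[].
  move=> /(_ hl x); rewrite (iter_tavDc [ffun => true])/= => h1; apply: (le_trans h1).
  by have := one x; rewrite ler_distl -natr1 => /andP[_]; rewrite /walk; lra.
apply: (le_trans (h _ _)); rewrite exprMn r2 le_eqVlt; apply/orP; left; apply/eqP.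
by field; rewrite pnatr_eq0 -lt0n.
Qed.

Lemma iter_walk_cos_le m r lam c : c = iter m (walk kappa r) F 0 ->
  iter m (walk kappa r) (fun x => 1 - cos (lam * (F x - c))) 0 <=
  lam ^+ 2 / 2 * (iter m (walk kappa r) (fun x => F x ^+ 2) 0 - c ^+ 2).
Proof.
move=> cE.
apply: (@le_trans _ _ (iter m (walk kappa r) (fun x =>
   lam ^+ 2 / 2 * (F x ^+ 2 + ((- 2 * c) * F x + c ^+ 2))) 0)).
  apply: le_iter_tav => x; apply: (le_trans (cos_le_sqr _)).
  by rewrite le_eqVlt; apply/orP; left; apply/eqP; field.
rewrite /walk iter_tavZ iter_tavD (iter_tavDc [ffun => true]) iter_tavZ -/(walk kappa r) -cE.
by rewrite le_eqVlt; apply/orP; left; apply/eqP; ring.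
Qed.

End sign_side.
End moments.

(** * The variance under Gaussian disorder *)

Section variance.
Context {R : realType} d (T : measurableType d) (P : probability T R).
Implicit Types (Y H : T -> R) (c : R).

Lemma integrable_prob_cst c : P.-integrable [set: T] (EFin \o cst c).
Proof. exact: finite_measure_integrable_cst. Qed.

Lemma Rintegral_prob_cst c : \int[P]_w (cst c w) = c.
Proof. by rewrite /Rintegral integral_prob_cst. Qed.

Lemma integrable_le Y H : measurable_fun [set: T] Y ->
  P.-integrable [set: T] (EFin \o H) -> (forall w, `|Y w| <= H w) ->
  P.-integrable [set: T] (EFin \o Y).
Proof.
move=> mY iH YH; apply: (le_integrable measurableT _ _ iH).
  exact/measurable_EFinP.
by move=> w _ /=; rewrite lee_fin (le_trans (YH w))// ler_norm.
Qed.

(** The mean minimises the mean square deviation. *)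
Lemma variance_le_shift Y c : measurable_fun [set: T] Y ->
  P.-integrable [set: T] (EFin \o (fun w => Y w ^+ 2)) ->
  ('V_P[Y] <= (\int[P]_w ((Y w - c) ^+ 2))%:E)%E.
Proof.
move=> mY iY2.
have i1 := integrable_prob_cst 1.
have iY : P.-integrable [set: T] (EFin \o Y).
  apply: (integrable_le mY (integrableD measurableT i1 iY2)) => w /=.
  have := sqr_ge0 (1 - `|Y w|); rewrite sqrrB expr1n mul1r real_normK ?num_real//.
  by have := sqr_ge0 (Y w); have := normr_ge0 (Y w); lra.
pose mu := \int[P]_w Y w.
have iZ : P.-integrable [set: T] (EFin \o (fun w => Y w - mu)).
  exact: (integrableB measurableT iY (integrable_prob_cst mu)).
have iZ2 : P.-integrable [set: T] (EFin \o (fun w => (Y w - mu) ^+ 2)).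
  have i2 := integrableZl measurableT 2 iY2.
  have i3 := integrable_prob_cst (2 * mu ^+ 2).
  apply: (integrable_le _ (integrableD measurableT i2 i3)) => [|w /=].
    by apply: measurable_funX; apply: measurable_funB.
  rewrite ger0_norm ?sqr_ge0//.
  by have := sqr_ge0 (Y w + mu); rewrite sqrrB sqrrD; lra.
have muE : 'E_P[Y]%E = mu%:E.
  by rewrite unlock /mu /Rintegral fineK//; exact: (integrable_fin_num measurableT iY).
have -> : ('V_P[Y] = (\int[P]_w ((Y w - mu) ^+ 2))%:E)%E.
  rewrite /variance unlock muE /= unlock /Rintegral fineK; last first.
    exact: (integrable_fin_num measurableT iZ2).
  by apply: eq_integral => w _; rewrite expr2.
rewrite lee_fin.
pose e := mu - c.
have -> : \int[P]_w ((Y w - c) ^+ 2) =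
    \int[P]_w ((Y w - mu) ^+ 2 + (2 * e * (Y w - mu) + cst (e ^+ 2) w)).
  by congr (Rintegral _ _ _); apply/funext => w; rewrite /e/=; ring.
have iZl := integrableZl measurableT (2 * e) iZ.
have i3 := integrable_prob_cst (e ^+ 2).
rewrite (RintegralD measurableT iZ2 (integrableD measurableT iZl i3)).
rewrite (RintegralD measurableT iZl i3) (RintegralZl _ measurableT iZ).
rewrite (RintegralB measurableT iY (integrable_prob_cst mu)) -/mu.
rewrite !Rintegral_prob_cst subrr mulr0 add0r lerDl; exact: sqr_ge0.
Qed.

End variance.

Section gaussian_moment.
Context {R : realType}.
Local Notation TR := (measurableTypeR R).

Lemma centered_gaussian_X4 (v : R) : 0 <= v ->
  exists2 mu : probability TR R,
    (forall B : set R, measurable B -> centered_gaussian_law v B = mu B) &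
    (\int[mu]_x (x ^+ 4)%:E < +oo)%E.
Proof.
rewrite le_eqVlt => /orP[/eqP <-|v0].
  exists (dirac (0 : TR) : probability TR R).
    by move=> B mB; rewrite /centered_gaussian_law eqxx.
  rewrite integral_dirac//.
    by rewrite diracE mem_set// mul1e ltry.
  by apply/measurable_EFinP; exact: measurable_funX.
exists (normal_prob 0 (Num.sqrt v) : probability TR R).
  by move=> B mB; rewrite /centered_gaussian_law gt_eqF.
have [_ h] := integrable_normal_X4 v0.
by apply: le_lt_trans h _; rewrite ltry.
Qed.

Lemma integrable_X4 d (T : measurableType d) (P : probability T R) (X : T -> R) (v : R) :
  0 <= v -> measurable_fun [set: T] X ->
  (forall B : set R, measurable B -> P (X @^-1` B)%classic = centered_gaussian_law v B) ->
  P.-integrable [set: T] (EFin \o (fun w => X w ^+ 4)).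
Proof.
move=> v0 mX lawX; have [mu muE mu4] := centered_gaussian_X4 v0.
have mX4 : measurable_fun [set: TR] (fun x : TR => (x ^+ 4)%:E).
  by apply/measurable_EFinP; exact: measurable_funX.
apply/integrableP; split.
  by apply/measurable_EFinP; exact: measurable_funX.
have mX' : measurable_fun [set: T] (X : T -> TR) by exact: mX.
pose Xf : {mfun T >-> TR} := HB.pack (X : T -> TR) (isMeasurableFun.Build _ _ _ _ _ mX').
apply: le_lt_trans mu4.
rewrite (_ : \int[mu]_x (x ^+ 4)%:E = \int[pushforward P Xf]_x (x ^+ 4)%:E)%E; last first.
  by apply: eq_measure_integral => A mA _; rewrite /= -muE// -lawX.
rewrite ge0_integral_pushforward//; last by move=> x _; rewrite lee_fin expr4_ge0.
rewrite le_eqVlt; apply/orP; left; apply/eqP; apply: eq_integral => w _ /=.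
by rewrite ger0_norm ?expr4_ge0.
Qed.

End gaussian_moment.

Section gaussian_variance.
Context {R : realType} {E S : finType} (s0 : S).
Variable (b : E -> S -> R).
Local Notation V := {ffun E -> R}.
Local Notation F := (fe b).
Context d (T : measurableType d) (P : probability T R) (X : E -> T -> R) (v : E -> R).
Hypothesis mX : forall i, measurable_fun [set: T] (X i).
Hypothesis indepX : mutually_independent P X.
Hypothesis v_ge0 : forall e, 0 <= v e.
Hypothesis lawX : forall e (B : set R), measurable B ->
  P (X e @^-1` B)%classic = centered_gaussian_law (v e) B.
Local Notation Y := (fun w => F (Xv X w)).
Local Notation kappa := (fun e => Num.sqrt (v e)).

Lemma measurable_fe_Xv : measurable_fun [set: T] Y.
Proof. exact: coord_measurable_fe. Qed.

(** The free energy grows at most linearly in the disorder. *)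
Lemma fe_fourth_moment (M : R) : 0 <= M ->
  exists2 H : T -> R, P.-integrable [set: T] (EFin \o H) &
    forall c, `|c - F 0| <= M -> forall w, (Y w - c) ^+ 4 <= H w.
Proof.
move=> M0.
pose B : R := 1 + \sum_e \sum_s `|b e s|.
pose A := 8 * (B ^+ 4 * 8 ^+ size (enum E)).
pose H w := (\sum_(e <- enum E) A * X e w ^+ 4) + 8 * M ^+ 4.
exists H.
  have iX e := integrable_X4 (v_ge0 e) (mX e) (lawX e).
  rewrite /H; elim: (enum E) => [|e s IH].
    rewrite (_ : _ \o _ = EFin \o cst (8 * M ^+ 4)); first exact: integrable_prob_cst.
    by apply/funext => w /=; rewrite big_nil add0r.
  rewrite (_ : _ \o _ = (EFin \o (fun w => A * X e w ^+ 4)%R) \+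
    (EFin \o (fun w => \sum_(e <- s) A * X e w ^+ 4 + 8 * M ^+ 4)%R))%E; last first.
    by apply/funext => w /=; rewrite big_cons -EFinD addrA.
  exact: (integrableD measurableT (integrableZl measurableT A (iX e)) IH).
move=> c cM w; rewrite (_ : Y w - c = (Y w - F 0) + (F 0 - c)); last by ring.
apply: (le_trans (expr4D_le _ _)); rewrite /H mulrDr; apply: lerD; last first.
  rewrite ler_wpM2l// -(ger0_norm (expr4_ge0 _)) normrX lerXn2r ?nnegrE// distrC//.
rewrite -mulr_sumr /A -mulrA ler_wpM2l// -(ger0_norm (expr4_ge0 _)) normrX.
have h := norm_fe_sub s0 b (Xv X w).
apply: (@le_trans _ _ ((B * \sum_e `|Xv X w e|) ^+ 4)).
  by rewrite lerXn2r ?nnegrE// (le_trans _ h).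
rewrite exprMn -mulrA ler_wpM2l ?expr4_ge0//.
rewrite -big_enum/=; apply: (le_trans (expr4_sum _ _)).
rewrite ler_wpM2l ?exprn_ge0//; apply: ler_sum => e _.
by rewrite -normrX ger0_norm ?expr4_ge0// ffunE.
Qed.

(** The square is compared with the bounded test function 1 - cos, which agrees with
    it near 0; the fourth moment controls the difference. *)
Lemma gaussian_variance_approx (lam K D c : R) (H : T -> R) m : 0 < lam -> (0 < m)%N ->
  (forall c, smooth_le 2 K (fun x : V => 1 - cos (lam * (F x - c)))) ->
  P.-integrable [set: T] (EFin \o H) -> (forall w, (Y w - c) ^+ 4 <= H w) ->
  \int[P]_w H w <= D ->
  c = iter m (walk kappa (Num.sqrt m%:R^-1)) F 0 ->
  ('V_P[Y] <= (iter m (walk kappa (Num.sqrt m%:R^-1)) (fun x => (F x) ^+ 2) 0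
       - iter m (walk kappa (Num.sqrt m%:R^-1)) F 0 ^+ 2
     + (2 / lam ^+ 2 * \sum_(e <- enum E) 17 * K * (v e * Num.sqrt (v e / m%:R))
       + 2 * lam ^+ 2 * D))%:E)%E.
Proof.
move=> lam0 m0 smooth iH YH HD cE.
have iq : P.-integrable [set: T] (EFin \o (fun w => (Y w - c) ^+ 2)).
  apply: (integrable_le _ (integrableD measurableT (integrable_prob_cst P 1) iH)) => [|w /=].
    by apply: measurable_funX; apply: measurable_funB => //; exact: measurable_fe_Xv.
  rewrite ger0_norm ?sqr_ge0//; apply: le_trans (lerD (lexx _) (YH w)).
  have := sqr_ge0 ((Y w - c) ^+ 2 - 1); rewrite sqrrB expr1n -exprM.
  have := sqr_ge0 (Y w - c); lra.
have iY2 : P.-integrable [set: T] (EFin \o (fun w => Y w ^+ 2)).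
  have i2 := integrableZl measurableT 2 iq.
  apply: (integrable_le _ (integrableD measurableT i2 (integrable_prob_cst P (2 * c ^+ 2)))) => [|w /=].
    by apply: measurable_funX; exact: measurable_fe_Xv.
  rewrite ger0_norm ?sqr_ge0//.
  have := sqr_ge0 (Y w - c - c); rewrite (_ : Y w = (Y w - c) + c); last by ring.
  set u := Y w - c; rewrite sqrrB sqrrD; lra.
apply: (le_trans (variance_le_shift c measurable_fe_Xv iY2)); rewrite lee_fin.
set f := fun x : V => 1 - cos (lam * (F x - c)).
have sf := smooth c; have [mf fc _] := sf.
have if_ := integrable_smooth P mX mf fc.
have l2 : 0 < lam ^+ 2 by rewrite exprn_gt0.
have il := integrableZl measurableT (2 / lam ^+ 2) if_.
have iH2 := integrableZl measurableT (2 * lam ^+ 2) iH.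
apply: (@le_trans _ _ (\int[P]_w (2 / lam ^+ 2 * f (Xv X w) + 2 * lam ^+ 2 * H w))).
  apply: (le_Rintegral measurableT iq (integrableD measurableT il iH2)) => w _.
  apply: (@le_trans _ _ (2 / lam ^+ 2 * f (Xv X w) + 2 * lam ^+ 2 * (Y w - c) ^+ 4)); last first.
    by rewrite lerD2l ler_wpM2l ?YH// mulr_ge0// ltW.
  have := sqr_le_cos (lam * (Y w - c)); rewrite -/(f _).
  rewrite -(ler_pM2l (_ : 0 < 2 / lam ^+ 2)) ?divr_gt0// => h.
  rewrite (_ : (Y w - c) ^+ 2 = 2 / lam ^+ 2 * ((lam * (Y w - c)) ^+ 2 / 2)).
    apply: (le_trans h); rewrite le_eqVlt; apply/orP; left; apply/eqP.
    by rewrite /f; field; rewrite gt_eqF.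
  by field; rewrite gt_eqF.
rewrite (RintegralD measurableT il iH2) (RintegralZl _ measurableT if_) (RintegralZl _ measurableT iH).
rewrite addrA; apply: lerD; last by rewrite ler_wpM2l// mulr_ge0// ltW.
have -> : forall a e : R, a + 2 / lam ^+ 2 * e = 2 / lam ^+ 2 * (lam ^+ 2 / 2 * a + e).
  by move=> a e; field; rewrite gt_eqF.
rewrite ler_pM2l ?divr_gt0//.
case: m m0 cE => // m _ cE.
have := gaussian_step_all mX indepX v_ge0 lawX m (enum_uniq E) sf.
have -> : \int[P]_w step_all v m.+1 (enum E) f (kill (enum E) (Xv X w)) =
    iter m.+1 (walk kappa (Num.sqrt m.+1%:R^-1)) f 0.
  rewrite -[RHS](Rintegral_prob_cst P); congr (Rintegral _ _ _); apply/funext => w /=.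
  rewrite (_ : kill _ _ = 0) ?step_all_walk//.
  by apply/ffunP => e; rewrite !ffunE mem_enum.
rewrite ler_distl => /andP[_ h]; apply: (le_trans h); apply: lerD => //.
by have := iter_walk_cos_le lam cE; rewrite {2}cE.
Qed.

(** The frequency lam of the test function is fixed first, to make the fourth-moment
    term small; then the number of signs per coordinate tends to infinity. *)
Theorem gaussian_variance_le (p : nat) (q L : R) : (0 < p)%N -> 0 <= L ->
  (forall s s', 0 <= overlap b kappa s s') ->
  (forall s s', overlap b kappa s s' <= q) ->
  (forall (r u : R) n, p%:R^-1 < u -> u <= 1 -> 0 <= r ->
    iter n (indep kappa r) (coupled b kappa (1 - u / 2)) (0, 0) -
    iter n (indep kappa r) (coupled b kappa 0) (0, 0) <= L) ->
  ('V_P[Y] <= (2 * L * ln p%:R + q / p%:R)%:E)%E.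
Proof.
move=> p0 L0 ov0 ovq hL.
have [C hC] := rademacher_variance_le s0 ov0 p0 L0 ovq hL.
set Kb := fbound b kappa in hC; have Kb1 : 1 <= Kb by exact: fbound_ge1.
have Kb0 : 0 <= Kb by exact: le_trans ler01 Kb1.
have Kb2 : Kb <= Kb ^+ 2 by rewrite expr2 ler_peMr.
have [H iH hH] : exists2 H : T -> R, P.-integrable [set: T] (EFin \o H) &
    forall c, `|c - F 0| <= 7 * Kb ^+ 2 -> forall w, (Y w - c) ^+ 4 <= H w.
  by apply: fe_fourth_moment; rewrite mulr_ge0// exprn_ge0.
pose D := `|\int[P]_w H w| + 1.
have HD : \int[P]_w H w <= D by rewrite (le_trans (ler_norm _))// lerDl.
have D0 : 0 < D by rewrite ltr_wpDl.
apply/lee_addgt0Pr => eps eps0.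
pose lam := Num.sqrt (eps / (4 * D)).
have lam2 : lam ^+ 2 = eps / (4 * D) by rewrite sqr_sqrtr// divr_ge0 ?mulr_ge0 ?ltW.
have lam0 : 0 < lam by rewrite sqrtr_gt0 divr_gt0// mulr_gt0.
have [K' smooth] := smooth_cos_fe s0 b (ltW lam0).
pose A := 2 / lam ^+ 2 * \sum_(e <- enum E) 17 * K' * (v e * Num.sqrt (v e)).
pose Z := (`|C| + `|A|) * (2 / eps) + 12 * Kb ^+ 2.
have CA0 : 0 <= (`|C| + `|A|) * (2 / eps).
  by rewrite mulr_ge0 ?addr_ge0// divr_ge0// ltW.
have Z0 : 0 < Z by rewrite ltr_wpDl// mulr_gt0// exprn_gt0// (lt_le_trans ltr01).
pose n := (Num.truncn (Z ^+ 2)).+1.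
have nZ : Z ^+ 2 <= n%:R by apply/ltW/truncnS_gt.
have mn : Z ^+ 2 <= (p * n)%:R by rewrite (le_trans nZ)// ler_nat leq_pmull.
have m0 : (0 < p * n)%N by rewrite muln_gt0 p0.
set m := (p * n)%N in mn m0.
have mR : 0 < m%:R :> R by rewrite ltr0n.
pose r : R := Num.sqrt m%:R^-1.
have r0 : 0 <= r by exact: sqrtr_ge0.
have r2 : r ^+ 2 = m%:R^-1 by rewrite sqr_sqrtr// invr_ge0 ltW.
have rZ : r * Z <= 1.
  rewrite -ler_pdivlMr// mul1r /r (sqrtrV (ltW mR)); apply: inv_sqrt_le => //.
    by rewrite invr_ge0 ltW.
  by rewrite exprVn -ler_pdivrMr ?invr_gt0 ?exprn_gt0// invrK mul1r.
have rK3 : r * (3 * Kb ^+ 2) <= 4^-1.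
  have : r * (12 * Kb ^+ 2) <= r * Z by rewrite ler_wpM2l// lerDr.
  by lra.
have rK : r * Kb <= 4^-1.
  apply: le_trans rK3; rewrite ler_wpM2l//; lra.
have cM := iter_walk_fe_dist s0 r0 rK r2 m0.
have V1 := gaussian_variance_approx lam0 m0 smooth iH (hH _ cM) HD erefl.
apply: (le_trans V1); rewrite -EFinD lee_fin.
have h := hC n r isT r0 r2 rK3.
rewrite -/r -/m in h *.
have -> : 2 / lam ^+ 2 * \sum_(e <- enum E) 17 * K' * (v e * Num.sqrt (v e / m%:R)) = A * r.
  rewrite /A -[RHS]mulrA; congr (_ * _); rewrite mulr_suml; apply: eq_bigr => e _.
  by rewrite sqrtrM// !mulrA.
have -> : 2 * lam ^+ 2 * D = eps / 2 by rewrite lam2; field; rewrite gt_eqF.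
have : (C + A) * r <= eps / 2.
  have : r * ((`|C| + `|A|) * (2 / eps)) <= 1.
    by apply: le_trans rZ; rewrite ler_wpM2l// lerDl mulr_ge0// exprn_ge0.
  rewrite mulrA -ler_pdivlMr ?divr_gt0// mul1r invf_div mulrC; apply: le_trans.
  by rewrite ler_wpM2r// lerD// ler_norm.
by move: h; set X1 := iter _ _ _ _; set X2 := iter _ _ _ _; lra.
Qed.

End gaussian_variance.

(** * The spectral radius and the Rayleigh quotient *)

Section rayleigh.
Context {R : realType} {k : nat}.
Implicit Types (x y : 'I_k -> R).

Definition bilin (A : 'I_k -> 'I_k -> R) x y : R := \sum_s \sum_t A s t * x s * y t.

Lemma bilinC A x y : (forall s t, A s t = A t s) -> bilin A x y = bilin A y x.
Proof.
move=> symA; rewrite /bilin exchange_big/=; apply: eq_bigr => s _; apply: eq_bigr => t _.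
by rewrite symA; ring.
Qed.

Lemma bilin_line A x y (t : R) : (forall s t, A s t = A t s) ->
  bilin A (fun s => x s + t * y s) (fun s => x s + t * y s) =
  bilin A x x + 2 * t * bilin A x y + t ^+ 2 * bilin A y y.
Proof.
move=> symA; have -> : 2 * t * bilin A x y = t * bilin A x y + t * bilin A y x.
  by rewrite (bilinC y x symA); ring.
rewrite /bilin !mulr_sumr -!big_split/=; apply: eq_bigr => s _.
rewrite !mulr_sumr -!big_split/=; apply: eq_bigr => u _; ring.
Qed.

Lemma bilinZ A x (c : R) : bilin A (fun s => c * x s) (fun s => c * x s) = c ^+ 2 * bilin A x x.
Proof.
rewrite /bilin mulr_sumr; apply: eq_bigr => s _; rewrite mulr_sumr.
by apply: eq_bigr => t _; ring.
Qed.

(** Otherwise the form would become negative on moving slightly from x along y or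
    - y. *)
Lemma bilin_kernel A x y : (forall s t, A s t = A t s) -> (forall z, 0 <= bilin A z z) ->
  bilin A x x = 0 -> bilin A x y = 0.
Proof.
move=> symA A0 xx0; set B := bilin A x y; set Q := bilin A y y.
have Q0 : 0 <= Q by exact: A0.
have Q1 : 0 < Q + 1 by rewrite ltr_wpDl.
have := A0 (fun s => x s + (- B / (Q + 1)) * y s).
rewrite bilin_line// xx0 add0r -/B -/Q.
have -> : 2 * (- B / (Q + 1)) * B + (- B / (Q + 1)) ^+ 2 * Q =
   - ((B / (Q + 1)) ^+ 2 * (Q + 2)) by field; rewrite gt_eqF.
rewrite oppr_ge0 => h.
have : (B / (Q + 1)) ^+ 2 * (Q + 2) = 0.
  by apply/eqP; rewrite eq_le h mulr_ge0 ?sqr_ge0// addr_ge0.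
move/eqP; have Q2 : 0 < Q + 2 by rewrite ltr_wpDl.
by rewrite mulf_eq0 (gt_eqF Q2) orbF sqrf_eq0 mulf_eq0 invr_eq0 (gt_eqF Q1) orbF => /eqP.
Qed.

Lemma continuous_quadratic A :
  continuous (fun v : 'rV[R]_k => bilin A (v ord0) (v ord0)).
Proof.
apply: continuous_big => [|s _]; first exact: add_continuous.
apply: continuous_big => [|t _ v]; first exact: add_continuous.
have h i := @coord_continuous R 1 k ord0 i.
exact: (continuousM (continuousM (@cst_continuous _ _ (A s t) v) (h s v)) (h t v)).
Qed.

Variables (A : 'I_k -> 'I_k -> R) (alpha : 'I_k -> R).
Hypothesis symA : forall s t, A s t = A t s.
Hypothesis alpha_gt0 : forall s, 0 < alpha s.

Let N (s t : 'I_k) : R := if s == t then alpha s else 0.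

Let NE x y : bilin N x y = \sum_s alpha s * x s * y s.
Proof.
apply: eq_bigr => s _; rewrite (bigD1 s)//= big1 => [|t ts]; first by rewrite /N eqxx addr0.
by rewrite /N eq_sym (negbTE ts) !mul0r.
Qed.

Let wsq_ge0 s (z : R) : 0 <= alpha s * z * z.
Proof. by rewrite -mulrA mulr_ge0 ?(ltW (alpha_gt0 s))// -expr2 sqr_ge0. Qed.

Let inv_ge0 s : 0 <= (alpha s)^-1.
Proof. by rewrite invr_ge0 (ltW (alpha_gt0 s)). Qed.

Let symN s t : N s t = N t s.
Proof. by rewrite /N eq_sym; case: eqP => // ->. Qed.

Let N_ge0 x : 0 <= bilin N x x.
Proof. by rewrite NE sumr_ge0. Qed.

Let N_eq0 x : bilin N x x = 0 -> forall s, x s = 0.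
Proof.
rewrite NE => /eqP; rewrite psumr_eq0 => [/allP h s|s _]; last exact: wsq_ge0.
have := h s; rewrite mem_index_enum => /(_ isT)/=.
by rewrite -mulrA mulf_eq0 gt_eqF//= -expr2 sqrf_eq0 => /eqP.
Qed.

(** Compactness of the ellipsoid. *)
Lemma rayleigh_max : (0 < k)%N -> exists2 v : 'I_k -> R, bilin N v v = 1 &
  forall x, bilin N x x = 1 -> bilin A x x <= bilin A v v.
Proof.
move=> k0; pose M := 1 + \sum_s (alpha s)^-1.
have M1 : 1 <= M by rewrite lerDl sumr_ge0.
have sqM (z : R) : z ^+ 2 <= M ^+ 2 -> - M <= z <= M.
  move=> h; rewrite -ler_norml -(ler_pXn2r (n := 2)) ?nnegrE// ?(le_trans ler01)//.
  by rewrite real_normK ?num_real.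
pose D := [set v : 'rV[R]_k | bilin N (v ord0) (v ord0) = 1]%classic.
have cD : compact D.
  apply: (subclosed_compact _ (@rV_compact _ k (fun=> `[- M, M]%classic) _)) => //.
  - apply: (@closed_comp _ _ (fun v : 'rV[R]_k => bilin N (v ord0) (v ord0)) [set 1]%classic).
      by move=> v _; exact: continuous_quadratic.
    exact: closed_eq.
  - by move=> _; exact: segment_compact.
  - move=> v v1 s; pose z : R := v ord0 s.
    have h : alpha s * z ^+ 2 <= 1.
      rewrite -[leRHS]v1 NE (bigD1 s)//= expr2 mulrA lerDl.
      by apply: sumr_ge0 => t _; exact: wsq_ge0.
    have hz : z ^+ 2 <= (alpha s)^-1 by rewrite -[leRHS]mul1r ler_pdivlMr// mulrC.
    have aM : (alpha s)^-1 <= M.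
      rewrite /M ler_wpDl// (bigD1 s)//= lerDl.
      by apply: sumr_ge0 => t _; exact: inv_ge0.
    rewrite /= in_itv/=; apply: sqM; rewrite -/z (le_trans hz)// (le_trans aM)//.
    by rewrite expr2 ler_peMl// (le_trans ler01).
have nonempty : (D !=set0)%classic.
  pose s := Ordinal k0; exists (\row_t (if t == s then (Num.sqrt (alpha s))^-1 else 0)).
  rewrite /D/= NE (bigD1 s)//= big1 => [|t ts]; last by rewrite mxE (negbTE ts) mulr0.
  rewrite mxE eqxx addr0 -mulrA -expr2 exprVn sqr_sqrtr ?(ltW (alpha_gt0 s))// divff// gt_eqF//.
have [v vD vmax] := EVT_max_rV nonempty cD
  (continuous_subspaceT (@continuous_quadratic A)).
exists (v ord0); first by move: vD; rewrite inE.
move=> x x1; have := vmax (\row_s x s); rewrite inE /D/=.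
by rewrite (_ : (\row_s x s) ord0 = x) => [->//|]; apply/funext => s; rewrite mxE.
Qed.

(** The maximiser is a zero, hence a kernel vector, of the nonnegative form
    lam N - A. *)
Lemma rayleigh_eigen : (0 < k)%N -> exists v : 'I_k -> R, exists2 lam : R,
  (forall x, bilin A x x <= lam * \sum_s alpha s * x s ^+ 2) &
  (exists s, v s != 0) /\ forall s, \sum_t A s t * v t = lam * alpha s * v s.
Proof.
move=> k0; have [v v1 vmax] := rayleigh_max k0.
pose lam := bilin A v v.
have le x : bilin A x x <= lam * bilin N x x.
  have [x0|x0] := eqVneq (bilin N x x) 0.
    rewrite x0 mulr0; have xz : x = fun=> 0 by apply/funext => s; exact: N_eq0.
    by rewrite {}xz /bilin big1// => s _; rewrite big1// => t _; rewrite mulr0.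
  have xp : 0 < bilin N x x by rewrite lt_neqAle eq_sym x0 N_ge0.
  pose c := (Num.sqrt (bilin N x x))^-1.
  have c2 : c ^+ 2 = (bilin N x x)^-1 by rewrite exprVn sqr_sqrtr// (ltW xp).
  have := vmax (fun s => c * x s); rewrite !bilinZ c2 mulVf// => /(_ erefl).
  by rewrite mulrC ler_pdivrMr.
exists v, lam => [x|].
  by apply: (le_trans (le x)); rewrite NE; under eq_bigr do rewrite -mulrA -expr2.
split.
  apply/existsP; rewrite -negb_forall; apply/negP => /forallP h.
  move: v1; rewrite NE big1 => [/esym/eqP|s _]; first by rewrite oner_eq0.
  by have /eqP -> := h s; rewrite mulr0.
pose Q s t := lam * N s t - A s t.
have QE x y : bilin Q x y = lam * bilin N x y - bilin A x y.
  rewrite /bilin mulr_sumr -sumrB; apply: eq_bigr => s _.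
  rewrite mulr_sumr -sumrB; apply: eq_bigr => t _; rewrite /Q; ring.
move=> s; pose y t : R := (t == s)%:R.
have symQ a b : Q a b = Q b a by rewrite /Q symN symA.
have : bilin Q v y = 0.
  apply: bilin_kernel => // [z|]; first by rewrite QE subr_ge0.
  by rewrite QE v1 mulr1 subrr.
have AE : bilin A v y = \sum_t A s t * v t.
  rewrite bilinC// /bilin (bigD1 s)//= [X in _ + X]big1 ?addr0 => [|t ts].
    by apply: eq_bigr => t _; rewrite /y eqxx mulr1.
  by rewrite big1// => u _; rewrite /y (negbTE ts) mulr0 mul0r.
rewrite QE AE NE (bigD1 s)//= big1 => [|t ts]; last by rewrite /y (negbTE ts) mulr0.
by rewrite /y eqxx mulr1 addr0 mulrA => /eqP; rewrite subr_eq0 => /eqP.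
Qed.

End rayleigh.

Section spectral_radius.
Context {R : realType} {k : nat}.
Local Notation normc := ComplexField.Normc.normc.

Lemma normc_real (a : R) : normc (real_complex R a) = `|a|.
Proof. by rewrite /= expr0n/= addr0 sqrtr_sqr. Qed.

Lemma normc_sum (I : finType) (F : I -> R[i]) : normc (\sum_i F i) <= \sum_i normc (F i).
Proof.
elim/big_ind2: _ => [|x1 x2 y1 y2 h1 h2|//]; first by rewrite ComplexField.Normc.normc0.
by apply: le_trans (lerD h1 h2); exact: le_normcD.
Qed.

(** Sum the moduli of the entries in the equation of an eigenvector. *)
Lemma has_ubound_eigenvalue (A : 'M[R]_k) :
  has_ubound [set normc z | z in [set z : R[i] | eigenvalue (map_mx (real_complex R) A) z]]%classic.
Proof.
exists (\sum_j \sum_i `|A j i|) => _ [z /= /eigenvalueP[v vA v0] <-].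
have n0 (x : R[i]) : 0 <= normc x by case: x => a b; exact: sqrtr_ge0.
have pos : 0 < \sum_j normc (v ord0 j).
  rewrite lt_neqAle sumr_ge0 ?andbT// eq_sym; apply: contra v0 => /eqP h.
  apply/eqP/rowP => j; rewrite mxE; apply: ComplexField.Normc.eq0_normc.
  by apply/eqP; have := psumr_eq0P (fun i _ => n0 (v ord0 i)) h isT => ->.
rewrite -(ler_pM2r pos) mulr_sumr.
apply: (@le_trans _ _ (\sum_i \sum_j normc (v ord0 j) * `|A j i|)).
  apply: ler_sum => i _; rewrite -ComplexField.Normc.normcM.
  have /rowP/(_ i) := vA; rewrite !mxE => <-.
  apply: (le_trans (normc_sum _)); apply: ler_sum => j _.
  by rewrite ComplexField.Normc.normcM mxE normc_real.
rewrite exchange_big/= mulr_sumr; apply: ler_sum => j _.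
rewrite -mulr_sumr mulrC ler_wpM2r// [leRHS](bigD1 j)//= lerDl sumr_ge0// => i _.
by rewrite sumr_ge0.
Qed.

Variables (alpha : 'rV[R]_k) (Delta2 : 'M[R]_k).
Hypothesis k_gt0 : (0 < k)%N.
Hypothesis alpha_gt0 : forall s, 0 < alpha ord0 s.
Hypothesis Delta2_neq0 : Delta2 <> 0.
Hypothesis Delta2_sym : Delta2^T = Delta2.
Hypothesis Delta2_ge0 : forall s t, 0 <= Delta2 s t.

(** The matrix is symmetric for the weights alpha, so the maximum of its Rayleigh
    quotient is an eigenvalue. It is positive since the entries are nonnegative and
    not all zero. *)
Lemma spectral_radius_rayleigh :
  0 < spectral_radius (2 *: (diag_mx alpha *m Delta2)) /\
  forall S : 'I_k -> R, 2 * \sum_s \sum_t Delta2 s t * S s * S t <=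
    spectral_radius (2 *: (diag_mx alpha *m Delta2)) * \sum_s S s ^+ 2 / alpha ord0 s.
Proof.
have DC s t : Delta2 s t = Delta2 t s by rewrite -[in LHS]Delta2_sym mxE.
pose A s t := 2 * (alpha ord0 s * alpha ord0 t * Delta2 s t).
have symA s t : A s t = A t s by rewrite /A DC (mulrC (alpha ord0 s)).
have [v [lam hle [[s0 vs0] hv]]] := rayleigh_eigen symA alpha_gt0 k_gt0.
have lam0 : 0 < lam.
  have [/existsP[s /existsP[t st]]|] := boolP [exists s, [exists t, Delta2 s t != 0]]; last first.
    rewrite negb_exists => /forallP h; case: Delta2_neq0; apply/matrixP => s t.
    by have := h s; rewrite negb_exists mxE => /forallP/(_ t)/negPn/eqP.
  have A0 u w : 0 <= A u w by rewrite !mulr_ge0// ltW.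
  have : 0 < bilin A (fun=> 1) (fun=> 1).
    apply: (@lt_le_trans _ _ (A s t)).
      by rewrite !mulr_gt0// lt_neqAle eq_sym st Delta2_ge0.
    rewrite /bilin (bigD1 s)//= (bigD1 t)//= !mulr1 -addrA lerDl.
    apply: addr_ge0; first by apply: sumr_ge0 => w _; rewrite !mulr1.
    by apply: sumr_ge0 => u _; apply: sumr_ge0 => w _; rewrite !mulr1.
  move=> /lt_le_trans /(_ (hle _)); apply: contraTT; rewrite -!leNgt => h.
  rewrite mulr_le0_ge0// sumr_ge0// => u _; rewrite mulr_ge0 ?sqr_ge0//.
  by rewrite (ltW (alpha_gt0 u)).
have lam_le : lam <= spectral_radius (2 *: (diag_mx alpha *m Delta2)).
  apply: ub_le_sup; first exact: has_ubound_eigenvalue.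
  exists (real_complex R lam) => /=; last by rewrite expr0n/= addr0 sqrtr_sqr gtr0_norm.
  apply/eigenvalueP; exists (map_mx (real_complex R) (\row_s v s)).
    rewrite -map_mxM -map_mxZ; congr map_mx; apply/rowP => s; rewrite !mxE.
    apply: (mulfI (lt0r_neq0 (alpha_gt0 s))).
    transitivity (lam * alpha ord0 s * v s); last by ring.
    rewrite -hv mulr_sumr; apply: eq_bigr => t _; rewrite !mxE.
    rewrite (bigD1 t)//= big1 => [|u ut]; rewrite !mxE ?eqxx; last first.
      by rewrite eq_sym (negbTE ut) mul0r.
    by rewrite mulr1n addr0 /A (DC s); ring.
  apply/eqP => /rowP/(_ s0); rewrite !mxE => /(@complexI R)/eqP; exact/negP.
split; first exact: lt_le_trans lam_le.
move=> S; pose x s := S s / alpha ord0 s.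
have aV s : alpha ord0 s != 0 by exact: lt0r_neq0.
have -> : 2 * (\sum_s \sum_t Delta2 s t * S s * S t) = bilin A x x.
  rewrite mulr_sumr; apply: eq_bigr => s _; rewrite mulr_sumr; apply: eq_bigr => t _.
  by rewrite /A /x; field; rewrite !aV.
apply: (le_trans (hle x)).
have -> : \sum_s alpha ord0 s * x s ^+ 2 = \sum_s S s ^+ 2 / alpha ord0 s.
  by apply: eq_bigr => s _; rewrite /x; field.
rewrite ler_wpM2r// sumr_ge0// => s _; rewrite divr_ge0 ?sqr_ge0//.
by rewrite (ltW (alpha_gt0 s)).
Qed.

Lemma critical_betaE : critical_beta alpha Delta2 ^+ 2 =
   (spectral_radius (2 *: (diag_mx alpha *m Delta2)))^-1.
Proof.
rewrite /critical_beta; set rho := spectral_radius _.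
have [rho0 _] := spectral_radius_rayleigh.
rewrite -powR_mulrn ?powR_ge0// -powRrM (_ : - 2^-1 * 2%:R = -1); last by field.
by rewrite powR_inv1// ltW.
Qed.

End spectral_radius.

(** * Application to the multi-species model *)

Section species.
Context {R : realType} {k N : nat}.
Variables (sp : 'I_N -> 'I_k) (Delta2 : 'M[R]_k) (beta : R).
Hypothesis N_gt0 : (0 < N)%N.
Hypothesis Delta2_ge0 : forall s t, 0 <= Delta2 s t.
Local Notation conf := {ffun 'I_N -> bool}.
Implicit Types (rho sigma tau : conf).

Definition msk_coef (e : 'I_N * 'I_N) sigma : R :=
  beta / Num.sqrt N%:R * (sg (sigma e.1) * sg (sigma e.2)).
Definition msk_var (e : 'I_N * 'I_N) : R := Delta2 (sp e.1) (sp e.2).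
Local Notation kappa := (fun e => Num.sqrt (msk_var e)).
Local Notation overlap := (overlap msk_coef kappa).
Definition gauge_act rho sigma : conf := [ffun i => rho i (+) sigma i].
Local Notation S := (spin_sum sp (enum 'I_N)).
Local Notation size s := (count (fun i => sp i == s) (enum 'I_N)).

Lemma gauge_actK rho : involutive (gauge_act rho).
Proof. by move=> sigma; apply/ffunP => i; rewrite !ffunE addKb. Qed.

Lemma gauge_actC rho sigma : gauge_act rho sigma = gauge_act sigma rho.
Proof. by apply/ffunP => i; rewrite !ffunE addbC. Qed.

Lemma msk_coef_gauge rho e sigma : msk_coef e (gauge_act rho sigma) =
  sg (rho e.1 (+) rho e.2) * msk_coef e sigma.
Proof. by rewrite /msk_coef !ffunE /sg !signr_addb; ring. Qed.

Lemma sum_species (x : 'I_N -> R) (g : 'I_k -> R) :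
  \sum_i g (sp i) * x i = \sum_s g s * \sum_(i <- enum 'I_N | sp i == s) x i.
Proof.
rewrite (partition_big sp xpredT)//=; apply: eq_bigr => s _.
rewrite big_enum_cond mulr_sumr /=.
by apply: eq_bigr => i /eqP ->.
Qed.

(** The overlap is a function of the product of the two configurations, through its
    magnetisation in each species. *)
Lemma overlapE sigma tau : overlap sigma tau = beta ^+ 2 / N%:R *
  bilin (fun s t => Delta2 s t) (S (gauge_act sigma tau)) (S (gauge_act sigma tau)).
Proof.
set rho := gauge_act sigma tau.
transitivity (beta ^+ 2 / N%:R * \sum_i \sum_j Delta2 (sp i) (sp j) * sg (rho j) * sg (rho i)).
  rewrite pair_big/= mulr_sumr; apply: eq_bigr => -[i j] _ /=.
  have rE l : sg (rho l) = sg (sigma l) * sg (tau l) :> R by rewrite ffunE /sg signr_addb.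
  rewrite /msk_coef /msk_var /= !rE.
  set v := Delta2 _ _; set w := Num.sqrt v; set q := Num.sqrt N%:R.
  have -> : v = w ^+ 2 by rewrite sqr_sqrtr// /v Delta2_ge0.
  have n2 : N%:R = q ^+ 2 by rewrite sqr_sqrtr// ler0n.
  have q0 : q != 0 by rewrite -sqrf_eq0 -n2 pnatr_eq0 -lt0n.
  by rewrite n2; field.
congr (_ * _).
under eq_bigr do rewrite -mulr_suml.
under eq_bigr => i _ do rewrite (sum_species (fun j => sg (rho j)) (Delta2 (sp i))).
rewrite (sum_species (fun i => sg (rho i)) (fun s => \sum_t Delta2 s t * S rho t)).
apply: eq_bigr => s _; rewrite mulr_suml; apply: eq_bigr => t _.
by rewrite -/(S rho s); ring.
Qed.

Lemma norm_spin_sum rho s : `|S rho s| <= (size s)%:R :> R.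
Proof.
apply: (le_trans (ler_norm_sum _ _ _)).
under eq_bigr do rewrite norm_sg.
by rewrite -sum1_count natr_sum.
Qed.

Lemma overlap_le sigma tau : overlap sigma tau <= beta ^+ 2 * (\sum_s \sum_t Delta2 s t) * N%:R.
Proof.
have NR : 0 < N%:R :> R by rewrite ltr0n.
rewrite overlapE; set rho := gauge_act _ _.
have hS s : `|S rho s| <= N%:R :> R.
  apply: (le_trans (norm_spin_sum rho s)); rewrite ler_nat.
  by apply: (leq_trans (count_size _ _)); rewrite size_enum_ord.
have -> : beta ^+ 2 * (\sum_s \sum_t Delta2 s t) * N%:R =
    beta ^+ 2 / N%:R * \sum_s \sum_t Delta2 s t * N%:R * N%:R.
  under [X in _ = _ * X]eq_bigr do rewrite -!mulr_suml.
  by rewrite -!mulr_suml; field; rewrite gt_eqF.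
rewrite ler_wpM2l ?divr_ge0 ?sqr_ge0//.
apply: ler_sum => s _; apply: ler_sum => t _; rewrite -!mulrA ler_wpM2l//.
apply: (le_trans (ler_norm _)); rewrite normrM; exact: ler_pM.
Qed.

Section density.
Variables (alpha : 'rV[R]_k) (rho theta K : R).
Hypothesis alpha_gt0 : forall s, 0 < alpha ord0 s.
Hypothesis Delta2_psd : positive_semidefinite Delta2.
Hypothesis rho_gt0 : 0 < rho.
Hypothesis rayleigh : forall x : 'I_k -> R,
  2 * bilin (fun s t => Delta2 s t) x x <= rho * \sum_s x s ^+ 2 / alpha ord0 s.
Hypothesis theta_ge0 : 0 <= theta.
Hypothesis K_ge0 : 0 <= K.
Hypothesis beta2_le : beta ^+ 2 <= (1 + theta) / rho.
Hypothesis density : forall s, (size s)%:R <= N%:R * alpha ord0 s * (1 + K / N%:R).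

Lemma overlap_ge0 sigma tau : 0 <= overlap sigma tau.
Proof.
rewrite overlapE mulr_ge0 ?divr_ge0 ?sqr_ge0//.
set x := spin_sum _ _ _; have := Delta2_psd (\col_s x s).
rewrite (_ : (_ *m _) ord0 ord0 = bilin (fun s t => Delta2 s t) x x)//.
rewrite mxE /bilin exchange_big; apply: eq_bigr => t _; rewrite !mxE mulr_suml.
by apply: eq_bigr => s _; rewrite !mxE; ring.
Qed.

(** The relative excess over the critical value, from the temperature and from the
    densities of the species at size N. *)
Definition excess : R := (1 + theta) * (1 + K / N%:R) - 1.

(** At the critical temperature the Rayleigh bound leaves the coefficient 1/2 that a
    sum of independent signs can bear. *)
Lemma overlap_le_species sigma tau : overlap sigma tau <=
  2^-1 * (1 + excess) * \sum_s S (gauge_act sigma tau) s ^+ 2 / (size s)%:R.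
Proof.
have NR : 0 < N%:R :> R by rewrite ltr0n.
rewrite overlapE; set x := spin_sum _ _ _.
have b0 : 0 <= beta ^+ 2 / N%:R by rewrite divr_ge0 ?sqr_ge0.
have K1 : 0 <= 1 + K / N%:R by rewrite addr_ge0// divr_ge0.
have T1 : 0 <= 1 + theta by rewrite addr_ge0.
apply: (@le_trans _ _ (beta ^+ 2 / N%:R * (2^-1 * (rho * \sum_s x s ^+ 2 / alpha ord0 s)))).
  by rewrite ler_wpM2l// -[leLHS](mulKf (x := 2))// ler_wpM2l ?rayleigh.
apply: (@le_trans _ _ ((1 + theta) / rho / N%:R * (2^-1 * (rho * \sum_s x s ^+ 2 / alpha ord0 s)))).
  rewrite ler_wpM2r// ?ler_wpM2r ?invr_ge0 ?(ltW NR)//.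
  rewrite mulr_ge0// mulr_ge0 ?(ltW rho_gt0)// sumr_ge0// => s _.
  by rewrite divr_ge0 ?sqr_ge0// (ltW (alpha_gt0 s)).
rewrite (_ : _ * (2^-1 * _) = 2^-1 * (1 + theta) * (N%:R^-1 * \sum_s x s ^+ 2 / alpha ord0 s)).
  rewrite (_ : 1 + excess = (1 + theta) * (1 + K / N%:R)); last by rewrite /excess addrC subrK.
  rewrite -!mulrA ler_wpM2l// ler_wpM2l// !mulr_sumr; apply: ler_sum => s _.
  have [s0|s0] := posnP (size s).
    have -> : x s = 0.
      apply/eqP; rewrite -normr_le0; apply: (le_trans (norm_spin_sum _ s)).
      by rewrite s0.
    by rewrite expr0n/= !(mul0r, mulr0).
  have sR : 0 < (size s)%:R :> R by rewrite ltr0n.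
  rewrite mulrCA [leRHS]mulrCA ler_wpM2l ?sqr_ge0//.
  rewrite -invfM ler_pdivlMr// mulrC ler_pdivrMr ?mulr_gt0//.
  by apply: (le_trans (density s)); rewrite mulrC.
by field; rewrite !gt_eqF.
Qed.

(** Under the uniform measure the magnetisations of the species are independent sums
    of signs, and (1 - u / 2) (1 + excess) <= 1 - u / 4 keeps their exponential
    moments finite. *)
Lemma avg_expR_overlap_le (u : R) sigma : 0 < u -> u <= 1 -> excess <= u / 4 ->
  avg (fun tau => expR ((1 - u / 2) * overlap tau sigma)) <= (4 / u) ^+ k.
Proof.
move=> u0 u1 eu.
pose t := 1 - u / 2; have t0 : 0 <= t by rewrite /t; lra.
have ex0 : 0 <= 1 + excess.
  by rewrite /excess addrC subrK mulr_ge0 ?addr_ge0// divr_ge0.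
have te : t * (1 + excess) <= 1 - u / 4.
  apply: (@le_trans _ _ (t * (1 + u / 4))); first by rewrite ler_wpM2l// lerD2l.
  rewrite /t (_ : (1 - u / 2) * (1 + u / 4) = 1 - u / 4 - u ^+ 2 / 8); last by field.
  by rewrite gerBl divr_ge0// sqr_ge0.
pose l s := t * (2^-1 * (1 + excess)) / (size s)%:R.
have l0 s : 0 <= l s by rewrite divr_ge0// mulr_ge0// mulr_ge0.
have ln s : 2 * l s * (size s)%:R <= 1 - u / 4.
  have [s0|s0] := posnP (size s); first by rewrite s0 mulr0; lra.
  apply: le_trans te; rewrite /l le_eqVlt; apply/orP; left; apply/eqP.
  by field; rewrite pnatr_eq0 -lt0n.
have -> : (4 / u) ^+ k = \prod_(s < k) (4 / u) by rewrite prodr_const card_ord.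
apply: (@le_trans _ _ (\prod_s (1 - 2 * l s * (size s)%:R)^-1)); last first.
  have q s : u / 4 <= 1 - 2 * l s * (size s)%:R by have := ln s; lra.
  have u4 : 0 < u / 4 by rewrite divr_gt0.
  apply: ler_prod => s _; rewrite invr_ge0 (le_trans (ltW u4) (q s))/=.
  by rewrite -[leRHS]invf_div lef_pV2 ?posrE// (lt_le_trans u4).
apply: le_trans (avg_expR_square_le (enum_uniq 'I_N) l0 _); last first.
  by move=> s; apply: (le_lt_trans (ln s)); lra.
have gb : bijective (gauge_act^~ sigma).
  exists (gauge_act^~ sigma) => tau; rewrite [LHS]gauge_actC (gauge_actC tau).
    exact: gauge_actK.
  exact: gauge_actK.
rewrite [leRHS](avg_reindex _ gb); apply: le_avg => tau /=; rewrite ler_expR.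
apply: (le_trans (ler_wpM2l t0 (overlap_le_species tau sigma))).
rewrite mulrA mulr_sumr; apply: ler_sum => s _.
by rewrite le_eqVlt; apply/orP; left; apply/eqP; rewrite /l; ring.
Qed.

End density.
End species.

Section model.
Context {R : realType} {k : nat} {alpha : 'rV[R]_k} {Delta2 : 'M[R]_k}.
Variable M : MSK_model alpha Delta2.
Hypothesis k_gt0 : (0 < k)%N.
Hypothesis alpha_gt0 : forall s, 0 < alpha ord0 s.
Hypothesis Delta2_neq0 : Delta2 <> 0.
Hypothesis Delta2_sym : Delta2^T = Delta2.
Hypothesis Delta2_ge0 : forall s t, 0 <= Delta2 s t.
Hypothesis Delta2_psd : positive_semidefinite Delta2.
Local Notation rad := (spectral_radius (2 *: (diag_mx alpha *m Delta2))).
Local Notation D := (\sum_s \sum_t Delta2 s t).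

Lemma free_energyE N beta w : free_energy M N beta w =
  fe (msk_coef beta) (Xv (fun e w => disorder M e.1 e.2 w) w).
Proof.
rewrite /free_energy /fe /lse /gz; congr ln; apply: eq_bigr => sigma _; congr expR.
rewrite /hamiltonian /energy mulrA mulr_sumr.
under eq_bigr do rewrite mulr_sumr.
rewrite pair_big/=; apply: eq_bigr => -[i j] _.
by rewrite ffunE /msk_coef /spin /sg /=; ring.
Qed.

Lemma card_species N s :
  #|species_block M N s| = count (fun i => species M i == s) (enum 'I_N).
Proof.
by rewrite /species_block cardsE cardE enumT {1}/enum_mem size_filter.
Qed.

Lemma msk_variance_le (K theta beta : R) N p : (k <= N)%N -> 0 <= K -> 0 <= theta ->
  (forall s, `|#|species_block M N s|%:R / N%:R - alpha ord0 s| <= K * alpha ord0 s / N%:R) ->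
  beta ^+ 2 <= (1 + theta) / rad -> (0 < p)%N ->
  (1 < p)%N ==> (4 * p%:R * @excess R N theta K <= 1) ->
  ('V_(Prob M N)[free_energy M N beta] <=
    (2 * (k%:R * ln (4 * p%:R)) * ln p%:R + beta ^+ 2 * D * N%:R / p%:R)%:E)%E.
Proof.
move=> kN K0 th0 dens b2 p0 hp.
have N0 : (0 < N)%N by exact: leq_trans kN.
have NR : 0 < N%:R :> R by rewrite ltr0n.
have pR : 0 < p%:R :> R by rewrite ltr0n.
have p1 : 1 <= p%:R :> R by rewrite ler1n.
have [rho0 ray] := spectral_radius_rayleigh k_gt0 alpha_gt0 Delta2_neq0 Delta2_sym Delta2_ge0.
have dens' s : (count (fun i => species M i == s) (enum 'I_N))%:R <=
    N%:R * alpha ord0 s * (1 + K / N%:R) :> R.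
  rewrite -card_species; have := dens s; rewrite ler_distl => /andP[_].
  by rewrite ler_pdivrMr// => h; apply: (le_trans h); rewrite le_eqVlt; apply/orP; left; apply/eqP; field; rewrite gt_eqF.
pose sp := @species _ _ _ _ M N.
have L0 : 0 <= ln ((4 * p%:R : R) ^+ k).
  by apply: ln_ge0; apply: exprn_ege1; lra.
have v0 e : 0 <= msk_var sp Delta2 e by exact: Delta2_ge0.
have mX e : measurable_fun [set: Omega M N] (fun w => disorder M e.1 e.2 w).
  exact: measurable_funP.
have lawX (e : 'I_N * 'I_N) (B : set R) : measurable B ->
    Prob M N ((fun w => disorder M e.1 e.2 w) @^-1` B)%classic =
    centered_gaussian_law (msk_var sp Delta2 e) B.
  move=> mB; apply: (disorder_law (s := sp e.1) (t := sp e.2)) => //; by rewrite inE.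
have := gaussian_variance_le [ffun => true] (b := msk_coef beta) mX
  (@disorder_independent _ _ _ _ M N kN) v0 lawX p0 L0
  (overlap_ge0 sp beta N0 Delta2_ge0 Delta2_psd) (overlap_le sp beta N0 Delta2_ge0).
rewrite (_ : (fun w => fe _ _) = free_energy M N beta); last first.
  by apply/funext => w; rewrite free_energyE.
rewrite lnXn ?mulr_gt0// -[ln _ *+ k]mulr_natl; apply.
move=> r u n pu u1 r0.
have u0 : 0 < u by apply: lt_trans pu; rewrite invr_gt0.
rewrite mulr_natl -lnXn ?mulr_gt0//.
apply: (indep_coupled_le [ffun => true] (act := @gauge_act N)
    (chi := fun rho e => rho e.1 (+) rho e.2)).
- by move=> s; apply: inv_bij; exact: gauge_actK.
- move=> s; exists (@gauge_act N ^~ s) => tau; rewrite [LHS]gauge_actC (gauge_actC tau);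
    exact: gauge_actK.
- by move=> s e t; exact: msk_coef_gauge.
move=> s'.
apply: (le_trans (avg_expR_overlap_le N0 Delta2_ge0 alpha_gt0 rho0 _ th0 K0 b2 dens' s' u0 u1 _)).
- move=> x; apply: le_trans (ray x); rewrite le_eqVlt; apply/orP; left; apply/eqP.
  by rewrite /bilin.
- move: hp; have [p2 h|p2 _] := ltnP 1 p.
    rewrite ler_pdivlMr//; apply: le_trans (ltW pu).
    by rewrite -[leRHS]mul1r ler_pdivlMr//; move: h; lra.
  by move: pu; rewrite (_ : p = 1%N) ?invr1 ?ltNge ?u1//; apply/eqP; rewrite eqn_leq p2 p0.
rewrite lerXn2r ?nnegrE ?divr_ge0 ?mulr_ge0 ?ler0n ?(ltW u0)//.
rewrite ler_wpM2l// -[leRHS]invrK lef_pV2 ?posrE ?invr_gt0//.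
exact: ltW.
Qed.

(** The number of blocks p is of the order of the inverse of the excess: the
    logarithmic term is then of order at most (ln N)^2 + 1, and the remaining term
    of the order of N times the excess. *)
Lemma msk_variance_uniform (K0 Theta : R) : 0 <= Theta ->
  (forall N s, (k <= N)%N ->
     `|#|species_block M N s|%:R / N%:R - alpha ord0 s| <= K0 / N%:R) ->
  exists2 C : R, 0 < C & forall N theta beta, (k <= N)%N -> 0 <= theta <= Theta ->
    beta ^+ 2 <= (1 + theta) / rad ->
    ('V_(Prob M N)[free_energy M N beta] <=
      (C * (ln N%:R ^+ 2 + 1 + N%:R * theta))%:E)%E.
Proof.
move=> Th0 dens.
have [rho0 _] := spectral_radius_rayleigh k_gt0 alpha_gt0 Delta2_neq0 Delta2_sym Delta2_ge0.
pose K := 1 + `|K0| * \sum_s (alpha ord0 s)^-1.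
have ia s : 0 <= (alpha ord0 s)^-1 by rewrite invr_ge0 (ltW (alpha_gt0 s)).
have K1 : 1 <= K by rewrite lerDl mulr_ge0// sumr_ge0.
have K_ge0 : 0 <= K by exact: le_trans K1.
have D0 : 0 <= D by apply: sumr_ge0 => s _; apply: sumr_ge0.
pose C2 := 8 * (1 + Theta) ^+ 2 * K * D / rad.
have C20 : 0 <= C2 by apply: divr_ge0; last exact: ltW; apply: mulr_ge0 => //; apply: mulr_ge0 => //; apply: mulr_ge0 => //; apply: sqr_ge0.
have kR : 0 < k%:R :> R by rewrite ltr0n.
exists (8 * k%:R + C2) => [|N th beta kN /andP[th0 thT] b2].
  by rewrite ltr_wpDr// mulr_gt0.
have N0 : (0 < N)%N by exact: leq_trans kN.
have NR : 0 < N%:R :> R by rewrite ltr0n.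
pose eps := @excess R N th K.
have epsE : N%:R * eps = N%:R * th + (1 + th) * K.
  by rewrite /eps /excess; field; rewrite gt_eqF.
have Neps : 1 <= N%:R * eps.
  rewrite epsE ler_wpDl ?mulr_ge0 ?ler0n// (le_trans K1)// ler_peMl//.
  by rewrite lerDl.
have eps0 : 0 < eps by rewrite -(pmulr_rgt0 _ NR) (lt_le_trans ltr01).
pose x := (4 * eps)^-1.
have x0 : 0 < x by rewrite invr_gt0 mulr_gt0.
pose p := maxn 1 (Num.truncn x).
have p0 : (0 < p)%N by rewrite leq_max.
have pR : 0 < p%:R :> R by rewrite ltr0n.
have xp : x < 2 * p%:R.
  apply: (lt_le_trans (Num.Theory.truncnS_gt x)); rewrite -natrM ler_nat /p.
  by rewrite mul2n -addnn -addn1 leq_add ?leq_maxr ?leq_maxl.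
have ip : p%:R^-1 <= 8 * eps.
  rewrite -[leRHS]invrK lef_pV2 ?posrE ?invr_gt0 ?mulr_gt0//.
  rewrite (_ : (8 * eps)^-1 = x / 2); last by rewrite /x; field; rewrite gt_eqF.
  by rewrite ler_pdivrMr// mulrC ltW.
have xN : x <= N%:R.
  rewrite /x -[leRHS]invrK lef_pV2 ?posrE ?invr_gt0 ?mulr_gt0//.
  rewrite -(ler_pM2l NR) mulfV ?gt_eqF// mulrCA.
  lra.
have tx : (Num.truncn x)%:R <= x by rewrite Num.Theory.truncn_le ltW.
have pN : (p <= N)%N.
  by rewrite geq_max N0/= -(ler_nat R) (le_trans tx).
have hp : (1 < p)%N ==> (4 * p%:R * eps <= 1).
  apply/implyP => p1; have -> : p = Num.truncn x.
    by rewrite /p; apply/maxn_idPr; move: p1; rewrite /p leq_max ltnn => /ltnW.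
  rewrite mulrAC mulrC -ler_pdivlMr ?mulr_gt0// mul1r.
  exact: tx.
have dens' s : `|#|species_block M N s|%:R / N%:R - alpha ord0 s| <= K * alpha ord0 s / N%:R.
  apply: (le_trans (dens N s kN)); rewrite ler_pM2r ?invr_gt0//.
  apply: (le_trans (ler_norm _)); rewrite -ler_pdivrMr//.
  rewrite /K ler_wpDl// ler_wpM2l// (bigD1 s)//= lerDl sumr_ge0//.
apply: (le_trans (msk_variance_le kN K_ge0 th0 dens' b2 p0 hp)); rewrite lee_fin.
have l0 : 0 <= ln p%:R :> R by rewrite ln_ge0// ler1n.
have lN : ln p%:R <= ln N%:R :> R by rewrite ler_ln ?posrE// ler_nat.
have ln4 : ln 4 <= 3 :> R by have := @ln_le_subr1 R 4; rewrite ltr0n => /(_ isT); lra.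
have h1 : 2 * (k%:R * ln (4 * p%:R)) * ln p%:R <= 8 * k%:R * (ln N%:R ^+ 2 + 1) :> R.
  have lnE : ln (4 * p%:R) = ln 4 + ln p%:R :> R by apply: lnM; rewrite posrE.
  rewrite lnE.
  have : (ln 4 + ln p%:R) * ln p%:R <= (3 + ln N%:R) * ln N%:R :> R.
    by apply: ler_pM => //; [rewrite addr_ge0// ln_ge0// ler1n|exact: lerD].
  have : (3 + ln N%:R) * ln N%:R <= 4 * (ln N%:R ^+ 2 + 1) :> R.
    by have := sqr_ge0 (ln N%:R - 1 : R); have := sqr_ge0 (ln N%:R : R); nra.
  move=> h2 h3; have h := le_trans h3 h2.
  rewrite (_ : 2 * _ * _ = 2 * k%:R * ((ln 4 + ln p%:R) * ln p%:R)); last by ring.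
  rewrite (_ : 8 * k%:R * _ = 2 * k%:R * (4 * (ln N%:R ^+ 2 + 1))); last by ring.
  by rewrite ler_wpM2l// mulr_ge0// ltW.
have h2 : beta ^+ 2 * D * N%:R / p%:R <= C2 * (1 + N%:R * th).
  apply: (@le_trans _ _ ((1 + Theta) / rad * D * N%:R * (8 * eps))).
    apply: ler_pM; rewrite ?invr_ge0 ?ler0n//.
      by rewrite mulr_ge0// mulr_ge0// sqr_ge0.
    rewrite ler_wpM2r// ler_wpM2r//; apply: (le_trans b2).
    by rewrite ler_wpM2r ?invr_ge0 ?(ltW rho0)// lerD2l.
  rewrite (_ : _ * (8 * eps) = 8 * (1 + Theta) * D / rad * (N%:R * eps)); last by ring.
  rewrite (_ : C2 * _ = 8 * (1 + Theta) * D / rad * ((1 + Theta) * K * (1 + N%:R * th))).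
    rewrite ler_wpM2l ?divr_ge0 ?mulr_ge0 ?addr_ge0 ?(ltW rho0)// epsE.
    have TK : 1 + th <= 1 + Theta by rewrite lerD2l.
    have a1 : (1 + th) * K <= (1 + Theta) * K by rewrite ler_wpM2r.
    have a2 : 1 <= (1 + Theta) * K by rewrite (le_trans K1)// ler_peMl// lerDl.
    have Nt : 0 <= N%:R * th by rewrite mulr_ge0.
    have a3 := ler_wpM2r Nt a2; rewrite mul1r in a3.
    by rewrite [leRHS]mulrDr mulr1 addrC lerD.
  by rewrite /C2; ring.
apply: (le_trans (lerD h1 h2)).
have q1 : 0 <= ln N%:R ^+ 2 :> R by exact: sqr_ge0.
have q2 : 0 <= N%:R * th by rewrite mulr_ge0.
have e1 : 0 <= 8 * k%:R * (N%:R * th) by rewrite !mulr_ge0.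
have e2 : 0 <= C2 * ln N%:R ^+ 2 by rewrite mulr_ge0.
lra.
Qed.

End model.


Theorem theorem1p2 (R : realType) (k : nat) (alpha : 'rV[R]_k) (Delta2 : 'M[R]_k)
    (M : MSK_model alpha Delta2)
    (k_ge1 : (1 <= k)%N)
    (alpha_bounds : forall s : 'I_k, 0 < alpha ord0 s <= 1)
    (alpha_sum : \sum_(s < k) alpha ord0 s = 1)
    (Delta2_neq0 : Delta2 <> 0)
    (Delta2_sym : Delta2^T = Delta2)
    (Delta2_ge0 : forall s t : 'I_k, 0 <= Delta2 s t)
    (density_rate : exists K : R, forall (N : nat) (s : 'I_k), (k <= N)%N ->
       `|#|species_block M N s|%:R / N%:R - alpha ord0 s| <= K / N%:R)
    (Delta2_psd : positive_semidefinite Delta2) :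
  (exists C : R, 0 < C /\ forall N : nat, (k <= N)%N ->
     ('V_(Prob M N)[free_energy M N (critical_beta alpha Delta2)]
        <= (C * (ln N%:R ^+ 2 + 1))%:E)%E)
  /\
  (forall a d : R, 0 < a -> 0 < d ->
     exists C : R, 0 < C /\ forall N : nat, (k <= N)%N ->
       ('V_(Prob M N)[free_energy M N
            (Num.sqrt (critical_beta alpha Delta2 ^+ 2 + d * N%:R `^ (- a)))]
          <= (C * (ln N%:R ^+ 2 + N%:R `^ (1 - a)))%:E)%E).
Proof.
have alpha_gt0 s : 0 < alpha ord0 s by have /andP[] := alpha_bounds s.
have [K dens] := density_rate.
have [rho0 _] := spectral_radius_rayleigh k_ge1 alpha_gt0 Delta2_neq0 Delta2_sym Delta2_ge0.
have bc2 := critical_betaE k_ge1 alpha_gt0 Delta2_neq0 Delta2_sym Delta2_ge0.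
have var := msk_variance_uniform k_ge1 alpha_gt0 Delta2_neq0 Delta2_sym Delta2_ge0 Delta2_psd.
set rho := spectral_radius _ in rho0 bc2 var.
split.
  have [C C0 hC] := var M K 0 (lexx 0) dens.
  exists C; split => // N kN.
  have := hC N 0 (critical_beta alpha Delta2) kN; rewrite lexx => /(_ isT).
  by rewrite addr0 div1r bc2 mulr0 addr0; apply.
move=> a d a0 d0.
have rd0 : 0 < rho * d by exact: mulr_gt0.
have [C C0 hC] := var M K (rho * d) (ltW rd0) dens.
have ln2 : 0 < ln 2 :> R by rewrite ln_gt0// ltr1n.
pose c : R := 1 + (ln 2 ^+ 2)^-1.
have c0 : 0 < c by rewrite ltr_wpDr// invr_ge0 sqr_ge0.
exists (C * (1 + c + rho * d)); split.
  by rewrite mulr_gt0// ltr_wpDr ?(ltW rd0)// ltr_wpDl.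
move=> N kN.
have N1 : (1 <= N)%N by exact: leq_trans kN.
have NR : 0 < N%:R :> R by rewrite ltr0n.
have Na1 : N%:R `^ (- a) <= 1 :> R.
  have h : 1 <= N%:R :> R by rewrite ler1n.
  have na : - a <= 0 by rewrite oppr_le0 ltW.
  by have := ler_powR h na; rewrite powRr0.
have NNa : N%:R * N%:R `^ (- a) = N%:R `^ (1 - a) :> R.
  by rewrite -{1}(powRr1 (ltW NR)) -powRD// (gt_eqF NR) implybT.
have b0 : 0 <= d * N%:R `^ (- a) by rewrite mulr_ge0 ?(ltW d0)// powR_ge0.
(* The relative excess of beta^2 over its critical value is rho d N^(-a). *)
have := hC N (rho * (d * N%:R `^ (- a))) _ kN.
move=> /(_ (Num.sqrt (critical_beta alpha Delta2 ^+ 2 + d * N%:R `^ (- a)))).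
rewrite mulr_ge0 ?(ltW rho0)// ler_pM2l// -[leRHS]mulr1 ler_pM2l// Na1.
rewrite sqr_sqrtr; last by rewrite addr_ge0// sqr_ge0.
rewrite bc2 (_ : (1 + rho * (d * N%:R `^ (- a))) / rho = rho^-1 + d * N%:R `^ (- a)); last first.
  by field; rewrite gt_eqF.
move=> /(_ isT (lexx _))/le_trans; apply; rewrite lee_fin -mulrA ler_wpM2l ?(ltW C0)//.
have -> : N%:R * (rho * (d * N%:R `^ (- a))) = rho * d * N%:R `^ (1 - a).
  by rewrite -NNa; ring.
set l := (ln N%:R : R); set w := (N%:R `^ (1 - a) : R).
have w0 : 0 <= w by exact: powR_ge0.
have l0 : 0 <= l ^+ 2 by exact: sqr_ge0.
(* The constant term is absorbed by the power of N at N = 1, and by (ln N)^2 for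
   larger N. *)
have h1 : 1 <= c * (l ^+ 2 + w).
  have [N2|N2] := leqP 2 N.
    have ll : (ln 2 : R) ^+ 2 <= l ^+ 2.
      by rewrite lerXn2r ?nnegrE ?(ltW ln2) ?ln_ge0 ?ler1n// ler_ln ?posrE ?ler_nat.
    have l2 : 0 < ln 2 ^+ 2 :> R by rewrite exprn_gt0.
    apply: (@le_trans _ _ ((ln 2 ^+ 2)^-1 * l ^+ 2)); first by rewrite mulrC ler_pdivlMr// mul1r.
    apply: ler_pM => //; first by rewrite invr_ge0 ltW.
      by rewrite /c lerDr.
    by rewrite lerDl.
  have -> : w = 1 by rewrite /w (_ : N = 1%N) ?powR1//; apply/eqP; rewrite eqn_leq N1 -ltnS N2.
  have c1 : 1 <= c by rewrite lerDl invr_ge0 sqr_ge0.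
  by rewrite (le_trans c1)// ler_peMr ?(ltW c0)// lerDr.
have h2 : 0 <= rho * d * l ^+ 2 by rewrite mulr_ge0 ?(ltW rd0).
move: h1 h2; set q := rho * d; lra.
Qed.
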